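(* Let $O_F^+$ be of non-Kac type with a canonical $F$-matrix and let $\varphi:\mathbb{N}_0\to(0,\infty)$ be a function. Then the following are equivalent: (1) there is a constant $K>0$ such that $\|f\|_{C_r(O_F^+)}\le K\varphi(k)\|f\|_{L^2(O_F^+)}$ for all $k\in\mathbb{N}_0$ and all $f\in\mathrm{Pol}_k(O_F^+)$; (2) there is a constant $K'>0$ such that $\varphi(k)\ge K'\|F\|^{2k}$ for all $k\in\mathbb{N}_0$.
   Context: Canonical $F$-matrix: $N\ge 2$ and $F=\sum_{i=1}^N\lambda_i e_{i,N+1-i}\in M_N(\mathbb{R})$ with all $\lambda_i\neq 0$ real, $F^2=\pm\mathrm{Id}_N$, and for some integer $0\le m\le N/2$: $0<|\lambda_1|\le\cdots\le|\lambda_m|<1<|\lambda_{N-m+1}|\le\cdots\le|\lambda_N|$ and $|\lambda_j|=1$ for $m<j\le N-m$. Here $e_{ij}$ are matrix units and $\|F\|$ is the operator norm. The quantum group: $C(O_F^+)$ is the universal unital $C^*$-algebra generated by $u_{ij}$ ($1\le i,j\le N$) such that $u=\sum e_{ij}\otimes u_{ij}$ is unitary and $u=(F\otimes 1)u^c(F^{-1}\otimes 1)$, $u^c=\sum e_{ij}\otimes u_{ij}^*$; the comultiplication is $\Delta(u_{ij})=\sum_k u_{ik}\otimes u_{kj}$. $\mathrm{Pol}(O_F^+)$ is the unital $*$-algebra generated by the $u_{ij}$; $h$ is the Haar state, i.e. the unique state with $(\mathrm{id}\otimes h)\Delta=h(\cdot)1=(h\otimes\mathrm{id})\Delta$, faithful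 on $\mathrm{Pol}(O_F^+)$. $L^2(O_F^+)$ is the completion of $\mathrm{Pol}(O_F^+)$ for $\langle f,g\rangle=h(g^*f)$, and $\|f\|_{C_r(O_F^+)}$ is the operator norm of left multiplication by $f$ on $L^2(O_F^+)$. $O_F^+$ is of Kac type if and only if $F$ is unitary. Homogeneous polynomials: $u^{\otimes k}=\sum e_{i_1j_1}\otimes\cdots\otimes e_{i_kj_k}\otimes u_{i_1j_1}\cdots u_{i_kj_k}$. With $T=\sum_{j=1}^N e_j\otimes Fe_j$, $H_k\subseteq(\mathbb{C}^N)^{\otimes k}$ is the space of $\xi$ with $(\mathrm{id}^{\otimes i}\otimes T^*\otimes\mathrm{id}^{\otimes(k-2-i)})\xi=0$ for $0\le i\le k-2$ ($H_0=\mathbb{C}$, $H_1=\mathbb{C}^N$), $\iota_k$ is its inclusion, and $u^{(k)}=(\iota_k^*\otimes1)u^{\otimes k}(\iota_k\otimes1)$ is the $k$-th irreducible representation. $\mathrm{Pol}_k(O_F^+)$, the space of homogeneous polynomials of degree $k$, is the span of the matrix coefficients of $u^{(k)}$. *)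

(* Defs.v *)
From HB Require Import structures.
From mathcomp Require Import all_boot all_order all_algebra.
From mathcomp Require Import all_classical all_reals all_analysis.
From mathcomp Require Import complex.

Set Implicit Arguments.
Unset Strict Implicit.
Unset Printing Implicit Defensive.

Import Order.TTheory GRing.Theory Num.Theory.
Import numFieldNormedType.Exports ComplexField.Normc.
Local Open Scope classical_set_scope.
Local Open Scope complex_scope.
Local Open Scope ring_scope.

(* Unital C*-algebras over R[i].  The norm is a field of this structure because
   numDomainType already joins the ring and norm structures of the library, so
   that algType and normedModType have no further common extension. *)
HB.mixin Record isCStar (R : realType) A of GRing.Algebra R[i] A := {
  star : A -> A;
  starD : forall a b, star (a + b) = star a + star b;
  starZ : forall (c : R[i]) a, star (c *: a) = c^* *: star a;
  starM : forall a b, star (a * b) = star b * star a;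
  starK : involutive star;
  cnorm : A -> R;
  cnormD : forall a b, cnorm (a + b) <= cnorm a + cnorm b;
  cnormZ : forall (c : R[i]) a, cnorm (c *: a) = normc c * cnorm a;
  cnorm0_eq0 : forall a, cnorm a = 0 -> a = 0;
  cnormM : forall a b, cnorm (a * b) <= cnorm a * cnorm b;
  cnorm_star : forall a, cnorm (star a * a) = cnorm a ^+ 2;
  cnorm_complete : forall x : nat -> A,
    (forall e : R, 0 < e -> exists M : nat, forall m n : nat,
       (M <= m)%N -> (M <= n)%N -> cnorm (x m - x n) < e) ->
    exists a, forall e : R, 0 < e -> exists M : nat, forall n : nat,
      (M <= n)%N -> cnorm (x n - a) < e
}.

#[short(type="cstarType")]
HB.structure Definition CStar (R : realType) :=
  {A of isCStar R A & GRing.Algebra R[i] A}.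

Section FMatrix.
Variable R : realType.
Local Notation C := R[i].

(* Indices are shifted by one with respect to 1, ..., N: lam i is
   lambda_(i+1), and e_(i, N+1-i) sits in position (i, rev_ord i). *)
Definition canonical_F N (F : 'M[R]_N) : Prop :=
  exists lam : 'I_N -> R,
  [/\ F = \sum_(i < N) lam i *: delta_mx i (rev_ord i),
      forall i, lam i != 0,
      F *m F = 1%:M \/ F *m F = - 1%:M
    & exists m : nat,
      [/\ (m.*2 <= N)%N,
          forall i : 'I_N, (i < m)%N -> `|lam i| < 1,
          forall i : 'I_N, (N - m <= i)%N -> 1 < `|lam i|,
          forall i : 'I_N, (m <= i < N - m)%N -> `|lam i| = 1
        & forall i j : 'I_N, (i <= j)%N ->
            (j < m)%N || (N - m <= i)%N -> `|lam i| <= `|lam j|]].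

Definition l2norm n (x : 'cV[C]_n) : R :=
  Num.sqrt (\sum_(i < n) normc (x i 0) ^+ 2).

Definition opnorm n (M : 'M[C]_n) : R :=
  sup [set l2norm (M *m x) | x in [set x : 'cV[C]_n | l2norm x <= 1]].

(* A tensor xi of (C^N)^{\otimes k} is given by its coordinates xi w on the
   basis vectors e_(w 0) \otimes ... \otimes e_(w (k-1)). *)
Definition multi_index N k := {ffun 'I_k -> 'I_N}.
Definition tensor N k := {ffun multi_index N k -> C}.

Definition subst2 N k (w : multi_index N k) (i j : 'I_k) (a b : 'I_N) :
    multi_index N k :=
  [ffun l => if l == i then a else if l == j then b else w l].

(* The coordinate of T = \sum_j e_j \otimes F e_j on e_a \otimes e_b. *)
Definition Tvec N (F : 'M[C]_N) (a b : 'I_N) : C :=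
  \sum_(j < N) (a == j)%:R * (F *m delta_mx j (0 : 'I_1)) b 0.

(* H_k: the sum over a, b is the coordinate, at the restriction of w to the
   positions other than i and j = i + 1, of
   (id^{\otimes i} \otimes T^* \otimes id^{\otimes (k-2-i)}) xi. *)
Definition Hk N (F : 'M[C]_N) k (xi : tensor N k) : Prop :=
  forall (w : multi_index N k) (i j : 'I_k), j = i.+1 :> nat ->
    \sum_(a < N) \sum_(b < N) (Tvec F a b)^* * xi (subst2 w i j a b) = 0.

End FMatrix.

Section QuantumGroup.
Variables (R : realType) (N : nat).
Local Notation C := R[i].

(* The defining relations of C(O_F^+); conj_mx v is v^c and the transpose of
   v^c is the adjoint of v. *)
Definition conj_mx (B : cstarType R) (v : 'M[B]_N) : 'M[B]_N :=
  map_mx (@star R B) v.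

Definition scalar_mx_alg (B : cstarType R) (M : 'M[C]_N) : 'M[B]_N :=
  map_mx (fun c : C => c%:A) M.

Definition OF_relations (F : 'M[C]_N) (B : cstarType R) (v : 'M[B]_N) : Prop :=
  [/\ v *m (conj_mx v)^T = 1%:M,
      (conj_mx v)^T *m v = 1%:M
    & v = scalar_mx_alg B F *m conj_mx v *m scalar_mx_alg B (invmx F)].

Definition unital_star_subalg (B : cstarType R) (S : set B) : Prop :=
  [/\ S 1,
      forall a b, S a -> S b -> S (a + b),
      forall (c : C) a, S a -> S (c *: a),
      forall a b, S a -> S b -> S (a * b)
    & forall a, S a -> S (star a)].

Variable A : cstarType R.

(* The unital *-algebra generated by the entries of u. *)
Definition Pol (u : 'M[A]_N) : set A :=
  [set a | forall S : set A, unital_star_subalg S ->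
             (forall i j, S (u i j)) -> S a].

(* (A, u) is the universal unital C*-algebra generated by a solution of the
   relations.  The unital *-homomorphism is unique since Pol u is dense. *)
Definition is_COF (F : 'M[C]_N) (u : 'M[A]_N) : Prop :=
  [/\ OF_relations F u,
      forall (a : A) (e : R), 0 < e -> exists2 b, Pol u b & cnorm (a - b) < e
    & forall (B : cstarType R) (v : 'M[B]_N), OF_relations F v ->
        exists pi : {lrmorphism A -> B},
          (forall a, pi (star a) = star (pi a)) /\
          (forall i j, pi (u i j) = v i j)].

(* A finite sequence of pairs (a, b) stands for the sum of the a \otimes b in
   the algebraic tensor product; two of these sums are equal there exactly
   when no bilinear form distinguishes them. *)
Definition tens_eq (s t : seq (A * A)) : Prop :=
  forall beta : A -> A -> C,
    (forall a, scalar (beta a)) -> (forall b, scalar (beta^~ b)) ->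
    \sum_(p <- s) beta p.1 p.2 = \sum_(p <- t) beta p.1 p.2.

(* Delta a is a Sweedler decomposition \sum a_(1) \otimes a_(2) of the
   coproduct of a in Pol u; Delta is the unital *-homomorphism with
   u_ij |-> \sum_k u_ik \otimes u_kj.  Values outside Pol u are irrelevant. *)
Definition is_coproduct (u : 'M[A]_N) (Delta : A -> seq (A * A)) : Prop :=
  [/\ (forall a p, Pol u a -> p \in Delta a -> Pol u p.1 /\ Pol u p.2),
      [/\ tens_eq (Delta 1) [:: (1, 1)],
          forall a b, Pol u a -> Pol u b ->
            tens_eq (Delta (a + b)) (Delta a ++ Delta b)
        & forall (c : C) a, Pol u a ->
            tens_eq (Delta (c *: a)) [seq (c *: p.1, p.2) | p <- Delta a]],
      forall a b, Pol u a -> Pol u b ->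
        tens_eq (Delta (a * b))
          [seq (p.1 * q.1, p.2 * q.2) | p <- Delta a, q <- Delta b],
      forall a, Pol u a ->
        tens_eq (Delta (star a)) [seq (star p.1, star p.2) | p <- Delta a]
    & forall i j, tens_eq (Delta (u i j)) [seq (u i k, u k j) | k <- enum 'I_N]].

Definition is_state (h : {scalar A}) : Prop :=
  h 1 = 1 /\ forall a, 0 <= h (star a * a).

(* Invariance is required on the dense subalgebra Pol u, where the coproduct
   takes its values in the algebraic tensor product. *)
Definition is_Haar_state (u : 'M[A]_N) (Delta : A -> seq (A * A))
    (h : {scalar A}) : Prop :=
  [/\ is_state h,
      forall a, Pol u a -> \sum_(p <- Delta a) h p.2 *: p.1 = (h a)%:A,
      forall a, Pol u a -> \sum_(p <- Delta a) h p.1 *: p.2 = (h a)%:A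
    & forall a, Pol u a -> h (star a * a) = 0 -> a = 0].

Definition Kac_type (u : 'M[A]_N) (h : {scalar A}) : Prop :=
  forall a b, Pol u a -> Pol u b -> h (a * b) = h (b * a).

Definition L2norm (h : {scalar A}) (f : A) : R :=
  Num.sqrt (complex.Re (h (star f * f))).

(* Vectors of L^2(O_F^+) are represented by the Cauchy sequences of Pol u; the
   norm of such a vector is the limit of the norms. *)
Definition L2vec (u : 'M[A]_N) (h : {scalar A}) (x : nat -> A) : Prop :=
  (forall n, Pol u (x n)) /\
  forall e : R, 0 < e ->
    exists M : nat, forall m n : nat, (M <= m)%N -> (M <= n)%N ->
      L2norm h (x m - x n) < e.

Definition L2vec_norm (h : {scalar A}) (x : nat -> A) : R :=
  limn (fun n => L2norm h (x n)).

(* The operator norm of the left multiplication by f on L^2(O_F^+). *)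
Definition Crnorm (u : 'M[A]_N) (h : {scalar A}) (f : A) : R :=
  sup [set L2vec_norm h (fun n => f * x n)
      | x in [set x | L2vec u h x /\ L2vec_norm h x <= 1]].

Definition u_tensor (u : 'M[A]_N) k (v w : multi_index N k) : A :=
  \prod_(l < k) u (v l) (w l).

(* The matrix coefficient <u^(k) xi, eta> for xi, eta in H_k. *)
Definition coef_uk (u : 'M[A]_N) k (eta xi : tensor R N k) : A :=
  \sum_v \sum_w ((eta v)^* * xi w) *: u_tensor u v w.

Definition Polk (F : 'M[C]_N) (u : 'M[A]_N) (k : nat) : set A :=
  [set f | exists n (c : 'I_n -> C) (eta xi : 'I_n -> tensor R N k),
     (forall s, Hk F (eta s) /\ Hk F (xi s)) /\
     f = \sum_(s < n) c s *: coef_uk u (eta s) (xi s)].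

End QuantumGroup.

(* Main.v *)
Require Import Defs.
From HB Require Import structures.
From mathcomp Require Import all_boot all_order all_algebra.
From mathcomp Require Import all_classical all_reals all_analysis.
From mathcomp Require Import complex ring lra zify.

(* Write [r i] for N+1-i, so that l_i l_(r i) = eps = +-1, and let s be the
   square of the largest |l_i|, that is, of the operator norm of F.  The matrix
   coefficients of u^(k) are indexed by functions X(v, w) of two words of
   length k that are traceless in both words.  On the space of all finite sums
   of such functions (the Fock space) one writes down operators which satisfy
   the relations of C(O_F^+): the generator (i, j) acts by a creation operator,
   Wenzl's projection of e_i \otimes e_j \otimes X, plus an annihilation operator.
   Universality turns the vacuum vector into a state, invariance identifies it
   with h, and L^2(O_F^+) becomes the Fock space, with squared norm
   d_k^-1 \sum_(v, w) (\prod_i l_(v_i)^2) |X(v, w)|^2 in degree k, where d_k is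
   the quantum dimension.

   Upper bound: moving annihilation to the right writes left multiplication by
   a coefficient X of degree k as a sum over j <= k of operators that
   annihilate j letters and create k - j.  Each of them is bounded by s^j times
   the norm of X times a ratio of quantum dimensions, uniformly of order
   s^(k-j), and the coefficients in the sum are bounded by an Euler product,
   which converges because s > 1.

   Lower bound: for f = u_(11)^k the adjoint g = u_(NN)^k of f has norm s^k |f|
   in L^2, and |f|_r |g| >= |f g| >= h(f g) = |g|^2, where |f|_r is the operator
   norm.

   If all |l_i| are 1, the formula for h shows that it is tracial; this is how
   the non-Kac hypothesis enters. *)

Set Implicit Arguments.
Unset Strict Implicit.
Unset Printing Implicit Defensive.

Import Order.TTheory GRing.Theory Num.Theory.
Import numFieldNormedType.Exports ComplexField.Normc.
Local Open Scope classical_set_scope.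
Local Open Scope complex_scope.
Local Open Scope ring_scope.

(** * Moduli and pre-Hilbert spaces *)

(** The universal property of (A, u) can be applied only to C*-algebras, so the formal operators on
    the Fock space must first be proved bounded and be placed in one. Boundedness follows from the
    relations: a column of generators satisfies \sum_i u_ij^* u_ij = 1, so each generator is a
    contraction. The algebra consists of sesquilinear forms that are uniform limits of forms of
    adjointable operators; closing under such limits gives completeness, and the Hilbert space
    itself is never completed.

    The rate s^k without an additional factor k + 1 depends on a cancellation. After normalization
    the ratio of quantum dimensions in the term with j annihilations is bounded by a constant that
    does not depend on any degree. That term is therefore O(s^j) relative to the L^2 norm of f, and
    the sum over j is a geometric series dominated by j = k, where every letter annihilates.

    The Fock model and the formula for h are developed for s >= 1 rather than s > 1. This keeps the
    case where all |l_i| are 1 inside their scope, which is where the formula is used to contradict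
    the non-Kac hypothesis. *)

Section ComplexModulus.
Variable R : realType.
Implicit Types x y z : R[i].

Lemma normc_conj x : normc x^* = normc x.
Proof. by case: x => a b /=; rewrite sqrrN. Qed.

Lemma normc_triangle x y : normc (x + y) <= normc x + normc y.
Proof. exact: le_normcD. Qed.

Lemma normc_opp x : normc (- x) = normc x.
Proof. exact: normcN. Qed.

Lemma normc_nneg x : 0 <= normc x.
Proof. by case: x => a b; apply: sqrtr_ge0. Qed.

Lemma sqr_normcE x : normc x ^+ 2 = complex.Re (x * x^*).
Proof.
case: x => a b /=; rewrite sqr_sqrtr ?addr_ge0 ?sqr_ge0 //.
by rewrite mulrN opprK !expr2.
Qed.

Lemma mulc_conj x : x * x^* = (normc x ^+ 2)%:C.
Proof.
rewrite sqr_normcE; case: x => a b; rewrite /=.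
by apply/eqP; rewrite eq_complex /= eqxx; apply/eqP; ring.
Qed.

Lemma ReD x y : complex.Re (x + y) = complex.Re x + complex.Re y.
Proof. by case: x; case: y. Qed.

Lemma ReN x : complex.Re (- x) = - complex.Re x.
Proof. by case: x. Qed.

Lemma ReZ (r : R) x : complex.Re (r%:C * x) = r * complex.Re x.
Proof. by case: x => a b /=; rewrite mul0r subr0. Qed.

Lemma Re_conjc x : complex.Re x^* = complex.Re x.
Proof. by case: x. Qed.

Lemma Re_le_normc x : `|complex.Re x| <= normc x.
Proof.
case: x => a b /=; rewrite -sqrtr_sqr ler_wsqrtr // lerDl sqr_ge0 //.
Qed.

Lemma Im_le_normc x : `|complex.Im x| <= normc x.
Proof.
case: x => a b /=; rewrite -sqrtr_sqr ler_wsqrtr // lerDr sqr_ge0 //.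
Qed.

Lemma normc_le_ReIm x : normc x <= `|complex.Re x| + `|complex.Im x|.
Proof.
case: x => a b /=.
rewrite -(@ler_pXn2r _ 2) ?nnegrE ?sqrtr_ge0 ?addr_ge0 //.
rewrite sqr_sqrtr ?addr_ge0 ?sqr_ge0 // sqrrD !real_normK ?num_real //.
by rewrite -addrA [_ *+ 2 + _]addrC addrA lerDl mulrn_wge0 ?mulr_ge0.
Qed.

Lemma normc_real (r : R) : normc r%:C = `|r|.
Proof. by rewrite /= expr0n /= addr0 sqrtr_sqr. Qed.

Lemma castD (a b : R) : (a + b)%:C = a%:C + b%:C. Proof. exact: rmorphD. Qed.
Lemma castN (a : R) : (- a)%:C = - a%:C. Proof. exact: rmorphN. Qed.
Lemma castM (a b : R) : (a * b)%:C = a%:C * b%:C. Proof. exact: rmorphM. Qed.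
Lemma castX (a : R) n : (a ^+ n)%:C = a%:C ^+ n. Proof. exact: rmorphXn. Qed.
Lemma castV (a : R) : (a^-1)%:C = a%:C^-1. Proof. exact: fmorphV. Qed.
Lemma cast_nat n : (n%:R : R)%:C = n%:R. Proof. exact: rmorph_nat. Qed.
Definition castE := (castD, castN, castM, castX, castV, cast_nat).
Lemma cast_sum (I : Type) (r : seq I) (P : pred I) (f : I -> R) :
  (\sum_(i <- r | P i) f i)%:C = \sum_(i <- r | P i) (f i)%:C.
Proof. exact: rmorph_sum. Qed.

Lemma conj_realC (r : R) : (r%:C)^* = r%:C.
Proof. by apply/eqP; rewrite eq_complex /= oppr0 !eqxx. Qed.

Lemma complex_cauchy (z : nat -> R[i]) :
  (forall e : R, 0 < e -> exists M : nat, forall m n : nat,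
     (M <= m)%N -> (M <= n)%N -> normc (z m - z n) <= e) ->
  exists l, forall e : R, 0 < e -> exists M : nat, forall n : nat,
     (M <= n)%N -> normc (z n - l) <= e.
Proof.
move=> hz.
have real_case (f : nat -> R) :
    (forall m n, `|f m - f n| <= normc (z m - z n)) -> cvgn f.
  move=> hf; apply/cauchy_cvgP/cauchy_ballP => e e0.
  near_simpl; have [M hM] := hz (e / 2) ltac:(by rewrite divr_gt0).
  near=> m n => /=; rewrite /ball /=.
  apply: le_lt_trans (hf _ _) _.
  apply: le_lt_trans (hM _ _ _ _) _; last by lra.
    by near: m; exists M.
  by near: n; exists M.
have cRe : cvgn (fun n => complex.Re (z n)).
  by apply: real_case => m n; rewrite -ReN -ReD Re_le_normc.
have cIm : cvgn (fun n => complex.Im (z n)).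
  apply: real_case => m n; apply: le_trans (Im_le_normc _).
  by case: (z m); case: (z n).
exists (limn (fun n => complex.Re (z n)) +i* limn (fun n => complex.Im (z n))).
move=> e e0; have e2 : 0 < e / 2 by rewrite divr_gt0.
have /cvgrPdist_le /(_ _ e2) [M1 _ h1] := cRe.
have /cvgrPdist_le /(_ _ e2) [M2 _ h2] := cIm.
exists (maxn M1 M2) => n; rewrite geq_max => /andP[n1 n2].
apply: le_trans (normc_le_ReIm _) _; rewrite [e]splitr.
have {h1} := h1 n n1; have {h2} := h2 n n2; rewrite /= => h2 h1.
have -> : complex.Re (z n - (limn (fun n => complex.Re (z n)) +i* limn (fun n => complex.Im (z n)))) =
  complex.Re (z n) - limn (fun n => complex.Re (z n)) by case: (z n).
have -> : complex.Im (z n - (limn (fun n => complex.Re (z n)) +i* limn (fun n => complex.Im (z n)))) =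
  complex.Im (z n) - limn (fun n => complex.Im (z n)) by case: (z n).
by rewrite lerD // distrC.
Unshelve. all: by end_near.
Qed.

End ComplexModulus.

(** The distinguished unit vector excludes the zero space, on which the operators would form a ring
    with 1 = 0. For the Fock space it is the vacuum. *)
Record preHilbert (R : realType) := PreHilbert {
  ph_sort :> lmodType R[i];
  ip : ph_sort -> ph_sort -> R[i];
  ip_linear : forall (a : R[i]) x y z, ip (a *: x + y) z = a * ip x z + ip y z;
  ip_conj : forall x y, (ip x y)^* = ip y x;
  ip_ge0 : forall x, 0 <= ip x x;
  ph_vec : ph_sort;
  ip_vec : ip ph_vec ph_vec = 1
}.

Section PreHilbertTheory.
Variables (R : realType) (H : preHilbert R).
Local Notation C := R[i].
Implicit Types x y z : H.

Lemma ipD x y z : ip (x + y) z = ip x z + ip y z.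
Proof. by rewrite -[x]scale1r ip_linear mul1r scale1r. Qed.

Lemma ip0l z : ip (0 : H) z = 0.
Proof. by apply: (addrI (ip (0 : H) z)); rewrite -ipD addr0 addr0. Qed.

Lemma ipZ (a : C) x z : ip (a *: x) z = a * ip x z.
Proof. by rewrite -[a *: x]addr0 ip_linear ip0l addr0. Qed.

Lemma ipN x z : ip (- x) z = - ip x z.
Proof. by rewrite -scaleN1r ipZ mulN1r. Qed.

Lemma ipB x y z : ip (x - y) z = ip x z - ip y z.
Proof. by rewrite ipD ipN. Qed.

Lemma ipDr x y z : ip z (x + y) = ip z x + ip z y.
Proof. by rewrite -ip_conj ipD rmorphD /= !ip_conj. Qed.

Lemma ipZr (a : C) x z : ip z (a *: x) = a^* * ip z x.
Proof. by rewrite -ip_conj ipZ rmorphM /= !ip_conj. Qed.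

Lemma ipNr x z : ip z (- x) = - ip z x.
Proof. by rewrite -scaleN1r ipZr rmorphN rmorph1 mulN1r. Qed.

Lemma ipBr x y z : ip z (x - y) = ip z x - ip z y.
Proof. by rewrite ipDr ipNr. Qed.

Lemma ip_sum (I : Type) (r : seq I) (f : I -> H) z :
  ip (\sum_(i <- r) f i) z = \sum_(i <- r) ip (f i) z.
Proof.
by elim: r => [|i r IH]; rewrite ?big_nil ?ip0l // !big_cons ipD IH.
Qed.

Definition phnorm x : R := Num.sqrt (complex.Re (ip x x)).

Lemma Re_ip_ge0 x : 0 <= complex.Re (ip x x).
Proof. by have := ip_ge0 x; rewrite lecE => /andP[]. Qed.

Lemma ip_self x : ip x x = (phnorm x ^+ 2)%:C.
Proof.
rewrite sqr_sqrtr ?Re_ip_ge0 //.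
have := ip_ge0 x; rewrite lecE => /andP[/eqP /= h _].
by case: (ip x x) h => a b /= ->.
Qed.

Lemma phnorm_ge0 x : 0 <= phnorm x.
Proof. exact: sqrtr_ge0. Qed.

Lemma phnorm_vec : phnorm (ph_vec H) = 1.
Proof. by rewrite /phnorm ip_vec sqrtr1. Qed.

Lemma cauchy_schwarz x y : normc (ip x y) <= phnorm x * phnorm y.
Proof.
set c := ip x y; set g := normc c ^+ 2.
have key (s : R) : 0 <= phnorm x ^+ 2 - 2 * s * g + s ^+ 2 * g * phnorm y ^+ 2.
  have := Re_ip_ge0 (x - (s%:C * c) *: y).
  suff -> : ip (x - (s%:C * c) *: y) (x - (s%:C * c) *: y) =
     (phnorm x ^+ 2 - 2 * s * g + s ^+ 2 * g * phnorm y ^+ 2)%:C by [].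
  have cc : c * c^* = g%:C := mulc_conj c.
  clearbody g.
  rewrite ipB !ipBr !ipZ !ipZr -(ip_conj x y) -/c !ip_self.
  have -> : (s%:C * c)^* = s%:C * c^* by rewrite rmorphM /= conj_realC.
  rewrite !castE -cc; ring.
rewrite -(@ler_pXn2r _ 2) ?nnegrE ?mulr_ge0 ?phnorm_ge0 ?normc_nneg // -/g.
rewrite exprMn.
have g0 : 0 <= g by rewrite sqr_ge0.
(* The form may be degenerate. If |y| = 0, the quadratic in s becomes affine, and the s chosen below
   would give it the value -1 unless g = 0. *)
have [y0|y0] := eqVneq (phnorm y ^+ 2) 0.
  rewrite y0 mulr0 leNgt; apply/negP => gp.
  have := key ((phnorm x ^+ 2 + 1) / (2 * g)).
  rewrite y0 mulr0 addr0.
  have -> : 2 * ((phnorm x ^+ 2 + 1) / (2 * g)) * g = phnorm x ^+ 2 + 1.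
    by field; rewrite gt_eqF.
  by rewrite opprD addrA subrr sub0r oppr_ge0 ler10.
have yp : 0 < phnorm y ^+ 2 by rewrite lt_neqAle eq_sym y0 sqr_ge0.
have := key (phnorm y ^+ 2)^-1.
have -> : phnorm x ^+ 2 - 2 * (phnorm y ^+ 2)^-1 * g +
   (phnorm y ^+ 2)^-1 ^+ 2 * g * phnorm y ^+ 2 = phnorm x ^+ 2 - g / phnorm y ^+ 2.
  by field; rewrite -sqrf_eq0.
by rewrite subr_ge0 ler_pdivrMr.
Qed.

Lemma phnormD x y : phnorm (x + y) <= phnorm x + phnorm y.
Proof.
rewrite -(@ler_pXn2r _ 2) ?nnegrE ?addr_ge0 ?phnorm_ge0 //.
have -> : phnorm (x + y) ^+ 2 =
    phnorm x ^+ 2 + 2 * complex.Re (ip x y) + phnorm y ^+ 2.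
  rewrite !sqr_sqrtr ?Re_ip_ge0 // ipD !ipDr !ReD.
  by rewrite -(ip_conj x y) Re_conjc; ring.
have := le_trans (ler_norm _) (le_trans (Re_le_normc (ip x y)) (cauchy_schwarz x y)).
by rewrite sqrrD; lra.
Qed.

Lemma phnormZ (a : C) x : phnorm (a *: x) = normc a * phnorm x.
Proof.
apply/eqP; rewrite -(@eqrXn2 _ 2) ?mulr_ge0 ?phnorm_ge0 ?normc_nneg //.
rewrite exprMn sqr_sqrtr ?Re_ip_ge0 // ipZ ipZr mulrA mulc_conj ReZ.
by rewrite [in X in _ == X]sqr_sqrtr ?Re_ip_ge0.
Qed.

Lemma phnorm0 : phnorm (0 : H) = 0.
Proof. by rewrite /phnorm ip0l sqrtr0. Qed.

Lemma phnorm_le_of_ip x (M : R) : 0 <= M ->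
  phnorm x ^+ 2 <= M * phnorm x -> phnorm x <= M.
Proof.
move=> M0; rewrite expr2; have [->//|x0] := eqVneq (phnorm x) 0.
by rewrite ler_pM2r // lt_neqAle eq_sym x0 phnorm_ge0.
Qed.

End PreHilbertTheory.

(** * The C*-algebra generated by the adjointable bounded operators *)
Section FormAlgebra.
Variables (R : realType) (H : preHilbert R).
Local Notation C := R[i].
Local Notation form := (H -> H -> C^o).
Implicit Types (x y : H) (b c p : form) (T S : H -> H).

Definition adjoint T S := forall x y, ip (T x) y = ip x (S y).
Definition bounded_by T (K : R) := forall x, phnorm (T x) <= K * phnorm x.
Definition bounded_op T := exists2 K : R, 0 <= K & bounded_by T K.
Definition adjointable T S := [/\ adjoint T S, bounded_op T & bounded_op S].

Definition approx b T (e : R) :=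
  forall x y, normc (b x y - ip (T x) y) <= e * (phnorm x * phnorm y).
Definition form_bound b (K : R) :=
  forall x y, normc (b x y) <= K * (phnorm x * phnorm y).

Definition op_form T : form := fun x y => ip (T x) y.
Definition form_star b : form := fun x y => (b y x)^*.

(* A bounded form is the sesquilinear form (x, y) |-> <T x, y> of an operator
   T on the completion of H; keeping the form only avoids that completion. *)
Definition limit_form b :=
  forall e : R, 0 < e -> exists T S, adjointable T S /\ approx b T e.

(** The cap [e <= 1] allows a quadratic error e^2 to be charged to the linear term. *)
Lemma ler_eps_lin (a b c : R) : 0 <= c ->
  (forall e, 0 < e -> e <= 1 -> a <= b + e * c) -> a <= b.
Proof.
move=> c0 h; apply/ler_addgt0Pr => e e0.
pose d := Num.min 1 (e / (c + 1)).
have d0 : 0 < d by rewrite lt_min ltr01 divr_gt0 // ltr_wpDl.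
have d1 : d <= 1 by rewrite ge_min lexx.
apply: le_trans (h d d0 d1) _; rewrite lerD2l.
have : d <= e / (c + 1) by rewrite ge_min lexx orbT.
rewrite ler_pdivlMr ?ltr_wpDl // => h'; apply: le_trans h'.
by rewrite ler_pM2l // lerDl.
Qed.

Lemma nn_ge0 x y : 0 <= phnorm x * phnorm y.
Proof. by rewrite mulr_ge0 ?phnorm_ge0. Qed.

Lemma approx_mono b T d e : d <= e -> approx b T d -> approx b T e.
Proof. by move=> de h x y; apply: le_trans (h x y) _; rewrite ler_wpM2r ?nn_ge0. Qed.

Lemma approx_refl T e : 0 <= e -> approx (op_form T) T e.
Proof.
by move=> e0 x y; rewrite subrr /= expr0n /= addr0 sqrtr0 mulr_ge0 ?nn_ge0.
Qed.

Lemma approxD b c T S d e : approx b T d -> approx c S e ->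
  approx (b + c) (fun x => T x + S x) (d + e).
Proof.
move=> hb hc x y.
have -> : (b + c) x y = b x y + c x y by [].
rewrite ipD opprD addrACA mulrDl.
by apply: le_trans (normc_triangle _ _) _; apply: lerD.
Qed.

Lemma approxZ (a : C) b T d : approx b T d ->
  approx (a *: b) (fun x => a *: T x) (normc a * d).
Proof.
move=> hb x y; have -> : (a *: b) x y = a * b x y by [].
by rewrite ipZ -mulrBr normcM -mulrA ler_wpM2l ?normc_nneg.
Qed.

Lemma approx_star b T S d : adjoint T S -> approx b T d ->
  approx (form_star b) S d.
Proof.
move=> h hb x y; rewrite /form_star -normc_conj rmorphB /= conjCK ip_conj -h.
by rewrite [phnorm x * _]mulrC.
Qed.

Lemma adjoint_sym T S : adjoint T S -> adjoint S T.
Proof. by move=> h x y; rewrite -ip_conj -h ip_conj. Qed.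

Lemma adjointable_sym T S : adjointable T S -> adjointable S T.
Proof. by case=> h1 h2 h3; split=> //; apply: adjoint_sym. Qed.

Lemma adjointable_id : adjointable id id.
Proof.
have bi : bounded_op id by exists 1 => // x; rewrite mul1r.
by split.
Qed.

Lemma bounded_opD T S : bounded_op T -> bounded_op S ->
  bounded_op (fun x => T x + S x).
Proof.
move=> [K K0 hK] [L L0 hL]; exists (K + L); first by rewrite addr_ge0.
by move=> x /=; apply: le_trans (phnormD _ _) _; rewrite mulrDl lerD.
Qed.

Lemma bounded_opZ (a : C) T : bounded_op T -> bounded_op (fun x => a *: T x).
Proof.
move=> [K K0 hK]; exists (normc a * K); first by rewrite mulr_ge0 ?normc_nneg.
by move=> x /=; rewrite phnormZ -mulrA ler_wpM2l ?normc_nneg.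
Qed.

Lemma bounded_op_comp T S : bounded_op T -> bounded_op S ->
  bounded_op (T \o S).
Proof.
move=> [K K0 hK] [L L0 hL]; exists (K * L); first by rewrite mulr_ge0.
by move=> x /=; apply: le_trans (hK _) _; rewrite -mulrA ler_wpM2l.
Qed.

Lemma adjointableD T T' S S' : adjointable T T' -> adjointable S S' ->
  adjointable (fun x => T x + S x) (fun x => T' x + S' x).
Proof.
move=> [h1 h2 h3] [g1 g2 g3]; split; try exact: bounded_opD.
by move=> x y; rewrite ipD ipDr h1 g1.
Qed.

Lemma adjointableZ (a : C) T T' : adjointable T T' ->
  adjointable (fun x => a *: T x) (fun x => a^* *: T' x).
Proof.
move=> [h1 h2 h3]; split; try exact: bounded_opZ.
by move=> x y; rewrite ipZ ipZr conjCK h1.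
Qed.

Lemma adjointable_comp T T' S S' : adjointable T T' -> adjointable S S' ->
  adjointable (T \o S) (S' \o T').
Proof.
move=> [h1 h2 h3] [g1 g2 g3]; split; try exact: bounded_op_comp.
by move=> x y; rewrite /= h1 g1.
Qed.

Lemma limit_form_op T S : adjointable T S -> limit_form (op_form T).
Proof. by move=> h e e0; exists T, S; split=> //; apply/approx_refl/ltW. Qed.

Lemma limit_formD b c : limit_form b -> limit_form c -> limit_form (b + c).
Proof.
move=> hb hc e e0; have e2 : 0 < e / 2 by rewrite divr_gt0.
have [T [T' [h1 h2]]] := hb _ e2; have [S [S' [g1 g2]]] := hc _ e2.
exists (fun x => T x + S x), (fun x => T' x + S' x); split.
  exact: adjointableD.
by rewrite [e]splitr; apply: approxD.
Qed.

Lemma limit_formZ (a : C) b : limit_form b -> limit_form (a *: b).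
Proof.
move=> hb e e0; have d0 : 0 < e / (normc a + 1).
  by rewrite divr_gt0 // ltr_wpDl ?normc_nneg.
have [T [T' [h1 h2]]] := hb _ d0.
exists (fun x => a *: T x), (fun x => a^* *: T' x); split.
  exact: adjointableZ.
apply: (@approx_mono _ _ (normc a * (e / (normc a + 1)))); last exact: approxZ.
rewrite mulrCA ger_pMr //.
by rewrite ler_pdivrMr ?ltr_wpDl ?normc_nneg // mul1r lerDl.
Qed.

Lemma limit_form_star b : limit_form b -> limit_form (form_star b).
Proof.
move=> hb e e0; have [T [S [h1 h2]]] := hb e e0.
exists S, T; split; first exact: adjointable_sym.
by apply: approx_star h2; case: h1.
Qed.

Lemma limit_form_bound b : limit_form b -> exists2 K, 0 <= K & form_bound b K.
Proof.
move=> /(_ 1 ltr01) [T [S [[h1 [K K0 hK] h3] h2]]].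
exists (1 + K) => [|x y]; first by rewrite addr_ge0.
rewrite -[b x y](subrK (ip (T x) y)) mulrDl.
apply: le_trans (normc_triangle _ _) _; apply: lerD; first exact: h2.
by apply: le_trans (cauchy_schwarz _ _) _; rewrite mulrA ler_wpM2r ?phnorm_ge0.
Qed.

(** Testing the form against y = T x bounds T, and the adjoint relation gives the same bound for S.
    The bound depends on b and d only, hence is uniform over all approximants. *)
Lemma approx_bound b T S K d : 0 <= K -> 0 <= d -> form_bound b K ->
  adjointable T S -> approx b T d ->
  bounded_by T (K + d) /\ bounded_by S (K + d).
Proof.
move=> K0 d0 hb [hTS _ _] hT.
have key x y : normc (ip (T x) y) <= (K + d) * (phnorm x * phnorm y).
  have -> : ip (T x) y = b x y - (b x y - ip (T x) y) by rewrite opprB addrC subrK.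
  apply: le_trans (normc_triangle _ _) _; rewrite normc_opp mulrDl.
  by apply: lerD.
have sq z : phnorm z ^+ 2 = normc (ip z z).
  by rewrite ip_self normc_real ger0_norm ?sqr_ge0.
split=> x; apply: phnorm_le_of_ip; rewrite ?mulr_ge0 ?addr_ge0 ?phnorm_ge0 //.
  by rewrite sq -mulrA.
by rewrite sq -hTS; apply: le_trans (key _ _) _; rewrite -mulrA [phnorm x * _]mulrC.
Qed.

Lemma approx_eq b c : (forall e, 0 < e -> exists2 T, approx b T e & approx c T e) ->
  b = c.
Proof.
move=> h; apply/funext => x; apply/funext => y.
apply/eqP; rewrite -subr_eq0; apply/eqP/eq0_normc/eqP.
rewrite eq_le normc_nneg andbT.
apply: (@ler_eps_lin _ _ (2 * (phnorm x * phnorm y))) => [|e e0 _].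
  by rewrite mulr_ge0 ?nn_ge0.
have [T h1 h2] := h e e0; rewrite add0r mulrCA mulrDl mul1r.
rewrite -[b x y](subrK (ip (T x) y)) -addrA.
apply: le_trans (normc_triangle _ _) _; apply: lerD; first exact: h1.
by rewrite -normc_opp opprB; apply: h2.
Qed.

Lemma approx2 b T S d e x y : approx b T d -> approx b S e ->
  normc (ip (T x) y - ip (S x) y) <= (d + e) * (phnorm x * phnorm y).
Proof.
move=> h1 h2.
have -> : ip (T x) y - ip (S x) y =
  - (b x y - ip (T x) y) + (b x y - ip (S x) y) by ring.
apply: le_trans (normc_triangle _ _) _; rewrite normc_opp mulrDl.
by apply: lerD.
Qed.

(** Write T S - U W = (T - U) S + U (S - W) and move U to the other side as its adjoint. The uniform
    bounds L + 1 for S and K + 1 for U' add up to K + L + 2. *)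
Lemma approx_comp b c K L d e T T' S S' U U' W W' x y : 0 <= K -> 0 <= L ->
  0 <= d <= 1 -> 0 <= e <= 1 -> form_bound b K -> form_bound c L ->
  adjointable T T' -> adjointable S S' -> adjointable U U' -> adjointable W W' ->
  approx b T d -> approx c S d -> approx b U e -> approx c W e ->
  normc (ip (T (S x)) y - ip (U (W x)) y) <=
    (d + e) * (K + L + 2) * (phnorm x * phnorm y).
Proof.
move=> K0 L0 /andP[d0 d1] /andP[e0 e1] hb hc aT aS aU aW hT hS hU hW.
have [bS _] := approx_bound L0 d0 hc aS hS.
have [_ bU] := approx_bound K0 e0 hb aU hU.
have -> : ip (T (S x)) y - ip (U (W x)) y =
  (ip (T (S x)) y - ip (U (S x)) y) + (ip (S x) (U' y) - ip (W x) (U' y)).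
  by case: aU => aU _ _; rewrite -!aU; ring.
apply: le_trans (normc_triangle _ _) _.
have h1 := approx2 (S x) y hT hU; have h2 := approx2 x (U' y) hS hW.
have n1 : phnorm (S x) * phnorm y <= (L + 1) * (phnorm x * phnorm y).
  rewrite mulrA ler_wpM2r ?phnorm_ge0 //; apply: le_trans (bS x) _.
  by rewrite ler_wpM2r ?phnorm_ge0 // lerD2l.
have n2 : phnorm x * phnorm (U' y) <= (K + 1) * (phnorm x * phnorm y).
  rewrite mulrCA ler_wpM2l ?phnorm_ge0 //; apply: le_trans (bU y) _.
  by rewrite ler_wpM2r ?phnorm_ge0 // lerD2l.
have de : 0 <= d + e by rewrite addr_ge0.
apply: le_trans (lerD h1 h2) _.
have -> : (d + e) * (K + L + 2) * (phnorm x * phnorm y) =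
  (d + e) * ((L + 1) * (phnorm x * phnorm y)) +
  (d + e) * ((K + 1) * (phnorm x * phnorm y)) by ring.
by apply: lerD; rewrite ler_wpM2l.
Qed.

(** The product is characterized through all sufficiently good approximants instead of one chosen
    sequence. An algebraic identity then follows by selecting approximants that serve both of its
    sides. *)
Definition is_form_mul b c p := forall e, 0 < e -> exists2 d, 0 < d &
  forall T T' S S', adjointable T T' -> adjointable S S' ->
    approx b T d -> approx c S d -> approx p (T \o S) e.

(** For approximants T_n, S_n of precision 1/(n+1), the numbers <T_n S_n x, y> form a Cauchy
    sequence by [approx_comp]; the product is their limit. The same estimate compares it with any
    other pair of approximants. *)
Lemma form_mul_exists b c : limit_form b -> limit_form c ->
  exists p, is_form_mul b c p.
Proof.
move=> lb lc.
have [K K0 hK] := limit_form_bound lb; have [L L0 hL] := limit_form_bound lc.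
have eps0 n : 0 < (n.+1%:R : R)^-1 by rewrite invr_gt0 ltr0Sn.
have eps1 n : (n.+1%:R : R)^-1 <= 1 by rewrite invf_le1 ?ltr0Sn // ler1n.
have eps01 n : 0 <= (n.+1%:R : R)^-1 <= 1 by rewrite eps1 ltW.
have /choice [T hT] n := lb _ (eps0 n).
have /choice [T' hT'] := hT.
have /choice [S hS] n := lc _ (eps0 n).
have /choice [S' hS'] := hS.
pose z x y n := ip (T n (S n x)) y.
pose D := K + L + 2.
have D0 : 0 <= D by rewrite !addr_ge0.
have zle x y m n : normc (z x y m - z x y n) <=
    (m.+1%:R^-1 + n.+1%:R^-1) * D * (phnorm x * phnorm y).
  have [[a1 a2] [b1 b2]] := (hT' m, hS' m).
  have [[c1 c2] [d1 d2]] := (hT' n, hS' n).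
  exact: (approx_comp x y K0 L0 (eps01 m) (eps01 n) hK hL a1 b1 c1 d1).
have small (e : R) : 0 < e -> exists M : nat, forall n, (M <= n)%N ->
    n.+1%:R^-1 <= e.
  move=> e0; exists (Num.truncn e^-1) => n hn.
  rewrite -[e]invrK lef_pV2 ?posrE ?ltr0Sn ?invr_gt0 //.
  have := truncnS_gt e^-1; move/ltW/le_trans; apply.
  by rewrite ler_nat.
have zc x y : exists l, forall e : R, 0 < e -> exists M : nat, forall n : nat,
     (M <= n)%N -> normc (z x y n - l) <= e.
  apply: complex_cauchy => e e0.
  pose E := 2 * D * (phnorm x * phnorm y) + 1.
  have E0 : 0 < E by rewrite ltr_wpDl // !mulr_ge0 ?phnorm_ge0.
  have [M hM] := small (e / E) ltac:(by rewrite divr_gt0).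
  exists M => m n hm hn; apply: le_trans (zle x y m n) _.
  have h : m.+1%:R^-1 + n.+1%:R^-1 <= 2 * (e / E).
    by rewrite mulrDl mul1r lerD ?hM.
  apply: (@le_trans _ _ (2 * (e / E) * D * (phnorm x * phnorm y))).
    by rewrite !ler_wpM2r ?nn_ge0.
  have -> : 2 * (e / E) * D * (phnorm x * phnorm y) = e * ((E - 1) / E).
    by rewrite /E; field; rewrite -/E gt_eqF.
  by rewrite ger_pMr // ler_pdivrMr // mul1r gerBl.
have /choice [p0 hp0] x : exists f, forall y, forall e : R, 0 < e ->
    exists M : nat, forall n : nat, (M <= n)%N -> normc (z x y n - f y) <= e.
  by have /choice [f hf] := zc x; exists f.
exists p0 => e e0.
have E0 : 0 < D + 1 by rewrite ltr_wpDl.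
exists (Num.min 1 (e / (D + 1))); first by rewrite lt_min ltr01 divr_gt0.
set d := Num.min _ _ => U U' W W' aU aW hU hW.
have d01 : 0 <= d <= 1.
  by rewrite ge_min lexx /= le_min ler01 ltW ?divr_gt0.
have dD : d * D <= e.
  have : d <= e / (D + 1) by rewrite ge_min lexx orbT.
  rewrite ler_pdivlMr // => h; apply: le_trans h.
  by rewrite ler_wpM2l ?lerDl //; case/andP: d01.
move=> x y.
apply: (@ler_eps_lin _ _ (1 + D * (phnorm x * phnorm y))) => [|a a0 a1].
  by rewrite addr_ge0 // mulr_ge0 ?nn_ge0.
have [M1 hM1] := hp0 x y a a0; have [M2 hM2] := small a a0.
pose n := maxn M1 M2.
have h1 := hM1 n (leq_maxl _ _); have h2 := hM2 n (leq_maxr _ _).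
have [[t1 t2] [s1 s2]] := (hT' n, hS' n).
have h3 := approx_comp x y K0 L0 (eps01 n) d01 hK hL t1 s1 aU aW t2 s2 hU hW.
have -> : p0 x y - ip ((U \o W) x) y =
  - (z x y n - p0 x y) + (z x y n - ip (U (W x)) y) by rewrite /=; ring.
apply: le_trans (normc_triangle _ _) _; rewrite normc_opp.
apply: le_trans (lerD h1 h3) _.
rewrite -/D; set N := phnorm x * phnorm y.
have A : n.+1%:R^-1 * D * N <= a * D * N by rewrite !ler_wpM2r ?nn_ge0.
have B : d * D * N <= e * N by rewrite ler_wpM2r ?nn_ge0.
have -> : a + (n.+1%:R^-1 + d) * D * N = d * D * N + (a + n.+1%:R^-1 * D * N).
  by ring.
have -> : e * N + a * (1 + D * N) = e * N + (a + a * D * N) by ring.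
by rewrite lerD // lerD2l.
Qed.

Lemma form_mul_limit b c p : limit_form b -> limit_form c ->
  is_form_mul b c p -> limit_form p.
Proof.
move=> lb lc h e e0; have [d d0 hd] := h e e0.
have [T [T' [h1 h2]]] := lb d d0; have [S [S' [g1 g2]]] := lc d d0.
exists (T \o S), (S' \o T'); split; first exact: adjointable_comp.
exact: hd h1 g1 h2 g2.
Qed.

Definition limit_formb : pred form := fun b => `[< limit_form b >].

Lemma limit_form_submod : submod_closed limit_formb.
Proof.
split=> [|a b c /asboolP hb /asboolP hc]; apply/asboolP.
  move=> e e0; exists (fun=> 0), (fun=> 0); split.
    have b0 : bounded_op (fun=> 0).
      by exists 0 => // x; rewrite phnorm0 mul0r.
    by split=> // x y; rewrite ip0l -ip_conj ip0l rmorph0.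
  move=> x y; rewrite ip0l subr0 /= expr0n /= addr0 sqrtr0.
  by rewrite mulr_ge0 ?nn_ge0 ?ltW.
by apply: limit_formD => //; apply: limit_formZ.
Qed.
HB.instance Definition _ :=
  GRing.isSubmodClosed.Build C form limit_formb limit_form_submod.

Record boundedForm := BoundedForm {
  bform :> form;
  bformP : limit_formb bform }.

HB.instance Definition _ := [isSub for bform].
HB.instance Definition _ := [Choice of boundedForm by <:].
HB.instance Definition _ := [SubChoice_isSubLmodule of boundedForm by <:].

Implicit Types f g k : boundedForm.

Lemma bformD f g : bform (f + g) = bform f + bform g.
Proof. by []. Qed.

Lemma bform_ext f g : (forall x y, bform f x y = bform g x y) -> f = g.
Proof.
by move=> h; apply/val_inj/funext => x; apply/funext => y; apply: h.
Qed.

Lemma bformDE f g x y : bform (f + g) x y = bform f x y + bform g x y.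
Proof. by []. Qed.

Lemma bformZE (a : C) f x y : bform (a *: f) x y = a * bform f x y.
Proof. by []. Qed.

Lemma bformZ (a : C) f : bform (a *: f) = a *: bform f.
Proof. by []. Qed.

Lemma bform_limit f : limit_form f.
Proof. by apply/asboolP; apply: bformP. Qed.

Definition mul_sig f g :=
  cid (form_mul_exists (bform_limit f) (bform_limit g)).

Lemma bmul_subproof f g : limit_formb (projT1 (mul_sig f g)).
Proof.
apply/asboolP; apply: form_mul_limit (bform_limit f) (bform_limit g) _.
exact: projT2 (mul_sig f g).
Qed.

Definition bmul f g := BoundedForm (bmul_subproof f g).
Definition bone := BoundedForm (asboolT (limit_form_op adjointable_id)).
Definition bstar f := BoundedForm (asboolT (limit_form_star (bform_limit f))).

Lemma bmulP f g : is_form_mul f g (bmul f g).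
Proof. exact: projT2 (mul_sig f g). Qed.

Lemma bform_eq f g :
  (forall e, 0 < e -> exists2 T, approx f T e & approx g T e) -> f = g.
Proof. by move=> h; apply/val_inj/approx_eq. Qed.

Lemma min3 (a b c : R) : 0 < a -> 0 < b -> 0 < c ->
  exists d, [/\ 0 < d, d <= a, d <= b & d <= c].
Proof.
move=> a0 b0 c0; exists (Num.min a (Num.min b c)).
by split; rewrite ?lt_min ?a0 ?b0 ?c0 // !ge_min lexx ?orbT.
Qed.

(** Below all the thresholds, one triple T, S, U approximates both bracketings, and composition of
    operators is associative by definition. *)
Lemma bmulA : associative bmul.
Proof.
move=> f g k; apply: bform_eq => e e0.
have [d1 d10 h1] := bmulP f (bmul g k) e0.
have [d2 d20 h2] := bmulP (bmul f g) k e0.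
have [d3 d30 h3] := bmulP g k d10.
have [d4 d40 h4] := bmulP f g d20.
have [m [m0 m1 m2 m3]] := min3 d10 d20 d30.
have [d [d0 dm dd4 _]] := min3 m0 d40 m0.
have [T [T' [aT tT]]] := bform_limit f d0.
have [S [S' [aS tS]]] := bform_limit g d0.
have [U [U' [aU tU]]] := bform_limit k d0.
exists (T \o (S \o U)).
  apply: h1 aT (adjointable_comp aS aU) (approx_mono _ tT) _.
    exact: le_trans m1.
  by apply: h3 aS aU (approx_mono _ tS) (approx_mono _ tU); apply: le_trans m3.
apply: (h2 (T \o S) _ U _ (adjointable_comp aT aS) aU) (approx_mono _ tU).
  by apply: h4 aT aS (approx_mono _ tT) (approx_mono _ tS).
exact: le_trans m2.
Qed.

Lemma bmul1l : left_id bone bmul.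
Proof.
move=> f; apply: bform_eq => e e0.
have [d1 d10 h1] := bmulP bone f e0.
have [d [d0 dd1 de _]] := min3 d10 e0 d10.
have [T [T' [aT tT]]] := bform_limit f d0.
exists T; last exact: approx_mono tT.
apply: (h1 id id) adjointable_id aT _ (approx_mono _ tT) => //.
exact/approx_refl/ltW.
Qed.

Lemma bmulDl : left_distributive bmul +%R.
Proof.
move=> f g k; apply: bform_eq => e e0.
have e2 : 0 < e / 2 by rewrite divr_gt0.
have [d1 d10 h1] := bmulP (f + g) k e0.
have [d2 d20 h2] := bmulP f k e2.
have [d3 d30 h3] := bmulP g k e2.
have d1' : 0 < d1 / 2 by rewrite divr_gt0.
have [d [d0 dd1 dd2 dd3]] := min3 d1' d20 d30.
have [T [T' [aT tT]]] := bform_limit f d0.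
have [S [S' [aS tS]]] := bform_limit g d0.
have [U [U' [aU tU]]] := bform_limit k d0.
exists ((fun x => T x + S x) \o U).
  apply: h1 (adjointableD aT aS) aU _ (approx_mono _ tU).
    by apply: approx_mono (approxD tT tS); lra.
  by lra.
rewrite [e]splitr bformD.
apply: (@approxD _ _ (T \o U) (S \o U)).
  by apply: h2 aT aU (approx_mono _ tT) (approx_mono _ tU).
by apply: h3 aS aU (approx_mono _ tS) (approx_mono _ tU).
Qed.

Lemma bstarE f x y : bform (bstar f) x y = (bform f y x)^*.
Proof. by []. Qed.

Lemma bstarD f g : bstar (f + g) = bstar f + bstar g.
Proof.
apply: bform_ext => x y.
by rewrite bformDE !bstarE bformDE rmorphD.
Qed.

Lemma bstarZ (a : C) f : bstar (a *: f) = a^* *: bstar f.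
Proof.
apply: bform_ext => x y.
by rewrite bformZE !bstarE bformZE rmorphM.
Qed.

Lemma bstarK : involutive bstar.
Proof.
by move=> f; apply: bform_ext => x y; rewrite !bstarE conjCK.
Qed.

Lemma bstar_bmul f g : bstar (bmul f g) = bmul (bstar g) (bstar f).
Proof.
apply: bform_eq => e e0.
have [d1 d10 h1] := bmulP f g e0.
have [d2 d20 h2] := bmulP (bstar g) (bstar f) e0.
have [d [d0 dd1 dd2 _]] := min3 d10 d20 d10.
have [T [T' [aT tT]]] := bform_limit f d0.
have [S [S' [aS tS]]] := bform_limit g d0.
exists (S' \o T').
  apply: (@approx_star _ (T \o S)); first by case: (adjointable_comp aT aS).
  exact: h1 aT aS (approx_mono dd1 tT) (approx_mono dd1 tS).
apply: h2 (adjointable_sym aS) (adjointable_sym aT) _ _.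
  by apply: approx_star (approx_mono dd2 tS); case: aS.
by apply: approx_star (approx_mono dd2 tT); case: aT.
Qed.

(** The laws on the right are mirror images of those on the left under the involution, which
    reverses products. *)
Lemma bmul1r : right_id bone bmul.
Proof.
have star1 : bstar bone = bone by apply: bform_ext => x y; exact: ip_conj.
by move=> f; rewrite -[LHS]bstarK bstar_bmul star1 bmul1l bstarK.
Qed.

Lemma bmulDr : right_distributive bmul +%R.
Proof.
move=> k f g; rewrite -[LHS]bstarK bstar_bmul bstarD bmulDl bstarD.
by rewrite -!bstar_bmul !bstarK.
Qed.

Lemma bone_neq0 : bone != 0.
Proof.
apply/eqP => h; have : bform bone (ph_vec H) (ph_vec H) = 0 by rewrite h.
by rewrite /= /op_form ip_vec => /eqP; rewrite oner_eq0.
Qed.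

HB.instance Definition _ := GRing.Zmodule_isNzRing.Build boundedForm
  bmulA bmul1l bmul1r bmulDl bmulDr bone_neq0.

Lemma bscaleAl (a : C) f g : a *: (f * g) = (a *: f) * g.
Proof.
apply: bform_eq => e e0.
have n0 := normc_nneg a.
have a0 : 0 < normc a + 1 by rewrite ltr_wpDl.
have [d1 d10 h1] := bmulP (a *: f) g e0.
have [d2 d20 h2] := bmulP f g (divr_gt0 e0 a0).
have [d [d0 dd1 dd2 dd3]] := min3 (divr_gt0 d10 a0) d10 d20.
have [T [T' [aT tT]]] := bform_limit f d0.
have [S [S' [aS tS]]] := bform_limit g d0.
have sh (r s : R) : 0 < s -> r <= s / (normc a + 1) -> normc a * r <= s.
  move=> s0; rewrite ler_pdivlMr // mulrC.
  have [r0|/ltW r0] := leP 0 r; first by rewrite mulrDl mul1r; lra.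
  by move=> _; apply: le_trans (mulr_ge0_le0 n0 r0) (ltW s0).
exists ((fun x => a *: T x) \o S).
  rewrite bformZ; apply: (@approx_mono _ _ _ _ (sh _ _ e0 (lexx _))).
  by apply: (@approxZ a _ (T \o S)); apply: h2 aT aS (approx_mono dd3 tT) (approx_mono dd3 tS).
apply: h1 (adjointableZ a aT) aS _ (approx_mono dd2 tS).
by rewrite bformZ; apply: approx_mono (approxZ a tT); apply: sh.
Qed.

HB.instance Definition _ :=
  GRing.Lmodule_isLalgebra.Build C boundedForm bscaleAl.

Lemma bstarM f g : bstar (f * g) = bstar g * bstar f.
Proof. exact: bstar_bmul. Qed.

Lemma bscaleAr (a : C) f g : a *: (f * g) = f * (a *: g).
Proof.
rewrite -[LHS]bstarK bstarZ bstarM bscaleAl -bstarZ -bstarM.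
exact: bstarK.
Qed.

HB.instance Definition _ :=
  GRing.Lalgebra_isAlgebra.Build C boundedForm bscaleAr.
Definition bnorm f : R := inf [set K | 0 <= K /\ form_bound f K].

Lemma bnorm_has_inf f : has_inf [set K | 0 <= K /\ form_bound f K].
Proof.
split; last by exists 0 => K [].
by have [K K0 hK] := limit_form_bound (bform_limit f); exists K.
Qed.

Lemma bnorm_le f K : 0 <= K -> form_bound f K -> bnorm f <= K.
Proof. by move=> K0 hK; apply: ge_inf => //; case: (bnorm_has_inf f). Qed.

Lemma bnorm_ge0 f : 0 <= bnorm f.
Proof.
by apply: lb_le_inf; [case: (bnorm_has_inf f) | move=> K []].
Qed.

Lemma bnormP f : form_bound f (bnorm f).
Proof.
move=> x y; have := nn_ge0 x y; rewrite le_eqVlt => /orP[/eqP n0|n0].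
  have [K _ hK] := limit_form_bound (bform_limit f).
  by apply: le_trans (hK x y) _; rewrite -n0 !mulr0.
rewrite -ler_pdivrMr //; apply: lb_le_inf; first by case: (bnorm_has_inf f).
by move=> K [_ hK]; rewrite ler_pdivrMr.
Qed.

Lemma bnormD f g : bnorm (f + g) <= bnorm f + bnorm g.
Proof.
apply: bnorm_le; first by rewrite addr_ge0 ?bnorm_ge0.
move=> x y; rewrite bformD mulrDl.
by apply: le_trans (normc_triangle _ _) _; rewrite lerD ?bnormP.
Qed.

Lemma bnormZ_le (a : C) f : bnorm (a *: f) <= normc a * bnorm f.
Proof.
apply: bnorm_le; first by rewrite mulr_ge0 ?bnorm_ge0 ?normc_nneg.
by move=> x y; rewrite bformZ normcM -mulrA ler_wpM2l ?normc_nneg ?bnormP.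
Qed.

Lemma bnormZ (a : C) f : bnorm (a *: f) = normc a * bnorm f.
Proof.
apply/eqP; rewrite eq_le bnormZ_le /=.
have [->|a0] := eqVneq a 0; first by rewrite normc0 mul0r bnorm_ge0.
have := bnormZ_le a^-1 (a *: f); rewrite scalerA mulVf // scale1r normcV.
have na : 0 < normc a.
  by rewrite lt_neqAle normc_nneg eq_sym andbT; apply: contra a0 => /eqP/eq0_normc ->.
by rewrite mulrC ler_pdivlMr // mulrC.
Qed.

Lemma bnorm0_eq0 f : bnorm f = 0 -> f = 0.
Proof.
move=> f0; apply: bform_ext => x y.
apply: eq0_normc; apply/eqP; rewrite eq_le normc_nneg andbT.
by have := bnormP f x y; rewrite f0 mul0r.
Qed.

Lemma bnormM f g : bnorm (f * g) <= bnorm f * bnorm g.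
Proof.
have K0 := bnorm_ge0 f; have L0 := bnorm_ge0 g.
apply: bnorm_le; first by rewrite mulr_ge0.
move=> x y; set K := bnorm f; set L := bnorm g; set n := _ * phnorm y.
have n0 : 0 <= n := nn_ge0 x y.
apply: (@ler_eps_lin _ _ ((K + L + 2) * n)) => [|e e0 e1].
  by rewrite mulr_ge0 // !addr_ge0.
have [d1 d10 h1] := bmulP f g e0.
have [d [d0 dd1 de _]] := min3 d10 e0 d10.
have [T [T' [aT tT]]] := bform_limit f d0.
have [S [S' [aS tS]]] := bform_limit g d0.
have h2 := h1 _ _ _ _ aT aS (approx_mono dd1 tT) (approx_mono dd1 tS) x y.
have [_ bT] := approx_bound K0 (ltW d0) (@bnormP f) aT tT.
have [bS _] := approx_bound L0 (ltW d0) (@bnormP g) aS tS.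
rewrite -[bform (f * g) x y](subrK (ip ((T \o S) x) y)).
apply: le_trans (normc_triangle _ _) _.
have h3 : normc (ip ((T \o S) x) y) <= (L + d) * (K + d) * n.
  have [aT' _ _] := aT; rewrite /= aT'.
  apply: le_trans (cauchy_schwarz _ _) _.
  by rewrite /n mulrACA ler_pM ?phnorm_ge0.
apply: le_trans (lerD h2 h3) _; rewrite -/n.
have h4 : (L + d) * (K + d) <= (L + e) * (K + e).
  by rewrite ler_pM ?addr_ge0 ?(ltW d0) // lerD2l.
have h5 : (L + e) * (K + e) <= K * L + e * (K + L + 1).
  have : e * e <= e by rewrite ger_pMr.
  by nra.
have h6 := ler_wpM2r n0 (le_trans h4 h5).
by lra.
Qed.

Lemma bnorm_star_le f : bnorm (bstar f) <= bnorm f.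
Proof.
apply: bnorm_le; first exact: bnorm_ge0.
by move=> x y; rewrite normc_conj [phnorm x * _]mulrC; apply: bnormP.
Qed.

Lemma bnorm_cstar f : bnorm (bstar f * f) = bnorm f ^+ 2.
Proof.
apply/eqP; rewrite eq_le; apply/andP; split.
  apply: le_trans (bnormM _ _) _.
  by rewrite expr2 ler_wpM2r ?bnorm_ge0 ?bnorm_star_le.
set M := bnorm (bstar f * f).
have M0 : 0 <= M := bnorm_ge0 _.
rewrite -[M]sqr_sqrtr // ler_pXn2r ?nnegrE ?bnorm_ge0 ?sqrtr_ge0 //.
apply: bnorm_le; first exact: sqrtr_ge0.
move=> x y; set n := _ * phnorm y.
have n0 : 0 <= n := nn_ge0 x y.
apply: (@ler_eps_lin _ _ (2 * n)) => [|e e0 e1]; first by rewrite mulr_ge0.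
(* Precision e^2 is requested because a square root follows: M + e^2 <= (sqrt M + e)^2. *)
have ee0 : 0 < e ^+ 2 by rewrite exprn_gt0.
have [d1 d10 h1] := bmulP (bstar f) f ee0.
have [d [d0 dd1 de _]] := min3 d10 e0 d10.
have [T [S [aT tT]]] := bform_limit f d0.
have aTS : adjoint T S by case: aT.
have h2 := h1 _ _ _ _ (adjointable_sym aT) aT (approx_star aTS (approx_mono dd1 tT))
  (approx_mono dd1 tT) x x.
have h3 : phnorm (T x) <= (Num.sqrt M + e) * phnorm x.
  have s0 := sqrtr_ge0 M.
  rewrite -(@ler_pXn2r _ 2) ?nnegrE ?phnorm_ge0 ?mulr_ge0 ?addr_ge0 ?phnorm_ge0 ?(ltW e0) //.
  have -> : phnorm (T x) ^+ 2 = normc (ip ((S \o T) x) x).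
    by rewrite /= (adjoint_sym aTS) ip_self normc_real ger0_norm ?sqr_ge0.
  have -> : ip ((S \o T) x) x = bform (bstar f * f) x x -
      (bform (bstar f * f) x x - ip ((S \o T) x) x) by rewrite opprB addrC subrK.
  apply: le_trans (normc_triangle _ _) _; rewrite normc_opp.
  apply: le_trans (lerD (bnormP _ _ _) h2) _; rewrite -/M -mulrDl -expr2 exprMn.
  apply: ler_wpM2r; first exact: sqr_ge0.
  rewrite -[X in X + _ <= _]sqr_sqrtr // sqrrD -addrA [_ *+ 2 + _]addrC addrA lerDl.
  by rewrite mulrn_wge0 // mulr_ge0 // ltW.
rewrite -[f x y](subrK (ip (T x) y)).
apply: le_trans (normc_triangle _ _) _.
have h4 : d * n <= e * n by rewrite ler_wpM2r.
have h5 : normc (ip (T x) y) <= (Num.sqrt M + e) * n.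
  apply: le_trans (cauchy_schwarz _ _) _.
  by rewrite /n mulrA ler_wpM2r ?phnorm_ge0.
by have := tT x y; rewrite -/n => h6; lra.
Qed.

(** The pointwise limit of the forms is approached uniformly by some X M, which in turn is
    approached by an adjointable operator. So the limit is again a [limit_form]. *)
Lemma bnorm_complete (X : nat -> boundedForm) :
  (forall e : R, 0 < e -> exists M : nat, forall m n : nat,
     (M <= m)%N -> (M <= n)%N -> bnorm (X m - X n) < e) ->
  exists f, forall e : R, 0 < e -> exists M : nat, forall n : nat,
     (M <= n)%N -> bnorm (X n - f) < e.
Proof.
move=> hX.
have Xle m n x y : normc (X m x y - X n x y) <=
    bnorm (X m - X n) * (phnorm x * phnorm y) by exact: (@bnormP (X m - X n)).
have zc x y : exists l : C, forall e : R, 0 < e -> exists M : nat, forall n : nat,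
     (M <= n)%N -> normc (X n x y - l) <= e.
  apply: complex_cauchy => e e0.
  have E0 : 0 < phnorm x * phnorm y + 1 by rewrite ltr_wpDl ?nn_ge0.
  have [M hM] := hX _ (divr_gt0 e0 E0).
  exists M => m n hm hn; apply: le_trans (Xle m n x y) _.
  apply: (@le_trans _ _ (e / (phnorm x * phnorm y + 1) * (phnorm x * phnorm y))).
    by rewrite ler_wpM2r ?nn_ge0 // ltW // hM.
  by rewrite -mulrA ger_pMr // mulrC ler_pdivrMr // mul1r lerDl.
have /choice [p hp] x : exists a : H -> C, forall y, forall e : R, 0 < e ->
    exists M : nat, forall n : nat, (M <= n)%N -> normc (X n x y - a y) <= e.
  by have /choice [a ha] := zc x; exists a.
have lim_le (e : R) : 0 < e -> exists M : nat, forall n, (M <= n)%N ->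
    forall x y, normc (X n x y - p x y) <= e * (phnorm x * phnorm y).
  move=> e0; have [M hM] := hX e e0; exists M => n hn x y.
  apply: (@ler_eps_lin _ _ 1) => // a a0 _.
  have [M1 hM1] := hp x y a a0.
  have -> : X n x y - p x y = (X n x y - X (maxn M M1) x y) +
    (X (maxn M M1) x y - p x y) by ring.
  apply: le_trans (normc_triangle _ _) _; rewrite mulr1; apply: lerD.
    apply: le_trans (Xle _ _ x y) _.
    by rewrite ler_wpM2r ?nn_ge0 // ltW // hM // leq_maxl.
  by apply: hM1; rewrite leq_maxr.
have lp : limit_form p.
  move=> e e0; have e2 : 0 < e / 2 by rewrite divr_gt0.
  have [M hM] := lim_le _ e2.
  have [T [T' [aT tT]]] := bform_limit (X M) e2.
  exists T, T'; split=> // x y.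
  have -> : p x y - ip (T x) y = - (X M x y - p x y) + (X M x y - ip (T x) y).
    by ring.
  apply: le_trans (normc_triangle _ _) _; rewrite normc_opp.
  apply: le_trans (lerD (hM M (leqnn _) x y) (tT x y)) _.
  by rewrite -mulrDl -splitr.
exists (BoundedForm (asboolT lp)) => e e0.
have e2 : 0 < e / 2 by rewrite divr_gt0.
have [M hM] := lim_le _ e2; exists M => n hn.
have : bnorm (X n - BoundedForm (asboolT lp)) <= e / 2.
  by apply: bnorm_le; [exact: ltW | exact: hM].
by move/le_lt_trans; apply; lra.
Qed.

HB.instance Definition _ := isCStar.Build R boundedForm
  bstarD bstarZ bstarM bstarK bnormD bnormZ bnorm0_eq0 bnormM bnorm_cstar
  bnorm_complete.

Definition op_elt T S (a : adjointable T S) : boundedForm :=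
  BoundedForm (asboolT (limit_form_op a)).

Lemma op_elt_comp T T' S S' (aT : adjointable T T') (aS : adjointable S S') :
  bform (op_elt aT * op_elt aS) = op_form (T \o S).
Proof.
apply: approx_eq => e e0; exists (T \o S); last exact/approx_refl/ltW.
have [d d0 h] := bmulP (op_elt aT) (op_elt aS) e0.
by apply: (h T T' S S' aT aS); apply/approx_refl/ltW.
Qed.

Lemma op_elt_star T S (aT : adjointable T S) :
  bform (bstar (op_elt aT)) = op_form S.
Proof.
apply/funext => x; apply/funext => y.
by have [h _ _] := aT; rewrite bstarE /= /op_form h ip_conj.
Qed.

End FormAlgebra.

(** * Creation and annihilation operators on words *)
Section WordOperators.
Variables (K : fieldType) (N : nat) (l : 'I_N -> K) (e : K).
Hypothesis l_rev : forall i, l i * l (rev_ord i) = e.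
Hypothesis e_sqr : e * e = 1.
Local Notation r := (@rev_ord N).
Local Notation word := (seq 'I_N).
Implicit Types (x y : word -> K) (p v w : word) (i j m : 'I_N).

(** The ratio d_k / d_(k-1) of consecutive quantum dimensions: the recursion is d_(k+1) = (\sum_i
    l_i^2) d_k - d_(k-1) divided by d_k. Because 0 has inverse 0 here, the value 0 at k = 0 yields
    mu_1 = \sum_i l_i^2. *)
Fixpoint mu k : K :=
  if k is k'.+1 then \sum_(i < N) l i ^+ 2 - (mu k')^-1 else 0.

Lemma muS k : mu k.+1 = \sum_(i < N) l i ^+ 2 - (mu k)^-1.
Proof. by []. Qed.

Hypothesis mu_neq0 : forall k, mu k.+1 != 0.

(* On the space H_k of traceless tensors this is P_(k+1) (e_i \otimes x), where
   P_(k+1) is the orthogonal projection onto H_(k+1): the recursion is Wenzl's,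
   1 \otimes P_k = P_(k+1) + mu_k^-1 V V^* with
   V = (1 \otimes P_k) (T \otimes 1). *)
Fixpoint cre i x w : K :=
  if w is j :: w' then
    (i == j)%:R * x w' -
    (mu (size w'))^-1 * l (r i) * l (r j) * cre (r j) (fun z => x (r i :: z)) w'
  else 0.

(** The weights l (r i) are the coordinates of T on e_i \otimes e_(r i), so x is killed by T^* at
    every pair of adjacent positions. A single function carries words of all lengths, which replaces
    a direct sum over degrees. *)
Definition traceless x :=
  forall p w, \sum_i l (r i) * x (p ++ i :: r i :: w) = 0.

Lemma l_neq0 i : l i != 0.
Proof.
apply/eqP => l0; have := l_rev i; rewrite l0 mul0r => e0.
by have := e_sqr; rewrite -e0 mul0r => /eqP; rewrite eq_sym oner_eq0.
Qed.

Lemma l_sqr_rev i : l i ^+ 2 * l (r i) ^+ 2 = 1.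
Proof. by rewrite -exprMn l_rev expr2. Qed.

Lemma sum_rev (V : nmodType) (f : 'I_N -> V) : \sum_i f (r i) = \sum_i f i.
Proof. by rewrite [RHS](reindex_inj rev_ord_inj). Qed.

Lemma sum_delta (f : 'I_N -> K) j : \sum_i (j == i)%:R * f i = f j.
Proof.
rewrite (bigD1 j) //= eqxx mul1r big1 ?addr0 // => i.
by rewrite eq_sym => /negPf ->; rewrite mul0r.
Qed.

Lemma cre_cons i x j w : cre i x (j :: w) = (i == j)%:R * x w -
    (mu (size w))^-1 * l (r i) * l (r j) * cre (r j) (fun z => x (r i :: z)) w.
Proof. by []. Qed.

Lemma cre_local i x y w :
  (forall z, (size z).+1 = size w -> x z = y z) -> cre i x w = cre i y w.
Proof.
elim: w i x y => [//|j w IH] i x y h.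
rewrite !cre_cons h //; congr (_ - _ * _); apply: IH => z hz.
by apply: h => /=; rewrite hz.
Qed.

Lemma cre_sum (I : Type) (s : seq I) i (a : I -> K) (f : I -> word -> K) w :
  cre i (fun z => \sum_(k <- s) a k * f k z) w =
  \sum_(k <- s) a k * cre i (f k) w.
Proof.
elim: w i f => [|j w IH] i f; first by rewrite big1 // => k _; rewrite mulr0.
rewrite cre_cons IH !mulr_sumr -sumrB; apply: eq_bigr => k _.
by rewrite cre_cons; ring.
Qed.

Lemma creD i x y w : cre i (fun z => x z + y z) w = cre i x w + cre i y w.
Proof.
elim: w i x y => [|j w IH] i x y; first by rewrite addr0.
by rewrite !cre_cons IH; ring.
Qed.

Lemma creZ i (a : K) x w : cre i (fun z => a * x z) w = a * cre i x w.
Proof.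
elim: w i x => [|j w IH] i x; first by rewrite mulr0.
by rewrite !cre_cons IH; ring.
Qed.

Lemma cre0 i w : cre i (fun=> 0) w = 0.
Proof. by elim: w i => [//|j w IH] i; rewrite cre_cons IH !mulr0 subr0. Qed.

Lemma cre_zero i x w : (forall z, x z = 0) -> cre i x w = 0.
Proof. by move=> h; rewrite (@cre_local i x (fun=> 0)) ?cre0. Qed.

Lemma traceless_cons i x : traceless x -> traceless (fun z => x (i :: z)).
Proof. by move=> h p w; have := h (i :: p) w. Qed.

(** Removing and recreating the first letter applies the projection to x, which fixes it: the Wenzl
    corrections add up to a trace of x at its first two letters. *)
Lemma sum_cre_ann x w : traceless x ->
  \sum_i cre i (fun z => x (i :: z)) w = (w != [::])%:R * x w.
Proof.
case: w => [|j w] h /=; first by rewrite big1 ?mul0r.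
rewrite mul1r big_split /= sumrN.
rewrite (eq_bigr (fun i => (j == i)%:R * x (i :: w))); last first.
  by move=> i _; rewrite eq_sym.
rewrite sum_delta -[RHS]subr0; congr (_ - _).
transitivity ((mu (size w))^-1 * l (r j) *
  \sum_i l (r i) * cre (r j) (fun z => x (i :: r i :: z)) w).
  by rewrite mulr_sumr; apply: eq_bigr => i _; ring.
rewrite -cre_sum cre_zero ?mulr0 // => z; exact: (h [::] z).
Qed.

(** The weighted partial trace of P_(k+1) is mu_(k+1) P_k. The corrections are summed by
    [sum_cre_ann], which leaves exactly the recursion of [mu]; on the empty word the default mu_0^-1
    = 0 is the right value. *)
Lemma sum_ann_cre x w : traceless x ->
  \sum_i l i ^+ 2 * cre i x (i :: w) = mu (size w).+1 * x w.
Proof.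
move=> h; under eq_bigr => i _.
  rewrite cre_cons eqxx mul1r.
  have -> : l i ^+ 2 * (x w - (mu (size w))^-1 * l (r i) * l (r i) *
       cre (r i) (fun z => x (r i :: z)) w) =
    l i ^+ 2 * x w - (mu (size w))^-1 * (l i ^+ 2 * l (r i) ^+ 2) *
       cre (r i) (fun z => x (r i :: z)) w by ring.
  rewrite l_sqr_rev mulr1; over.
rewrite sumrB -mulr_suml -mulr_sumr.
rewrite (sum_rev (fun i => cre i (fun z => x (i :: z)) w)) sum_cre_ann //.
by case: w => [|j w] /=; rewrite ?invr0; ring.
Qed.

(** The factor mu^-1 in [cre] is the one for which the leading term and the correction, evaluated by
    [sum_ann_cre], cancel. *)
Lemma sum_cre_trace i x w : traceless x ->
  \sum_j l (r j) * cre i x (j :: r j :: w) = 0.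
Proof.
move=> h.
transitivity (\sum_j (i == j)%:R * (l (r j) * x (r j :: w)) -
  (mu (size w).+1)^-1 * l (r i) *
   \sum_j l (r j) ^+ 2 * cre (r j) (fun z => x (r i :: z)) (r j :: w)).
  rewrite mulr_sumr -sumrB; apply: eq_bigr => j _; rewrite (cre_cons i x j) [size _]/=.
  by ring.
rewrite sum_delta (sum_rev (fun j => l j ^+ 2 * cre j _ (j :: w))).
rewrite sum_ann_cre; last exact: traceless_cons.
by rewrite mulrACA mulVf ?mul1r ?subrr ?mu_neq0.
Qed.

Lemma traceless_cre i x : traceless x -> traceless (cre i x).
Proof.
move=> h p; elim: p i x h => [|j p IH] i x h w; first exact: sum_cre_trace.
under eq_bigr => k _ do rewrite cat_cons cre_cons size_cat /=.
transitivity ((i == j)%:R * (\sum_k l (r k) * x (p ++ k :: r k :: w)) -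
  (mu (size p + (size w).+2))^-1 * l (r i) * l (r j) *
  \sum_k l (r k) * cre (r j) (fun z => x (r i :: z)) (p ++ k :: r k :: w)).
  by rewrite !mulr_sumr -sumrB; apply: eq_bigr => k _; ring.
by rewrite h IH ?mulr0 ?subr0 //; apply: traceless_cons.
Qed.

(** This is P_(k+2) (T \otimes x) = 0. The correction contains the partial trace of [sum_ann_cre],
    whose [mu] cancels the coefficient. *)
Lemma sum_cre_cre x w : traceless x ->
  \sum_i l (r i) * cre i (cre (r i) x) w = 0.
Proof.
case: w => [|j w] h; first by rewrite big1 // => i _; rewrite mulr0.
transitivity (\sum_i (j == i)%:R * (l (r i) * cre (r i) x w) -
  (mu (size w))^-1 * l (r j) * cre (r j)
    (fun z => \sum_i l (r i) ^+ 2 * cre (r i) x (r i :: z)) w).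
  rewrite cre_sum mulr_sumr -sumrB; apply: eq_bigr => i _.
  by rewrite (cre_cons i _ j) eq_sym; ring.
rewrite sum_delta.
rewrite [X in _ - _ * X](@cre_local _ _ (fun z => mu (size w) * x z)) => [|z hz]; last first.
  by rewrite -hz -sum_ann_cre //; apply: (sum_rev (fun i => l i ^+ 2 * cre i x (i :: z))).
rewrite creZ; case: w => [|i w]; first by rewrite /= !mulr0 subr0.
by rewrite [size _]/=; field; rewrite mu_neq0.
Qed.

(** * Generators acting on functions of two words, and their quadratic relations *)

Implicit Types X Y : word -> word -> K.

Definition rcre i X v w := cre i (fun z => X z w) v.
Definition ccre j X v w := cre j (X v) w.
Definition up i j X := rcre i (ccre j X).
(** The scalar is forced twice: by the relations, where it must cancel the [mu] of [sum_ann_cre],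
    and by adjointness to the opposite [up] for the weights d_k^-1. *)
Definition down i j X v w :=
  (mu (size v).+1)^-1 * l (r i) * l (r j) * X (r i :: v) (r j :: w).
Definition gen i j X v w := up i j X v w + down i j X v w.
Definition slice i j X v w := X (i :: v) (j :: w).

Definition balanced X := forall v w, size v != size w -> X v w = 0.
Definition row_traceless X := forall w, traceless (fun z => X z w).
Definition col_traceless X := forall v, traceless (X v).
Definition bitraceless X :=
  [/\ balanced X, row_traceless X & col_traceless X].

(** Row and column creations act on different tensor legs. Commuting them allows [up] to be unfolded
    from either side. *)
Lemma rcre_ccre i j X v w : rcre i (ccre j X) v w = ccre j (rcre i X) v w.
Proof.
elim: v i X w => [|k v IH] i X w.
  by rewrite /ccre /rcre /= cre_zero.
have E : rcre i X (k :: v) = fun w => (i == k)%:R * X v w +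
   (- ((mu (size v))^-1 * l (r i) * l (r k))) *
     rcre (r k) (fun z => X (r i :: z)) v w.
  by apply/funext => z; rewrite /rcre cre_cons mulNr.
rewrite [RHS]/ccre E creD !creZ mulNr -[cre j (rcre _ _ _) w]/(ccre j _ v w) -IH.
exact: cre_cons.
Qed.

Lemma ccre_rcre i j X : ccre j (rcre i X) = rcre i (ccre j X).
Proof. by apply/funext => v; apply/funext => w; rewrite rcre_ccre. Qed.

Lemma up_ccre i j X v w : up i j X v w = ccre j (rcre i X) v w.
Proof. exact: rcre_ccre. Qed.

Lemma up_local i j X Y v w :
  (forall t z, (size t).+1 = size v -> (size z).+1 = size w -> X t z = Y t z) ->
  up i j X v w = up i j Y v w.
Proof. by move=> h; apply: cre_local => t ht; apply: cre_local => z; apply: h. Qed.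

Lemma up_sum (I : Type) (s : seq I) i j (a : I -> K) (f : I -> word -> word -> K) v w :
  up i j (fun t z => \sum_(k <- s) a k * f k t z) v w =
  \sum_(k <- s) a k * up i j (f k) v w.
Proof.
rewrite /up /rcre -cre_sum; apply: cre_local => z _.
by rewrite /ccre -cre_sum.
Qed.

Lemma upD i j X Y v w :
  up i j (fun t z => X t z + Y t z) v w = up i j X v w + up i j Y v w.
Proof.
by rewrite /up /rcre -creD; apply: cre_local => z _; rewrite /ccre -creD.
Qed.

Lemma upZ i j (a : K) X v w :
  up i j (fun t z => a * X t z) v w = a * up i j X v w.
Proof.
by rewrite /up /rcre -creZ; apply: cre_local => z _; rewrite /ccre -creZ.
Qed.

Lemma row_traceless_rcre i X : row_traceless X -> row_traceless (rcre i X).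
Proof. by move=> h w; apply: traceless_cre. Qed.

Lemma col_traceless_ccre i X : col_traceless X -> col_traceless (ccre i X).
Proof. by move=> h w; apply: traceless_cre. Qed.

Lemma row_traceless_ccre i X : row_traceless X -> row_traceless (ccre i X).
Proof.
move=> h w p q; rewrite /ccre -cre_sum cre_zero // => z; exact: h.
Qed.

Lemma col_traceless_rcre i X : col_traceless X -> col_traceless (rcre i X).
Proof.
move=> h v p q; rewrite /rcre -cre_sum cre_zero // => z; exact: h.
Qed.

Lemma balanced_up i j X : balanced X -> balanced (up i j X).
Proof.
move=> h v w hvw; rewrite (@up_local i j X (fun _ _ => 0)).
  by rewrite /up /rcre cre_zero // => z; rewrite /ccre cre0.
move=> t z ht hz; apply: h; apply: contra hvw => /eqP htz.
by rewrite -ht -hz htz.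
Qed.

Lemma bitraceless_up i j X : bitraceless X -> bitraceless (up i j X).
Proof.
move=> [h1 h2 h3]; split; first exact: balanced_up.
  by apply: row_traceless_rcre; apply: row_traceless_ccre.
by apply: col_traceless_rcre; apply: col_traceless_ccre.
Qed.

Lemma row_traceless_slice i j X : row_traceless X -> row_traceless (slice i j X).
Proof. by move=> h w; apply: (@traceless_cons i (fun z => X z (j :: w))). Qed.

Lemma col_traceless_slice i j X : col_traceless X -> col_traceless (slice i j X).
Proof. by move=> h v; apply: (@traceless_cons j (X (i :: v))). Qed.

Lemma bitraceless_slice i j X : bitraceless X -> bitraceless (slice i j X).
Proof.
move=> [h1 h2 h3]; split; first by move=> v w hvw; apply: h1.
  exact: row_traceless_slice.
exact: col_traceless_slice.
Qed.

Lemma bitraceless_comb (I : Type) (s : seq I) (a : I -> K)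
    (f : I -> word -> word -> K) : (forall k, bitraceless (f k)) ->
  bitraceless (fun v w => \sum_(k <- s) a k * f k v w).
Proof.
move=> h; split=> [v w hvw|w p q|v p q].
- by rewrite big1 // => k _; have [-> //] := h k; rewrite mulr0.
- under eq_bigr do rewrite mulr_sumr.
  rewrite exchange_big big1 //= => k _; have [_ hk _] := h k.
  under eq_bigr do rewrite mulrCA.
  by rewrite -mulr_sumr hk mulr0.
- under eq_bigr do rewrite mulr_sumr.
  rewrite exchange_big big1 //= => k _; have [_ _ hk] := h k.
  under eq_bigr do rewrite mulrCA.
  by rewrite -mulr_sumr hk mulr0.
Qed.

Lemma bitracelessD X Y : bitraceless X -> bitraceless Y ->
  bitraceless (fun v w => X v w + Y v w).
Proof.
move=> hX hY; have := @bitraceless_comb _ [:: true; false] (fun=> 1)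
  (fun b : bool => if b then X else Y).
under eq_fun do under eq_fun do rewrite !big_cons big_nil addr0 !mul1r.
by apply; case.
Qed.

Lemma bitraceless_downfun (c : nat -> K) i j X : bitraceless X ->
  bitraceless (fun v w => c (size v) * X (i :: v) (j :: w)).
Proof.
move=> [h1 h2 h3]; split=> [v w hvw|w p q|v p q].
- by rewrite h1 ?mulr0.
- under eq_bigr => k _ do rewrite size_cat /= mulrCA.
  by rewrite -mulr_sumr (h2 (j :: w) (i :: p) q) mulr0.
- under eq_bigr => k _ do rewrite mulrCA.
  by rewrite -mulr_sumr (h3 (i :: v) (j :: p) q) mulr0.
Qed.

Lemma bitraceless_scale (c : nat -> K) X : bitraceless X ->
  bitraceless (fun v w => c (size v) * X v w).
Proof.
move=> [h1 h2 h3]; split=> [v w hvw|w p q|v p q].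
- by rewrite h1 ?mulr0.
- under eq_bigr => k _ do rewrite size_cat /= mulrCA.
  by rewrite -mulr_sumr (h2 w p q) mulr0.
- under eq_bigr => k _ do rewrite mulrCA.
  by rewrite -mulr_sumr (h3 v p q) mulr0.
Qed.

Lemma bitraceless_down i j X : bitraceless X -> bitraceless (down i j X).
Proof.
exact: (bitraceless_downfun (fun k => (mu k.+1)^-1 * l (r i) * l (r j)) (r i) (r j)).
Qed.

Lemma bitraceless_gen i j X : bitraceless X -> bitraceless (gen i j X).
Proof.
by move=> h; apply: bitracelessD; [apply: bitraceless_up | apply: bitraceless_down].
Qed.

Lemma slice_up i j m n X v w : slice i j (up m n X) v w =
  (m == i)%:R * (n == j)%:R * X v w
  - (m == i)%:R * ((mu (size w))^-1 * l (r n) * l (r j)) *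
      ccre (r j) (fun v z => X v (r n :: z)) v w
  - (n == j)%:R * ((mu (size v))^-1 * l (r m) * l (r i)) *
      rcre (r i) (fun z w => X (r m :: z) w) v w
  + ((mu (size v))^-1 * l (r m) * l (r i)) * ((mu (size w))^-1 * l (r n) * l (r j)) *
     up (r i) (r j) (slice (r m) (r n) X) v w.
Proof.
rewrite /slice /up {1}/rcre cre_cons {1}/ccre cre_cons.
have -> : (fun z => ccre n X (r m :: z) (j :: w)) =
  (fun z => (n == j)%:R * X (r m :: z) w +
    (- ((mu (size w))^-1 * l (r n) * l (r j))) *
      ccre (r j) (fun v' w' => X (r m :: v') (r n :: w')) z w).
  by apply/funext => z; rewrite /ccre cre_cons mulNr.
by rewrite creD !creZ /rcre /ccre; ring.
Qed.

Lemma sum_col_trace X v w : col_traceless X ->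
  \sum_i l (r i) * X v (i :: r i :: w) = 0.
Proof. by move=> h; apply: (h v [::] w). Qed.

(** Of the four products, [upup] vanishes by [sum_cre_cre] and [dndn] by tracelessness of the
    columns of X. In [dnup] the partial trace removes [mu], leaving a row creation at a word
    starting with r i; its matching term is the right-hand side and its Wenzl correction cancels
    [updn]. *)
Lemma gen_row_relation i m X v w : bitraceless X ->
  \sum_j l (r j) * gen i j (gen m (r j) X) v w = (m == r i)%:R * l (r i) * X v w.
Proof.
move=> hX; have [bX rX cX] := hX.
have [hvw|hvw] := eqVneq (size v) (size w); last first.
  have [-> //] := hX; rewrite mulr0 big1 // => j _.
  have [-> //] := bitraceless_gen i j (bitraceless_gen m (r j) hX).
  by rewrite mulr0.
have upup : \sum_j l (r j) * up i j (up m (r j) X) v w = 0.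
  transitivity (rcre i (rcre m (fun v w => \sum_j l (r j) * ccre j (ccre (r j) X) v w)) v w).
    have -> : rcre m (fun v w => \sum_j l (r j) * ccre j (ccre (r j) X) v w) =
      (fun v w => \sum_j l (r j) * rcre m (ccre j (ccre (r j) X)) v w).
      by apply/funext => ?; apply/funext => ?; rewrite /rcre cre_sum.
    rewrite [RHS]/rcre cre_sum; apply: eq_bigr => j _; congr (_ * _).
    by rewrite /up ccre_rcre.
  rewrite /rcre cre_zero // => z; rewrite cre_zero // => t.
  exact: sum_cre_cre.
have dndn : \sum_j l (r j) * down i j (down m (r j) X) v w = 0.
  transitivity ((mu (size v).+1)^-1 * l (r i) * (mu (size v).+2)^-1 * l (r m) * e *
     \sum_j l (r j) * X (r m :: r i :: v) (j :: r j :: w)).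
    rewrite mulr_sumr; apply: eq_bigr => j _.
    by rewrite /down [size _]/= rev_ordK -(l_rev j); ring.
  by rewrite sum_col_trace ?mulr0.
have dnup : \sum_j l (r j) * down i j (up m (r j) X) v w =
    l (r i) * rcre m X (r i :: v) w.
  transitivity ((mu (size v).+1)^-1 * l (r i) *
     rcre m (fun v w => \sum_j l (r j) ^+ 2 * ccre (r j) X v (r j :: w)) (r i :: v) w).
    rewrite /rcre cre_sum mulr_sumr; apply: eq_bigr => j _.
    by rewrite /down /up /rcre; ring.
  rewrite (_ : rcre _ _ _ _ = mu (size v).+1 * rcre m X (r i :: v) w).
    by field; rewrite mu_neq0.
  rewrite /rcre -creZ; apply: cre_local => z _.
  rewrite hvw -(sum_ann_cre _ (cX z)).
  exact: (sum_rev (fun j => l j ^+ 2 * cre j (X z) (j :: w))).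
have updn : \sum_j l (r j) * up i j (down m (r j) X) v w =
    e * (mu (size v))^-1 * l (r m) * rcre i (fun z w => X (r m :: z) w) v w.
  transitivity (e * (mu (size v))^-1 * l (r m) * rcre i (fun v w =>
     \sum_j ccre j (fun v w => X (r m :: v) (j :: w)) v w) v w); last first.
    congr (_ * _).
    case: v hvw {upup dndn dnup} => [//|k v] hvw; apply: cre_local => z [hz].
    rewrite /ccre sum_cre_ann // -size_eq0 -hvw /= mul1r //.
  have -> : (fun v w => \sum_j ccre j (fun v w => X (r m :: v) (j :: w)) v w) =
    (fun v w => \sum_j 1 * ccre j (fun v w => X (r m :: v) (j :: w)) v w).
    by apply/funext => ?; apply/funext => ?; apply: eq_bigr => ? _; rewrite mul1r.
  rewrite /rcre cre_sum mulr_sumr; apply: eq_bigr => j _.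
  transitivity (l (r j) * up i j (fun t z => (mu (size v))^-1 * l (r m) * l j *
     X (r m :: t) (j :: z)) v w).
    congr (_ * _); apply: up_local => t z ht hz.
    by rewrite /down rev_ordK ht.
  rewrite upZ /up /rcre -(l_rev j); ring.
under eq_bigr => j _ do rewrite /gen upD mulrDr.
rewrite big_split /=.
have -> : \sum_j l (r j) * (up i j (up m (r j) X) v w + up i j (down m (r j) X) v w) =
    e * (mu (size v))^-1 * l (r m) * rcre i (fun z w => X (r m :: z) w) v w.
  by under eq_bigr do rewrite mulrDr; rewrite big_split /= upup updn add0r.
have -> : \sum_j l (r j) * down i j
     (fun v0 w0 => up m (r j) X v0 w0 + down m (r j) X v0 w0) v w =
    l (r i) * rcre m X (r i :: v) w.
  transitivity (\sum_j l (r j) * (down i j (up m (r j) X) v w + down i j (down m (r j) X) v w)).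
    by apply: eq_bigr => j _; congr (_ * _); rewrite /down mulrDr.
  by under eq_bigr do rewrite mulrDr; rewrite big_split /= dndn dnup addr0.
have -> : rcre m X (r i :: v) w = (m == r i)%:R * X v w -
    (mu (size v))^-1 * l (r m) * l i * rcre i (fun z w => X (r m :: z) w) v w.
  by rewrite /rcre cre_cons rev_ordK.
by rewrite -(l_rev i); ring.
Qed.

Definition flip X v w := X w v.

Lemma bitraceless_flip X : bitraceless X -> bitraceless (flip X).
Proof. by move=> [h1 h2 h3]; split=> // v w hvw; apply: h1; rewrite eq_sym. Qed.

(** Transposition reduces the column relation to the row relation. Balance matters because [down]
    reads its scalar off the length of the row word. *)
Lemma gen_flip i j X : balanced X -> gen i j (flip X) = flip (gen j i X).
Proof.
move=> bX; apply/funext => v; apply/funext => w; rewrite /gen /flip.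
congr (_ + _); first by rewrite up_ccre.
have [hvw|hvw] := eqVneq (size v) (size w).
  by rewrite /down hvw; ring.
by rewrite /down !bX ?mulr0 //= eqSS eq_sym.
Qed.

Lemma gen_col_relation j m X v w : bitraceless X ->
  \sum_i l (r i) * gen i j (gen (r i) m X) v w = (m == r j)%:R * l (r j) * X v w.
Proof.
move=> hX; have hf := bitraceless_flip hX; have [bf _ _] := hf.
rewrite -(gen_row_relation j m w v hf); apply: eq_bigr => i _; congr (_ * _).
have -> : X = flip (flip X) by [].
have [b1 _ _] := bitraceless_gen m (r i) hf.
by rewrite (gen_flip _ _ bf) (gen_flip _ _ b1).
Qed.

(** * Weighted sums over words and adjoints of creations *)

Fixpoint wsum (q : 'I_N -> K) k (f : word -> K) : K :=
  if k is k'.+1 then \sum_i q i * wsum q k' (fun w => f (i :: w)) else f [::].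

Implicit Types (q : 'I_N -> K) (f g : word -> K).

Lemma wsum_local q k f g : (forall w, size w = k -> f w = g w) ->
  wsum q k f = wsum q k g.
Proof.
elim: k f g => [|k IH] f g h /=; first exact: h.
by apply: eq_bigr => i _; congr (_ * _); apply: IH => w hw; apply: h => /=; rewrite hw.
Qed.

Lemma wsumS q k f : wsum q k.+1 f = \sum_i q i * wsum q k (fun w => f (i :: w)).
Proof. by []. Qed.

Lemma wsumD q k f g :
  wsum q k (fun w => f w + g w) = wsum q k f + wsum q k g.
Proof.
elim: k f g => [//|k IH] f g /=.
by rewrite -big_split; apply: eq_bigr => i _; rewrite IH mulrDr.
Qed.

Lemma wsumZ q k (a : K) f : wsum q k (fun w => a * f w) = a * wsum q k f.
Proof.
elim: k f => [//|k IH] f /=.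
by rewrite mulr_sumr; apply: eq_bigr => i _; rewrite IH mulrCA.
Qed.

Lemma wsum_sum (I : Type) (s : seq I) q k (F : I -> word -> K) :
  wsum q k (fun w => \sum_(t <- s) F t w) = \sum_(t <- s) wsum q k (F t).
Proof.
elim: s => [|t s IH].
  rewrite big_nil (_ : (fun _ => _) = fun w => 0 * 0).
    by rewrite wsumZ mul0r.
  by apply/funext => w; rewrite big_nil mul0r.
rewrite big_cons -IH -wsumD; congr wsum; apply/funext => w.
by rewrite big_cons.
Qed.

Lemma wsum_exchange q1 q2 k1 k2 (F : word -> word -> K) :
  wsum q1 k1 (fun v => wsum q2 k2 (F v)) =
  wsum q2 k2 (fun w => wsum q1 k1 (fun v => F v w)).
Proof.
elim: k1 F => [//|k IH] F /=; rewrite wsum_sum; apply: eq_bigr => i _.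
by rewrite IH wsumZ.
Qed.

Lemma wsum0 q k : wsum q k (fun=> 0) = 0.
Proof.
rewrite (_ : (fun=> 0) = (fun w => 0 * (fun=> 0) w)).
  by rewrite wsumZ mul0r.
by apply/funext => w; rewrite mul0r.
Qed.

(** Against a traceless y, creation behaves like plain prefixing of a letter. In the correction the
    induction hypothesis produces q_j q_(r j) = 1, so the weights disappear and a trace of y
    remains. Both l_i^2 and 1 are admissible weights. *)
Lemma wsum_adjoint q k i x y : (forall j, q j * q (r j) = 1) -> traceless y ->
  wsum q k.+1 (fun w => cre i x w * y w) =
  q i * wsum q k (fun w => x w * y (i :: w)).
Proof.
move=> hq; elim: k i x y => [|k IH] i x y hy.
  rewrite -[RHS](sum_delta (fun j => q j * (x [::] * y [:: j]))).
  by apply: eq_bigr => j _; rewrite /= mulr0 subr0 -mulrA mulrCA.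
rewrite wsumS.
transitivity (\sum_j ((i == j)%:R * (q j * wsum q k.+1 (fun w => x w * y (j :: w)))
  - (mu k.+1)^-1 * l (r i) * (l (r j) * q j * wsum q k.+1
      (fun w => cre (r j) (fun z => x (r i :: z)) w * y (j :: w))))).
  apply: eq_bigr => j _.
  rewrite (@wsum_local q k.+1 (fun w => cre i x (j :: w) * y (j :: w))
    (fun w => (i == j)%:R * (x w * y (j :: w)) +
     - ((mu k.+1)^-1 * l (r i) * l (r j)) *
     (cre (r j) (fun z => x (r i :: z)) w * y (j :: w)))) => [|w hw].
    by rewrite wsumD !wsumZ; ring.
  by rewrite cre_cons hw; ring.
rewrite sumrB sum_delta -mulr_sumr -[RHS]subr0; congr (_ - _).
transitivity ((mu k.+1)^-1 * l (r i) * wsum q k (fun w => x (r i :: w) *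
    \sum_j l (r j) * y (j :: r j :: w))); last first.
  rewrite (@wsum_local _ _ _ (fun=> 0)) ?wsum0 ?mulr0 // => w _.
  by rewrite (hy [::]) mulr0.
congr (_ * _).
transitivity (\sum_j wsum q k (fun w => l (r j) * (x (r i :: w) * y (j :: r j :: w)))).
  apply: eq_bigr => j _; rewrite IH; last exact: traceless_cons.
  by rewrite wsumZ -[RHS]mul1r -(hq j); ring.
rewrite -wsum_sum; apply: wsum_local => w _; rewrite mulr_sumr.
by apply: eq_bigr => j _; rewrite mulrCA.
Qed.

Definition bsum k X := wsum (fun i => l i ^+ 2) k (fun v => wsum (fun=> 1) k (X v)).

Lemma bsum_local k X Y :
  (forall v w, size v = k -> size w = k -> X v w = Y v w) -> bsum k X = bsum k Y.
Proof. by move=> h; apply: wsum_local => v hv; apply: wsum_local => w; apply: h. Qed.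

Lemma bsumD k X Y : bsum k (fun v w => X v w + Y v w) = bsum k X + bsum k Y.
Proof.
by rewrite /bsum -wsumD; apply: wsum_local => v _; rewrite wsumD.
Qed.

Lemma bsumZ k (a : K) X : bsum k (fun v w => a * X v w) = a * bsum k X.
Proof. by rewrite /bsum -wsumZ; apply: wsum_local => v _; rewrite wsumZ. Qed.

Lemma bsum_zero k X : (forall v w, size v = k -> size w = k -> X v w = 0) ->
  bsum k X = 0.
Proof.
move=> h; rewrite (@bsum_local _ _ (fun v w => 0 * X v w)).
  by rewrite bsumZ mul0r.
by move=> v w hv hw; rewrite h ?mulr0.
Qed.

Lemma bsum_sum (I : Type) (s : seq I) k (F : I -> word -> word -> K) :
  bsum k (fun v w => \sum_(t <- s) F t v w) = \sum_(t <- s) bsum k (F t).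
Proof.
elim: s => [|t s IH]; first by rewrite big_nil bsum_zero // => v w; rewrite big_nil.
rewrite big_cons -IH -bsumD; apply: bsum_local => v w _ _.
by rewrite big_cons.
Qed.

Lemma bsum0 X : bsum 0 X = X [::] [::].
Proof. by []. Qed.

Lemma bsumS k X : bsum k.+1 X = \sum_i \sum_j l i ^+ 2 * bsum k (slice i j X).
Proof.
rewrite /bsum wsumS; apply: eq_bigr => i _; rewrite -mulr_sumr; congr (_ * _).
rewrite -wsum_sum; apply: wsum_local => v _.
by rewrite wsumS; apply: eq_bigr => j _; rewrite mul1r.
Qed.

Lemma bsum_up k i j X Z : bitraceless Z ->
  bsum k.+1 (fun v w => up i j X v w * Z v w) =
  l i ^+ 2 * bsum k (fun v w => X v w * slice i j Z v w).
Proof.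
move=> [_ rZ cZ]; rewrite /bsum.
transitivity (wsum (fun i => l i ^+ 2) k.+1 (fun v =>
    wsum (fun=> 1) k (fun w => rcre i X v w * Z v (j :: w)))).
  apply: wsum_local => v _; rewrite -[RHS]mul1r -(@wsum_adjoint (fun=> 1)) //.
    by apply: wsum_local => w _; rewrite up_ccre.
  by move=> ?; rewrite mul1r.
rewrite wsum_exchange [in RHS]wsum_exchange -wsumZ; apply: wsum_local => w _.
apply: (@wsum_adjoint (fun i => l i ^+ 2) k i (X^~ w) (fun v => Z v (j :: w))).
  by move=> m; rewrite l_sqr_rev.
exact: (rZ (j :: w)).
Qed.

Lemma bsum_down k i j X Z :
  bsum k (fun v w => down i j X v w * Z v w) =
  (mu k.+1)^-1 * l (r i) * l (r j) *
    bsum k (fun v w => slice (r i) (r j) X v w * Z v w).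
Proof.
rewrite -bsumZ; apply: bsum_local => v w hv _.
by rewrite /down hv /slice; ring.
Qed.

Fixpoint qdim k : K := if k is k'.+1 then mu k * qdim k' else 1.

Arguments qdim : simpl never.
Arguments mu : simpl never.

Lemma qdimS k : qdim k.+1 = mu k.+1 * qdim k. Proof. by []. Qed.

(** Bilinear, so that it makes sense over any field; the Hermitian product is obtained later by
    conjugating the second argument. *)
Definition pairing n X Z :=
  \sum_(k < n) (qdim k)^-1 * bsum k (fun v w => X v w * Z v w).

Definition degree_lt n X := forall v w, (n <= size v)%N -> X v w = 0.

Lemma degree_lt_up n i j X : degree_lt n X -> degree_lt n.+1 (up i j X).
Proof.
move=> h v w hv; rewrite (@up_local i j X (fun _ _ => 0)).
  by rewrite /up /rcre cre_zero // => z; rewrite /ccre cre0.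
by move=> t z ht _; apply: h; rewrite -ltnS ht.
Qed.

Lemma degree_lt_down n i j X : degree_lt n X -> degree_lt n (down i j X).
Proof. by move=> h v w hv; rewrite /down h ?mulr0 //= leqW. Qed.

Lemma degree_lt_mono n (m : nat) X : (n <= m)%N -> degree_lt n X -> degree_lt m X.
Proof. by move=> nm h v w hv; apply: h; apply: leq_trans hv. Qed.

Lemma degree_lt_gen n i j X : degree_lt n X -> degree_lt n.+1 (gen i j X).
Proof.
move=> h v w hv; rewrite /gen (degree_lt_up _ _ h) // add0r.
exact: (degree_lt_down _ _ (degree_lt_mono (leqnSn n) h)).
Qed.

Lemma pairing_widen n (m : nat) X Z : (n <= m)%N -> degree_lt n X \/ degree_lt n Z ->
  pairing m X Z = pairing n X Z.
Proof.
move=> nm h; rewrite /pairing -!(big_mkord xpredT (fun k => (qdim k)^-1 *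
  bsum k (fun v w => X v w * Z v w))).
rewrite (big_cat_nat (leq0n n) nm) //= [X in _ + X]big_nat_cond [X in _ + X]big1 ?addr0 //.
move=> k /andP[/andP[nk _] _]; rewrite bsum_zero ?mulr0 // => v w hv _.
by case: h => ->; rewrite ?mulr0 ?mul0r ?hv.
Qed.

(** The adjoint of [up i j] removes the letters i and j, which [down (r i) (r j)] does up to mu^-1.
    The weights d_k^-1 absorb this factor, since d_(k+1) = mu_(k+1) d_k. *)
Lemma pairing_gen n i j X Z : bitraceless X -> bitraceless Z ->
  degree_lt n X -> degree_lt n Z ->
  pairing n.+1 (gen i j X) Z =
  e * l i * l (r j) * pairing n.+1 X (gen (r i) (r j) Z).
Proof.
move=> hX hZ dX dZ.
pose A k := bsum k (fun v w => X v w * slice i j Z v w).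
pose B k := bsum k (fun v w => slice (r i) (r j) X v w * Z v w).
(* Creations shift the degree by one in the sums below; these vanishing top terms make the ranges of
   summation agree. *)
have A_n : A n = 0.
  by apply: bsum_zero => v w hv _; rewrite (dX v w) ?hv ?mul0r.
have B_n : B n = 0.
  by apply: bsum_zero => v w hv _; rewrite (dZ v w) ?hv ?mulr0.
have e_l m : (l m)^-1 = e * l (r m).
  by apply: (mulfI (l_neq0 m)); rewrite mulfV ?l_neq0 // mulrCA l_rev e_sqr.
have q_mu k : (qdim k)^-1 * (mu k.+1)^-1 = (qdim k.+1)^-1.
  by rewrite qdimS invfM mulrC.
have lhs : pairing n.+1 (gen i j X) Z = \sum_(k < n) (qdim k.+1)^-1 *
    (l i ^+ 2 * A k + l (r i) * l (r j) * B k).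
  transitivity (\sum_(k < n.+1) (qdim k)^-1 * bsum k (fun v w => up i j X v w * Z v w) +
     \sum_(k < n.+1) (qdim k.+1)^-1 * (l (r i) * l (r j) * B k)).
    rewrite -big_split; apply: eq_bigr => k _.
    transitivity ((qdim k)^-1 * (bsum k (fun v w => up i j X v w * Z v w) +
       bsum k (fun v w => down i j X v w * Z v w))).
      by rewrite -bsumD; congr (_ * _); apply: bsum_local => v w _ _; rewrite mulrDl.
    by rewrite bsum_down -q_mu /B /=; ring.
  rewrite big_ord_recl bsum_zero => [|[|v t] [|w s] // _ _]; last by rewrite mul0r.
  rewrite mulr0 add0r big_ord_recr B_n !mulr0 /= addr0 -big_split /=.
  by apply: eq_bigr => k _; rewrite /bump leq0n add1n bsum_up // -mulrDr.
have rhs : pairing n.+1 X (gen (r i) (r j) Z) = \sum_(k < n) (qdim k.+1)^-1 *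
    (l (r i) ^+ 2 * B k + l i * l j * A k).
  transitivity (\sum_(k < n.+1) (qdim k)^-1 * bsum k (fun v w => up (r i) (r j) Z v w * X v w) +
     \sum_(k < n.+1) (qdim k.+1)^-1 * (l i * l j * A k)).
    rewrite -big_split; apply: eq_bigr => k _.
    transitivity ((qdim k)^-1 * (bsum k (fun v w => up (r i) (r j) Z v w * X v w) +
       bsum k (fun v w => down (r i) (r j) Z v w * X v w))).
      by rewrite -bsumD; congr (_ * _); apply: bsum_local => v w _ _; rewrite -mulrDl mulrC.
    have hA : bsum k (fun v w => slice i j Z v w * X v w) = A k.
      by apply: bsum_local => v w _ _; rewrite mulrC.
    by rewrite bsum_down !rev_ordK hA -q_mu /=; ring.
  rewrite big_ord_recl bsum_zero => [|[|v t] [|w s] // _ _]; last by rewrite mul0r.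
  rewrite mulr0 add0r big_ord_recr A_n !mulr0 /= addr0 -big_split /=.
  apply: eq_bigr => k _; rewrite /bump leq0n add1n bsum_up // -mulrDr; congr (_ * (_ * _ + _)).
  by apply: bsum_local => v w _ _; rewrite mulrC.
rewrite lhs rhs mulr_sumr; apply: eq_bigr => k _.
rewrite mulrCA; congr (_ * _).
have h1 : e * l i * l (r j) * (l (r i) ^+ 2) = l (r i) * l (r j).
  rewrite (_ : _ * _ = e * (l i * l (r i)) * (l (r i) * l (r j))); last by ring.
  by rewrite l_rev e_sqr mul1r.
have h2 : e * l i * l (r j) * (l i * l j) = l i ^+ 2.
  rewrite (_ : _ * _ = e * (l j * l (r j)) * (l i ^+ 2)); last by ring.
  by rewrite l_rev e_sqr mul1r.
by rewrite mulrDr mulrA h1 mulrA h2 addrC.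
Qed.

(** * Matrix coefficients in an algebra satisfying the relations, and the fusion rule *)

Section Coefficients.
Variables (A : algType K) (u : 'I_N -> 'I_N -> A).
Hypothesis u_row : forall i m,
  \sum_j l (r j) *: (u i j * u m (r j)) = ((m == r i)%:R * l (r i)) *: 1.
Hypothesis u_col : forall j m,
  \sum_i l (r i) *: (u i j * u (r i) m) = ((m == r j)%:R * l (r j)) *: 1.

Fixpoint coef k X : A :=
  if k is k'.+1 then \sum_i \sum_j u i j * coef k' (slice i j X)
  else X [::] [::] *: 1.

Lemma coefS k X : coef k.+1 X = \sum_i \sum_j u i j * coef k (slice i j X).
Proof. by []. Qed.

Lemma coef_local k X Y :
  (forall v w, size v = k -> size w = k -> X v w = Y v w) -> coef k X = coef k Y.
Proof.
elim: k X Y => [|k IH] X Y h; first by rewrite /= h.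
rewrite !coefS; apply: eq_bigr => i _; apply: eq_bigr => j _; congr (_ * _).
by apply: IH => v w hv hw; apply: h; rewrite /= ?hv ?hw.
Qed.

Lemma coefD k X Y : coef k (fun v w => X v w + Y v w) = coef k X + coef k Y.
Proof.
elim: k X Y => [|k IH] X Y; first by rewrite /= scalerDl.
rewrite !coefS -big_split /=; apply: eq_bigr => i _.
rewrite -big_split /=; apply: eq_bigr => j _; rewrite -mulrDr; congr (_ * _).
exact: IH.
Qed.

Lemma coefZ k (a : K) X : coef k (fun v w => a * X v w) = a *: coef k X.
Proof.
elim: k X => [|k IH] X; first by rewrite /= scalerA.
rewrite !coefS scaler_sumr; apply: eq_bigr => i _.
rewrite scaler_sumr; apply: eq_bigr => j _.
by rewrite scalerAr; congr (_ * _); apply: IH.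
Qed.

Lemma coef_zero k X : (forall v w, size v = k -> size w = k -> X v w = 0) ->
  coef k X = 0.
Proof.
move=> h; rewrite (@coef_local _ _ (fun v w => 0 * X v w)).
  by rewrite coefZ scale0r.
by move=> v w hv hw; rewrite h ?mulr0.
Qed.

Lemma coef_sum (I : Type) (s : seq I) k (F : I -> word -> word -> K) :
  coef k (fun v w => \sum_(t <- s) F t v w) = \sum_(t <- s) coef k (F t).
Proof.
elim: s => [|t s IH]; first by rewrite big_nil coef_zero // => v w; rewrite big_nil.
rewrite big_cons -IH -coefD; apply: coef_local => v w _ _.
by rewrite big_cons.
Qed.

(** The coefficient of degree k - 1, with value 0 at k = 0, where nothing can be annihilated. *)
Definition coef_pred k X := if k is k'.+1 then coef k' X else 0.

Lemma sum_delta_alg (f : 'I_N -> A) j : \sum_i (j == i)%:R *: f i = f j.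
Proof.
rewrite (bigD1 j) //= eqxx scale1r big1 ?addr0 // => i.
by rewrite eq_sym => /negPf ->; rewrite scale0r.
Qed.

Lemma coef_sum_down k n X : row_traceless X ->
  \sum_m coef_pred k (down m n (fun v w => X (m :: v) w)) = 0.
Proof.
move=> h; case: k => [|k]; first by rewrite big1.
rewrite -coef_sum; apply: coef_zero => v w _ _.
transitivity ((mu (size v).+1)^-1 * l (r n) *
   \sum_m l (r m) * X (m :: r m :: v) (r n :: w)).
  by rewrite mulr_sumr; apply: eq_bigr => m _; rewrite /down; ring.
by rewrite (h (r n :: w) [::]) mulr0.
Qed.

Lemma coef_sum_down_col k n X : col_traceless X ->
  \sum_m coef_pred k (down n m (fun v w => X v (m :: w))) = 0.
Proof.
move=> h; case: k => [|k]; first by rewrite big1.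
rewrite -coef_sum; apply: coef_zero => v w _ _.
transitivity ((mu (size v).+1)^-1 * l (r n) *
   \sum_m l (r m) * X (r n :: v) (m :: r m :: w)).
  by rewrite mulr_sumr; apply: eq_bigr => m _; rewrite /down; ring.
by rewrite (h (r n :: v) [::]) mulr0.
Qed.

Lemma coef_pred_sum k X :
  \sum_m \sum_n (l (r m) * l (r n)) *: (u m n * coef_pred k (down (r m) (r n) X)) =
  (mu k)^-1 *: coef k X.
Proof.
case: k => [|k].
  rewrite invr0 scale0r big1 // => m _; rewrite big1 // => n _.
  by rewrite mulr0 scaler0.
rewrite scaler_sumr; apply: eq_bigr => m _; rewrite scaler_sumr; apply: eq_bigr => n _.
rewrite [coef_pred _ _]/= (@coef_local _ _ (fun v w => ((mu k.+1)^-1 * l m * l n) * slice m n X v w)).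
  rewrite coefZ -scalerAr scalerA; congr (_ *: _).
  transitivity ((mu k.+1)^-1 * (l m * l (r m)) * (l n * l (r n))); first by ring.
  by rewrite !l_rev -mulrA e_sqr mulr1.
by move=> v w hv _; rewrite /down hv !rev_ordK.
Qed.

Section Step.
Variables (k : nat).
Hypothesis IH : forall i j X, bitraceless X ->
  coef k.+1 (up i j X) = u i j * coef k X - coef_pred k (down i j X).

(** A cross term of [slice_up]. [sum_cre_ann] completes the column creation to full operators [up],
    to which the induction hypothesis applies; the [down] parts sum to a trace, and the row relation
    contracts the two generators. *)
Lemma coef_ccre_step i j X : bitraceless X ->
  \sum_n l (r n) *: (u i n * coef k.+1 (ccre (r n) (fun v w => X v (j :: w)))) =
  l (r i) *: coef k (slice (r i) j X).
Proof.
move=> hX; have [_ rX cX] := hX.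
have expand n : coef k.+1 (ccre (r n) (fun v w => X v (j :: w))) =
    \sum_m u m (r n) * coef k (slice m j X).
  transitivity (\sum_m coef k.+1 (up m (r n) (slice m j X))).
    rewrite -coef_sum; apply: coef_local => v w hv hw.
    have hr : row_traceless (ccre (r n) (fun v w => X v (j :: w))).
      by apply: row_traceless_ccre => z; apply: (rX (j :: z)).
    by have := sum_cre_ann v (hr w); rewrite -size_eq0 hv mul1r => <-.
  under eq_bigr => m _ do rewrite (IH _ _ (bitraceless_slice m j hX)).
  rewrite sumrB.
  rewrite (coef_sum_down k (r n) (X := fun v w => X v (j :: w))) ?subr0 //.
under eq_bigr => n _ do rewrite expand mulr_sumr scaler_sumr.
rewrite exchange_big /=.
transitivity (\sum_m (r i == m)%:R *: (l (r i) *: coef k (slice m j X))).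
  apply: eq_bigr => m _.
  transitivity ((\sum_n l (r n) *: (u i n * u m (r n))) * coef k (slice m j X)).
    by rewrite mulr_suml; apply: eq_bigr => n _; rewrite -scalerAl mulrA.
  by rewrite u_row -scalerAl mul1r eq_sym scalerA.
by rewrite sum_delta_alg.
Qed.

Lemma coef_rcre_step i j X : bitraceless X ->
  \sum_n l (r n) *: (u n j * coef k.+1 (rcre (r n) (fun v w => X (i :: v) w))) =
  l (r j) *: coef k (slice i (r j) X).
Proof.
move=> hX; have [_ rX cX] := hX.
have expand n : coef k.+1 (rcre (r n) (fun v w => X (i :: v) w)) =
    \sum_m u (r n) m * coef k (slice i m X).
  transitivity (\sum_m coef k.+1 (up (r n) m (slice i m X))).
    rewrite -coef_sum; apply: coef_local => v w hv hw.
    have hr : col_traceless (rcre (r n) (fun v w => X (i :: v) w)).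
      by apply: col_traceless_rcre => z; apply: (cX (i :: z)).
    under eq_bigr do rewrite up_ccre.
    by have := sum_cre_ann w (hr v); rewrite -size_eq0 hw mul1r => <-.
  under eq_bigr => m _ do rewrite (IH _ _ (bitraceless_slice i m hX)).
  rewrite sumrB.
  rewrite (coef_sum_down_col k (r n) (X := fun v w => X (i :: v) w)) ?subr0 //.
under eq_bigr => n _ do rewrite expand mulr_sumr scaler_sumr.
rewrite exchange_big /=.
transitivity (\sum_m (r j == m)%:R *: (l (r j) *: coef k (slice i m X))).
  apply: eq_bigr => m _.
  transitivity ((\sum_n l (r n) *: (u n j * u (r n) m)) * coef k (slice i m X)).
    by rewrite mulr_suml; apply: eq_bigr => n _; rewrite -scalerAl mulrA.
  by rewrite u_col -scalerAl mul1r eq_sym scalerA.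
by rewrite sum_delta_alg.
Qed.

Lemma coef_up_step X : bitraceless X ->
  \sum_m \sum_n (l (r m) * l (r n)) *: (u m n * coef k.+1 (up (r m) (r n) X)) =
  mu k.+1 *: coef k X.
Proof.
move=> hX.
have -> : mu k.+1 *: coef k X = (\sum_i l i ^+ 2) *: coef k X - (mu k)^-1 *: coef k X.
  by rewrite -scalerBl.
transitivity (\sum_m \sum_n ((l (r m) * l (r n)) *: (u m n * u (r m) (r n)) * coef k X
   - (l (r m) * l (r n)) *: (u m n * coef_pred k (down (r m) (r n) X)))).
  apply: eq_bigr => m _; apply: eq_bigr => n _.
  by rewrite IH // mulrBr scalerBr -scalerAl mulrA.
under eq_bigr do rewrite sumrB.
rewrite sumrB coef_pred_sum; congr (_ - _).
rewrite -(sum_rev (fun i => l i ^+ 2)) scaler_suml; apply: eq_bigr => m _.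
rewrite -mulr_suml.
under eq_bigr do rewrite -scalerA.
by rewrite -scaler_sumr u_row eqxx mul1r scalerA -expr2 -scalerAl mul1r.
Qed.

End Step.

(** The fusion rule u \otimes u^(k) = u^(k+1) \oplus u^(k-1) on coefficients. Wenzl's recursion in
    rows and columns gives four terms by [slice_up]: the product u_ij coef X, two cross terms -D,
    and a double correction +D. One -D survives, and it is the [down] term. *)
Lemma coef_up k i j X : bitraceless X ->
  coef k.+1 (up i j X) = u i j * coef k X - coef_pred k (down i j X).
Proof.
elim: k i j X => [|k IH] i j X hX.
  rewrite coefS /= subr0; under eq_bigr => m _.
    under eq_bigr => n _.
      rewrite slice_up /rcre /ccre /= !mulr0 !subr0 addr0.
      rewrite -!scalerA -!scalerAr mulr1; over.
    rewrite -scaler_sumr (sum_delta_alg (fun n => X [::] [::] *: u m n)); over.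
  by rewrite (sum_delta_alg (fun m => X [::] [::] *: u m j)) -scalerAr mulr1.
have step m n : coef k.+1 (slice m n (up i j X)) =
    (i == m)%:R *: ((j == n)%:R *: coef k.+1 X)
    - (i == m)%:R *: (((mu k.+1)^-1 * l (r j)) *: (l (r n) *:
        coef k.+1 (ccre (r n) (fun v z => X v (r j :: z)))))
    - (j == n)%:R *: (((mu k.+1)^-1 * l (r i)) *: (l (r m) *:
        coef k.+1 (rcre (r m) (fun z w => X (r i :: z) w))))
    + ((mu k.+1)^-1 ^+ 2 * l (r i) * l (r j)) *: ((l (r m) * l (r n)) *:
        coef k.+1 (up (r m) (r n) (slice (r i) (r j) X))).
  rewrite -!scaleNr -!coefZ -!coefD; apply: coef_local => v w hv hw.
  by rewrite slice_up hv hw; ring.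
rewrite coefS.
transitivity (\sum_m \sum_n ((i == m)%:R *: ((j == n)%:R *: (u m n * coef k.+1 X))
    - (i == m)%:R *: (((mu k.+1)^-1 * l (r j)) *: (l (r n) *:
        (u m n * coef k.+1 (ccre (r n) (fun v z => X v (r j :: z))))))
    - (j == n)%:R *: (((mu k.+1)^-1 * l (r i)) *: (l (r m) *:
        (u m n * coef k.+1 (rcre (r m) (fun z w => X (r i :: z) w)))))
    + ((mu k.+1)^-1 ^+ 2 * l (r i) * l (r j)) *: ((l (r m) * l (r n)) *:
        (u m n * coef k.+1 (up (r m) (r n) (slice (r i) (r j) X)))))).
  apply: eq_bigr => m _; apply: eq_bigr => n _; rewrite step.
  by rewrite mulrDr !mulrBr -!scalerAr.
under eq_bigr do rewrite big_split /= !sumrB.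
rewrite big_split /= !sumrB.
have hs := bitraceless_slice (r i) (r j) hX.
have -> : \sum_m \sum_n (i == m)%:R *: ((j == n)%:R *: (u m n * coef k.+1 X)) =
    u i j * coef k.+1 X.
  under eq_bigr do rewrite -scaler_sumr (sum_delta_alg (fun n => u _ n * coef k.+1 X)).
  by rewrite (sum_delta_alg (fun m => u m j * coef k.+1 X)).
pose D := ((mu k.+1)^-1 * l (r i) * l (r j)) *: coef k (slice (r i) (r j) X).
have -> : \sum_m \sum_n (i == m)%:R *: (((mu k.+1)^-1 * l (r j)) *: (l (r n) *:
        (u m n * coef k.+1 (ccre (r n) (fun v z => X v (r j :: z)))))) = D.
  under eq_bigr do rewrite -!scaler_sumr.
  rewrite (sum_delta_alg (fun m => _ *: \sum_n l (r n) *: (u m n * _))).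
  by rewrite (coef_ccre_step IH) // scalerA /D mulrAC.
have -> : \sum_m \sum_n (j == n)%:R *: (((mu k.+1)^-1 * l (r i)) *: (l (r m) *:
        (u m n * coef k.+1 (rcre (r m) (fun z w => X (r i :: z) w))))) = D.
  rewrite exchange_big /=; under eq_bigr do rewrite -!scaler_sumr.
  rewrite (sum_delta_alg (fun n => _ *: \sum_m l (r m) *: (u m n * _))).
  by rewrite (coef_rcre_step IH) // scalerA.
have -> : \sum_m \sum_n ((mu k.+1)^-1 ^+ 2 * l (r i) * l (r j)) *: ((l (r m) * l (r n)) *:
        (u m n * coef k.+1 (up (r m) (r n) (slice (r i) (r j) X)))) = D.
  under eq_bigr do rewrite -scaler_sumr.
  rewrite -scaler_sumr (coef_up_step IH) // scalerA; congr (_ *: _).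
  by field; rewrite mu_neq0.
rewrite subrK; congr (_ - _); rewrite /D -coefZ; apply: coef_local => v w hv _.
by rewrite /down hv.
Qed.

Definition embed n X := \sum_(k < n) coef k X.

Lemma embed_gen n i j X : bitraceless X -> degree_lt n X ->
  embed n.+1 (gen i j X) = u i j * embed n X.
Proof.
move=> hX dX.
have down0 k : (n <= k.+1)%N -> coef k (down i j X) = 0.
  move=> nk; apply: coef_zero => v w hv _.
  by rewrite /down dX ?mulr0 //= hv.
have -> : embed n.+1 (gen i j X) = \sum_(k < n.+1) coef k (up i j X) +
    \sum_(k < n.+1) coef k (down i j X).
  by rewrite /embed -big_split; apply: eq_bigr => k _; rewrite coefD.
have -> : \sum_(k < n.+1) coef k (up i j X) =
    u i j * embed n X - \sum_(k < n) coef_pred k (down i j X).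
  rewrite big_ord_recl [coef _ _](_ : _ = 0) ?add0r; last by rewrite /= scale0r.
  rewrite /embed mulr_sumr -sumrB; apply: eq_bigr => k _.
  by rewrite lift0 coef_up.
rewrite -[RHS]addr0 -addrA; congr (_ + _); apply/eqP.
rewrite addrC subr_eq0; apply/eqP.
(* The two sums of [down] terms differ by a shift of index: [coef_pred] contributes nothing in
   degree 0, and the two surplus top degrees vanish by [down0]. *)
case: n dX down0 => [|n] _ down0.
  by rewrite big_ord_recr !big_ord0 /= add0r -[LHS]/(coef 0 _) down0.
have -> : \sum_(k < n.+2) coef k (down i j X) =
    \sum_(k < n) coef k (down i j X) + coef n (down i j X) + coef n.+1 (down i j X).
  by rewrite !big_ord_recr.
by rewrite !down0 // !addr0 big_ord_recl add0r.
Qed.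

Lemma embedE n (m : nat) X : (n <= m)%N -> degree_lt n X -> embed m X = embed n X.
Proof.
move=> nm h; rewrite /embed -!(big_mkord xpredT (fun k => coef k X)).
rewrite (big_cat_nat (leq0n n) nm) //= [X in _ + X]big_nat_cond [X in _ + X]big1 ?addr0 //.
move=> k /andP[/andP[nk _] _]; rewrite coef_zero // => v w hv _.
by rewrite h ?hv.
Qed.

End Coefficients.

(** * Left multiplication on the Fock space and its normal ordering *)

Fixpoint act k X Y : word -> word -> K :=
  if k is k'.+1 then
    fun v w => \sum_i \sum_j gen i j (act k' (slice i j X) Y) v w
  else fun v w => X [::] [::] * Y v w.

(* In [mix m p X Y] the last p letters of X annihilate letters of Y and the first
   m letters create letters. *)
Fixpoint low (p : nat) X Y : word -> word -> K :=
  if p is p'.+1 then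
    fun v w => \sum_i \sum_j down i j (low p' (slice i j X) Y) v w
  else fun v w => X [::] [::] * Y v w.

Fixpoint mix (m p : nat) X Y : word -> word -> K :=
  if m is m'.+1 then
    fun v w => \sum_i \sum_j up i j (mix m' p (slice i j X) Y) v w
  else low p X Y.

Lemma actS k X Y v w : act k.+1 X Y v w =
  \sum_i \sum_j gen i j (act k (slice i j X) Y) v w.
Proof. by []. Qed.

Lemma lowS (p : nat) X Y v w : low p.+1 X Y v w =
  \sum_i \sum_j down i j (low p (slice i j X) Y) v w.
Proof. by []. Qed.

Lemma mixS (m p : nat) X Y v w : mix m.+1 p X Y v w =
  \sum_i \sum_j up i j (mix m p (slice i j X) Y) v w.
Proof. by []. Qed.

Lemma down_sum (I : Type) (s : seq I) i j (a : I -> K)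
    (f : I -> word -> word -> K) v w :
  down i j (fun t z => \sum_(k <- s) a k * f k t z) v w =
  \sum_(k <- s) a k * down i j (f k) v w.
Proof. by rewrite /down mulr_sumr; apply: eq_bigr => k _; rewrite mulrCA. Qed.

Lemma low_sum (I : Type) (s : seq I) (p : nat) (a : I -> K)
    (F : I -> word -> word -> K) Y v w :
  low p (fun t z => \sum_(k <- s) a k * F k t z) Y v w =
  \sum_(k <- s) a k * low p (F k) Y v w.
Proof.
elim: p F v w => [|p IH] F v w.
  by rewrite /= mulr_suml; apply: eq_bigr => k _; rewrite mulrA.
rewrite lowS; under eq_bigr => i _.
  under eq_bigr => j _.
    rewrite (_ : low p _ Y = fun t z => \sum_(k <- s) a k * low p (slice i j (F k)) Y t z).
      by rewrite down_sum; over.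
    by apply/funext => t; apply/funext => z; rewrite -IH.
  rewrite exchange_big; over.
rewrite exchange_big; apply: eq_bigr => k _.
by rewrite lowS mulr_sumr; apply: eq_bigr => i _; rewrite mulr_sumr.
Qed.

Lemma mix_sum (I : Type) (s : seq I) (m p : nat) (a : I -> K)
    (F : I -> word -> word -> K) Y v w :
  mix m p (fun t z => \sum_(k <- s) a k * F k t z) Y v w =
  \sum_(k <- s) a k * mix m p (F k) Y v w.
Proof.
elim: m F v w => [|m IH] F v w; first exact: low_sum.
rewrite mixS; under eq_bigr => i _.
  under eq_bigr => j _.
    rewrite (_ : mix m p _ Y = fun t z => \sum_(k <- s) a k * mix m p (slice i j (F k)) Y t z).
      by rewrite up_sum; over.
    by apply/funext => t; apply/funext => z; rewrite -IH.
  rewrite exchange_big; over.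
rewrite exchange_big; apply: eq_bigr => k _.
by rewrite mixS mulr_sumr; apply: eq_bigr => i _; rewrite mulr_sumr.
Qed.

Lemma mix_zero (m p : nat) X Y v w : (forall t z, X t z = 0) -> mix m p X Y v w = 0.
Proof.
move=> h; rewrite (_ : X = fun t z => \sum_(k <- [::] : seq unit) 0 * 0).
  by rewrite (mix_sum _ _ _ _ (fun _ _ _ => 0)) big_nil.
by apply/funext => t; apply/funext => z; rewrite big_nil h.
Qed.

(** Removing a letter just after creating one: the matching term is a trace of Z, which vanishes,
    and the Wenzl correction is a creation after a removal with the roles of the two indices
    exchanged. *)
Lemma swap_letter (Z : 'I_N -> 'I_N -> word -> K) w :
  (forall z, \sum_i l (r i) * Z i (r i) z = 0) ->
  \sum_i \sum_k l (r i) * cre k (Z i k) (r i :: w) =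
  - (e * (mu (size w))^-1) *
    \sum_i \sum_k l (r k) * cre i (fun z => Z i k (r k :: z)) w.
Proof.
move=> h; rewrite mulr_sumr.
transitivity (\sum_i (l (r i) * Z i (r i) w - e * (mu (size w))^-1 *
    \sum_k l (r k) * cre i (fun z => Z i k (r k :: z)) w)).
  apply: eq_bigr => i _; rewrite mulr_sumr.
  rewrite -[l (r i) * _](sum_delta (fun k => l (r i) * Z i k w) (r i)) -sumrB.
  apply: eq_bigr => k _; rewrite cre_cons eq_sym rev_ordK -(l_rev i); ring.
rewrite sumrB h sub0r -sumrN; apply: eq_bigr => i _.
by rewrite mulNr.
Qed.

Lemma sum4_exchange23 (f : 'I_N -> 'I_N -> 'I_N -> 'I_N -> K) :
  \sum_i \sum_j \sum_m \sum_n f i j m n = \sum_j \sum_n \sum_i \sum_m f i j m n.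
Proof.
rewrite exchange_big; apply: eq_bigr => j _ /=.
by under eq_bigr do rewrite exchange_big /=; rewrite exchange_big.
Qed.

(** Rows and columns each contribute a factor -e mu^-1 by [swap_letter]. The letters exchange roles:
    the one that annihilated now creates, and conversely. This is why moving annihilations to the
    right costs only scalars. *)
Lemma swap_letters (Z : 'I_N -> 'I_N -> 'I_N -> 'I_N -> word -> word -> K) v w :
  size v = size w ->
  (forall j n t z, \sum_i l (r i) * Z i j (r i) n t z = 0) ->
  (forall i m t z, \sum_j l (r j) * Z i j m (r j) t z = 0) ->
  \sum_i \sum_j \sum_m \sum_n down i j (up m n (Z i j m n)) v w =
  (mu (size v) * mu (size v).+1)^-1 *
    \sum_i \sum_j \sum_m \sum_n up i j (down m n (Z i j m n)) v w.
Proof.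
move=> hvw hr hc.
have row j n w' : \sum_i \sum_m l (r i) * up m n (Z i j m n) (r i :: v) w' =
  - (e * (mu (size v))^-1) * \sum_i \sum_m l (r m) *
     rcre i (fun t z => ccre n (Z i j m n) (r m :: t) z) v w'.
  apply: (swap_letter (Z := fun i m t => ccre n (Z i j m n) t w')) => t.
  by rewrite /ccre -cre_sum cre_zero.
have col i m : \sum_j \sum_n l (r j) *
     rcre i (fun t z => ccre n (Z i j m n) (r m :: t) z) v (r j :: w) =
  - (e * (mu (size v))^-1) * \sum_j \sum_n l (r n) *
     up i j (fun t z => Z i j m n (r m :: t) (r n :: z)) v w.
  rewrite hvw.
  transitivity (\sum_j \sum_n l (r j) *
     cre n (fun z => rcre i (fun t z => Z i j m n (r m :: t) z) v z) (r j :: w)).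
    apply: eq_bigr => j _; apply: eq_bigr => n _; congr (_ * _).
    exact: (rcre_ccre i n (fun t z => Z i j m n (r m :: t) z)).
  rewrite (swap_letter (Z := fun j n z => rcre i (fun t z => Z i j m n (r m :: t) z) v z)).
    congr (_ * _); apply: eq_bigr => j _; apply: eq_bigr => n _; congr (_ * _).
    exact: esym (up_ccre i j (fun t z => Z i j m n (r m :: t) (r n :: z)) v w).
  by move=> z; rewrite /rcre -cre_sum cre_zero.
pose c := - (e * (mu (size v))^-1).
transitivity (\sum_j \sum_n (mu (size v).+1)^-1 * l (r j) *
   \sum_i \sum_m l (r i) * up m n (Z i j m n) (r i :: v) (r j :: w)).
  rewrite sum4_exchange23; apply: eq_bigr => j _; apply: eq_bigr => n _.
  rewrite mulr_sumr; apply: eq_bigr => i _; rewrite mulr_sumr; apply: eq_bigr => m _.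
  by rewrite /down; ring.
transitivity (\sum_i \sum_m (mu (size v).+1)^-1 * c * l (r m) *
   \sum_j \sum_n l (r j) *
     rcre i (fun t z => ccre n (Z i j m n) (r m :: t) z) v (r j :: w)).
  under eq_bigr => j _ do under eq_bigr => n _ do rewrite row 2!mulr_sumr.
  under eq_bigr => j _ do under eq_bigr => n _ do under eq_bigr => i _ do
    rewrite 2!mulr_sumr.
  rewrite -sum4_exchange23; apply: eq_bigr => i _; rewrite exchange_big.
  apply: eq_bigr => m _; rewrite mulr_sumr; apply: eq_bigr => j _.
  by rewrite mulr_sumr; apply: eq_bigr => n _; rewrite -/c; ring.
transitivity (\sum_i \sum_m (mu (size v).+1)^-1 * c ^+ 2 * l (r m) *
   \sum_j \sum_n l (r n) * up i j (fun t z => Z i j m n (r m :: t) (r n :: z)) v w).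
  by apply: eq_bigr => i _; apply: eq_bigr => m _; rewrite col -/c; ring.
rewrite mulr_sumr; apply: eq_bigr => i _.
under eq_bigr => m _ do rewrite mulr_sumr.
rewrite exchange_big mulr_sumr; apply: eq_bigr => j _ /=.
rewrite mulr_sumr; apply: eq_bigr => m _.
rewrite !mulr_sumr; apply: eq_bigr => n _.
(* On empty words both sides vanish. Otherwise one of the two inverse factors of c^2 is absorbed by
   the inner [down], which acts one letter lower. *)
case: v w hvw @c {row col} => [|a v] [|b w] //= hvw.
  by rewrite /up /rcre /= !mulr0.
rewrite (@up_local i j (down m n (Z i j m n)) (fun t z =>
  ((mu (size v).+1)^-1 * l (r m) * l (r n)) * Z i j m n (r m :: t) (r n :: z))).
  rewrite upZ.
  have -> : (- (e * (mu (size v).+1)^-1)) ^+ 2 = (mu (size v).+1)^-1 ^+ 2.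
    by rewrite sqrrN exprMn expr2 e_sqr mul1r.
  by rewrite invfM; ring.
by move=> t z [ht] _; rewrite /down ht.
Qed.

(** The cost of moving one annihilation to the right of m creations, read at words of length n. Each
    creation passed lowers the length by one. *)
Fixpoint swap_coef (m n : nat) : K :=
  if m is m'.+1 then (mu n * mu n.+1)^-1 * swap_coef m' n.-1 else 1.

Lemma mix_trace_row (m p : nat) X Y i j n t z : row_traceless X ->
  \sum_i l (r i) * mix m p (slice (r i) n (slice i j X)) Y t z = 0.
Proof.
move=> h; rewrite -(mix_sum _ _ _ (fun i => l (r i)) (fun i => slice (r i) n (slice i j X))).
by apply: mix_zero => a b; apply: (h [:: j, n & b] [::]).
Qed.

Lemma mix_trace_col (m p : nat) X Y i n t z : col_traceless X ->
  \sum_j l (r j) * mix m p (slice n (r j) (slice i j X)) Y t z = 0.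
Proof.
move=> h; rewrite -(mix_sum _ _ _ (fun j => l (r j)) (fun j => slice n (r j) (slice i j X))).
by apply: mix_zero => a b; apply: (h [:: i, n & a] [::]).
Qed.

Lemma down_mix (m p : nat) X Y v w : row_traceless X -> col_traceless X ->
  size v = size w ->
  \sum_i \sum_j down i j (mix m p (slice i j X) Y) v w =
  swap_coef m (size v) * mix m p.+1 X Y v w.
Proof.
elim: m X v w => [|m IH] X v w rX cX hvw; first by rewrite mul1r.
transitivity (\sum_i \sum_j \sum_s \sum_t down i j
   (up s t (mix m p (slice s t (slice i j X)) Y)) v w).
  apply: eq_bigr => i _; apply: eq_bigr => j _.
  rewrite /down mulr_sumr; apply: eq_bigr => s _; exact: mulr_sumr.
rewrite (swap_letters (Z := fun i j s t => mix m p (slice s t (slice i j X)) Y)) //.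
- rewrite mixS [swap_coef _ _]/= -mulrA; congr (_ * _); rewrite mulr_sumr.
  apply: eq_bigr => i _; rewrite mulr_sumr; apply: eq_bigr => j _.
  rewrite -upZ.
  transitivity (up i j (fun v w => \sum_s \sum_t
     down s t (mix m p (slice s t (slice i j X)) Y) v w) v w).
    have upsum (F : 'I_N -> word -> word -> K) :
        up i j (fun v w => \sum_s F s v w) v w = \sum_s up i j (F s) v w.
      have := up_sum (index_enum 'I_N) i j (fun=> 1) F v w.
      under eq_bigr do rewrite mul1r; move=> <-; apply: up_local => a b _ _.
      by apply: eq_bigr => s _; rewrite mul1r.
    by rewrite upsum; apply: eq_bigr => s _; rewrite upsum.
  apply: up_local => a b ha hb.
  rewrite IH; last by apply/succn_inj; rewrite ha hb.
  + by rewrite -ha.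
  + exact: row_traceless_slice.
  + exact: col_traceless_slice.
- by move=> j n t z; apply: mix_trace_row.
- by move=> i n t z; apply: mix_trace_col.
Qed.

(** The coefficient of the term with j annihilations, read at output words of length n. The first
    letter either creates, over an output of length n - 1, or annihilates, from an output of length
    n + 1, and is then moved past the k' - j' creations behind it. *)
Fixpoint act_coef (k j n : nat) : K :=
  if k is k'.+1 then
    act_coef k' j n.-1 +
    if j is j'.+1 then act_coef k' j' n.+1 * swap_coef (k' - j') n else 0
  else (j == 0)%:R.

Lemma act_coef_small k (j n : nat) : (k < j)%N -> act_coef k j n = 0.
Proof.
elim: k j n => [|k IH] [|j] n //= hj.
by rewrite (IH j.+1) 1?ltnW // (IH j) // mul0r addr0.
Qed.

Lemma act_expand k X Y v w : row_traceless X -> col_traceless X ->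
  balanced Y -> size v = size w ->
  act k X Y v w = \sum_(j < k.+1) act_coef k j (size v) * mix (k - j) j X Y v w.
Proof.
elim: k X v w => [|k IH] X v w rX cX bY hvw.
  by rewrite big_ord_recl big_ord0 /= mul1r addr0.
rewrite actS; under eq_bigr => i _ do rewrite big_split /=.
rewrite big_split /=.
have -> : \sum_i \sum_j up i j (act k (slice i j X) Y) v w =
    \sum_(p < k.+1) act_coef k p (size v).-1 * mix (k - p).+1 p X Y v w.
  transitivity (\sum_i \sum_j \sum_(p < k.+1) act_coef k p (size v).-1 *
      up i j (mix (k - p) p (slice i j X) Y) v w).
    apply: eq_bigr => i _; apply: eq_bigr => j _; rewrite -up_sum.
    apply: up_local => a b ha hb; rewrite IH //.
    - by rewrite -ha.
    - exact: row_traceless_slice.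
    - exact: col_traceless_slice.
    - by apply/succn_inj; rewrite ha hb.
  under eq_bigr do rewrite exchange_big; rewrite exchange_big.
  apply: eq_bigr => p _; rewrite mixS mulr_sumr; apply: eq_bigr => i _.
  by rewrite mulr_sumr.
have -> : \sum_i \sum_j down i j (act k (slice i j X) Y) v w =
    \sum_(p < k.+1) act_coef k p (size v).+1 * swap_coef (k - p) (size v) *
       mix (k - p) p.+1 X Y v w.
  transitivity (\sum_i \sum_j \sum_(p < k.+1) act_coef k p (size v).+1 *
      down i j (mix (k - p) p (slice i j X) Y) v w).
    apply: eq_bigr => i _; apply: eq_bigr => j _; rewrite -down_sum.
    rewrite /down IH //=.
    - exact: row_traceless_slice.
    - exact: col_traceless_slice.
    - by rewrite hvw.
  under eq_bigr do rewrite exchange_big; rewrite exchange_big.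
  apply: eq_bigr => p _; rewrite -mulrA -down_mix // mulr_sumr; apply: eq_bigr => i _.
  by rewrite mulr_sumr.
pose g (j : nat) := if j is j'.+1 then
  act_coef k j' (size v).+1 * swap_coef (k - j') (size v) else 0.
transitivity (\sum_(j < k.+2) act_coef k j (size v).-1 * mix (k.+1 - j) j X Y v w +
    \sum_(j < k.+2) g j * mix (k.+1 - j) j X Y v w).
  congr (_ + _); first rewrite [RHS]big_ord_recr /= act_coef_small // mul0r addr0.
    by apply: eq_bigr => j _; rewrite subSn // -ltnS.

  by rewrite [RHS]big_ord_recl mul0r /= add0r.
by rewrite -big_split; apply: eq_bigr => j _; apply: esym (mulrDl _ _ _).
Qed.

Lemma bitraceless_sum (I : Type) (s : seq I) (f : I -> word -> word -> K) :
  (forall k, bitraceless (f k)) -> bitraceless (fun v w => \sum_(k <- s) f k v w).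
Proof.
move=> h; have := @bitraceless_comb _ s (fun=> 1) _ h.
by under eq_fun do under eq_fun do under eq_bigr do rewrite mul1r.
Qed.

Lemma bitraceless_act k X Y : bitraceless Y -> bitraceless (act k X Y).
Proof.
move=> hY; elim: k X => [|k IH] X.
  exact: (bitraceless_scale (fun=> X [::] [::]) hY).
apply: (@bitraceless_sum _ _ (fun i v w => \sum_j gen i j (act k (slice i j X) Y) v w)) => i.
by apply: bitraceless_sum => j; apply: bitraceless_gen.
Qed.

Lemma degree_lt_act n k X Y : degree_lt n Y -> degree_lt (n + k) (act k X Y).
Proof.
move=> hY; elim: k X => [|k IH] X v w hv.
  by rewrite /= hY ?mulr0 //; rewrite addn0 in hv.
rewrite actS big1 // => i _; rewrite big1 // => j _.
by apply: (degree_lt_gen _ _ (IH (slice i j X))); rewrite -addnS.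
Qed.

Lemma mix_short (m p : nat) X Y v w : (size v < m)%N -> mix m p X Y v w = 0.
Proof.
elim: m X v w => [//|m IH] X v w hv.
rewrite mixS big1 // => i _; rewrite big1 // => j _.
rewrite (@up_local i j _ (fun _ _ => 0)) => [|t z ht _].
  by rewrite /up /rcre cre_zero // => z; rewrite /ccre cre0.
by apply: IH; rewrite ht.
Qed.

Definition vac v w : K := (nilp v && nilp w)%:R.

Lemma bitraceless_vac : bitraceless vac.
Proof.
split=> [[|i v] [|j w] //|w|v] p q.
- by rewrite big1 // => i _; rewrite /vac /nilp size_cat addnS mulr0.
- by rewrite big1 // => i _; rewrite /vac /nilp size_cat addnS andbF mulr0.
Qed.

Lemma degree_lt_vac : degree_lt 1 vac.
Proof. by case=> [|i v] w. Qed.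

Fixpoint rproj k (x : word -> K) : word -> K :=
  if k is k'.+1 then fun v => \sum_i cre i (rproj k' (fun z => x (i :: z))) v
  else x.

Lemma rprojS k x v :
  rproj k.+1 x v = \sum_i cre i (rproj k (fun z => x (i :: z))) v.
Proof. by []. Qed.

Lemma rproj_sum (I : Type) (s : seq I) k (a : I -> K) (f : I -> word -> K) v :
  rproj k (fun z => \sum_(t <- s) a t * f t z) v = \sum_(t <- s) a t * rproj k (f t) v.
Proof.
elim: k f v => [//|k IH] f v; rewrite rprojS.
under eq_bigr => i _.
  rewrite (_ : rproj k _ = fun v => \sum_(t <- s) a t * rproj k (fun z => f t (i :: z)) v).
    by rewrite cre_sum; over.
  by apply/funext => z; rewrite -IH.
by rewrite exchange_big; apply: eq_bigr => t _; rewrite rprojS mulr_sumr.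
Qed.

Lemma rproj_zero k x v : (forall z, x z = 0) -> rproj k x v = 0.
Proof.
move=> h; rewrite (_ : x = fun z => \sum_(t <- [::] : seq unit) 0 * 0).
  by rewrite (rproj_sum _ _ _ (fun _ _ => 0)) big_nil.
by apply/funext => z; rewrite big_nil h.
Qed.

Lemma rproj_id k x v : traceless x -> size v = k -> rproj k x v = x v.
Proof.
elim: k x v => [//|k IH] x v hx hv; rewrite rprojS.
transitivity (\sum_i cre i (fun z => x (i :: z)) v); last first.
  by rewrite sum_cre_ann // -size_eq0 hv mul1r.
apply: eq_bigr => i _; apply: cre_local => z hz; apply: IH.
  exact: traceless_cons.
by apply/succn_inj; rewrite hz.
Qed.

(** Annihilation dies because consecutive letters of X are contracted in its traceless columns. What
    remains recreates the columns unchanged and projects the rows. The rows of X are left arbitrary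
    since invariance of h will be applied to coefficients with one frozen row. *)
Lemma act_vac k X v w : col_traceless X -> size v = size w ->
  act k X vac v w = (size v == k)%:R * rproj k (X^~ w) v.
Proof.
elim: k X v w => [|k IH] X v w cX hvw.
  by case: v w hvw => [|i v] [|j w] //= _; rewrite ?mulr1 ?mul1r ?mulr0 ?mul0r.
have IH' i j t z : size t = size z -> act k (slice i j X) vac t z =
    (size t == k)%:R * rproj k (fun s => X (i :: s) (j :: z)) t.
  by move=> ht; rewrite IH //; apply: col_traceless_slice.
rewrite actS; under eq_bigr do rewrite big_split /=.
rewrite big_split /= [X in _ + X]big1 ?addr0 => [|i _]; last first.
  transitivity ((mu (size v).+1)^-1 * l (r i) * ((size v).+1 == k)%:R *
    \sum_j l (r j) * rproj k (fun s => X (i :: s) (j :: r j :: w)) (r i :: v)).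
    rewrite mulr_sumr; apply: eq_bigr => j _.
    by rewrite /down IH' /= ?hvw //; ring.
  by rewrite -rproj_sum rproj_zero ?mulr0 // => s; apply: (cX (i :: s) [::]).
rewrite mulr_sumr; apply: eq_bigr => i _.
case: v w hvw => [|a v] [|b w] // hvw.
  by rewrite mul0r big1.
have cR t : traceless (fun z => rproj k (fun s => X (i :: s) z) t).
  move=> p q; rewrite -rproj_sum rproj_zero // => s; exact: (cX (i :: s)).
transitivity (\sum_j (size v == k)%:R *
   up i j (fun t z => rproj k (fun s => X (i :: s) (j :: z)) t) (a :: v) (b :: w)).
  apply: eq_bigr => j _; rewrite -upZ; apply: up_local => t z [ht] [hz].
  by rewrite IH' ht // hz; case: hvw.
rewrite -mulr_sumr eqSS; congr (_ * _).
under eq_bigr do rewrite up_ccre.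
transitivity (\sum_j cre j (fun z =>
   (fun s => cre i (rproj k (fun t => X (i :: t) s)) (a :: v)) (j :: z)) (b :: w)).
  by apply: eq_bigr => j _; apply: cre_local.
have h : traceless (fun s : word => cre i (rproj k (fun t => X (i :: t) s)) (a :: v)).
  by move=> p q; rewrite -cre_sum cre_zero // => t; apply: cR.
by rewrite -[RHS]mul1r; apply: (sum_cre_ann (b :: w) h).
Qed.

Section Action.
Variables (A : algType K) (u : 'I_N -> 'I_N -> A).
Hypothesis u_row : forall i m,
  \sum_j l (r j) *: (u i j * u m (r j)) = ((m == r i)%:R * l (r i)) *: 1.
Hypothesis u_col : forall j m,
  \sum_i l (r i) *: (u i j * u (r i) m) = ((m == r j)%:R * l (r j)) *: 1.

Lemma embed_sum (I : Type) (s : seq I) n (F : I -> word -> word -> K) :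
  embed u n (fun v w => \sum_(t <- s) F t v w) = \sum_(t <- s) embed u n (F t).
Proof.
by rewrite /embed exchange_big; apply: eq_bigr => k _; apply: coef_sum.
Qed.

Lemma embed_act n k X Y : bitraceless Y -> degree_lt n Y ->
  embed u (n + k) (act k X Y) = coef u k X * embed u n Y.
Proof.
move=> hY dY; elim: k X => [|k IH] X.
  rewrite addn0 /= -scalerAl mul1r /embed scaler_sumr.
  by apply: eq_bigr => k _; apply: coefZ.
rewrite addnS coefS mulr_suml embed_sum; apply: eq_bigr => i _.
rewrite mulr_suml embed_sum; apply: eq_bigr => j _.
rewrite (embed_gen u_row u_col) ?IH ?mulrA //.
- exact: bitraceless_act.
- exact: degree_lt_act.
Qed.

Lemma embed_vac : embed u 1 vac = 1.
Proof. by rewrite /embed big_ord_recl big_ord0 addr0 /= scale1r. Qed.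

End Action.

End WordOperators.

Arguments mu : simpl never.
Arguments qdim : simpl never.
Arguments coef : simpl never.
Arguments act : simpl never.

(** * The relations and their Fock space model *)

Section Relations.
Variables (R : realType) (N : nat) (lam : 'I_N -> R) (eps : R).
Hypothesis lam_rev : forall i, lam i * lam (rev_ord i) = eps.
Hypothesis eps_sqr : eps * eps = 1.
Local Notation C := R[i].
Local Notation r := (@rev_ord N).
Variable F : 'M[C]_N.
Hypothesis F_entry : forall i j, F i j = (lam i)%:C * (j == r i)%:R.

Definition lamC i : C := (lam i)%:C.
Definition star_coef i j : C := eps%:C * lamC i * lamC (r j).

Lemma lamC_rev i : lamC i * lamC (r i) = eps%:C.
Proof. by rewrite /lamC -castM lam_rev. Qed.

Lemma epsC_sqr : eps%:C * eps%:C = 1 :> C.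
Proof. by rewrite -castM eps_sqr. Qed.

Lemma star_coef_rev i j : star_coef i j * star_coef (r i) (r j) = 1.
Proof.
rewrite /star_coef rev_ordK.
transitivity (eps%:C * eps%:C * (lamC i * lamC (r i)) * (lamC j * lamC (r j))).
  by ring.
by rewrite !lamC_rev epsC_sqr mul1r epsC_sqr.
Qed.

Lemma F_sqr : F *m F = (eps%:C)%:M.
Proof.
apply/matrixP => i j; rewrite !mxE (bigD1 (r i)) //= big1 ?addr0.
  by rewrite !F_entry rev_ordK eqxx mulr1 mulrA -/(lamC i) -/(lamC (r i)) lamC_rev
    mulr_natr eq_sym.
by move=> k /negPf hk; rewrite F_entry hk mulr0 mul0r.
Qed.

Lemma invF_entry i j : invmx F i j = eps%:C * (lamC i * (j == r i)%:R).
Proof.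
have h : (eps%:C *: F) *m F = 1%:M.
  by rewrite -scalemxAl F_sqr scale_scalar_mx epsC_sqr.
have uF : F \in unitmx by case: (mulmx1_unit h).
have -> : invmx F = eps%:C *: F by rewrite -[LHS]mul1mx -h mulmxK.
by rewrite !mxE F_entry.
Qed.

Variables (B : cstarType R) (v : 'M[B]_N).

Lemma conj_F_entry i j :
  (scalar_mx_alg B F *m conj_mx v *m scalar_mx_alg B (invmx F)) i j =
  star_coef i j *: star (v (r i) (r j)).
Proof.
rewrite !mxE (bigD1 (r j)) //= [X in _ + X]big1 ?addr0; last first.
  move=> k hk; rewrite !mxE invF_entry.
  have /negPf -> : j != r k by apply: contra hk => /eqP ->; rewrite rev_ordK.
  by rewrite !mulr0 scale0r mulr0.
rewrite !mxE invF_entry rev_ordK eqxx mulr1.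
rewrite (bigD1 (r i)) //= [X in (_ + X) * _]big1 ?addr0; last first.
  move=> k /negPf hk; rewrite !mxE F_entry hk.
  by rewrite !mulr0 scale0r mul0r.
rewrite !mxE F_entry eqxx mulr1 -!scalerAl mul1r -scalerAr mulr1 scalerA.
by congr (_ *: _); rewrite /star_coef /lamC; ring.
Qed.

Definition row_relation := forall i m,
  \sum_j lamC (r j) *: (v i j * v m (r j)) = ((m == r i)%:R * lamC (r i)) *: 1.
Definition col_relation := forall j m,
  \sum_i lamC (r i) *: (v i j * v (r i) m) = ((m == r j)%:R * lamC (r j)) *: 1.
Definition star_relation := forall i j,
  star (v i j) = star_coef i j *: v (r i) (r j).

Lemma eq_rev (i m : 'I_N) : (i == r m) = (m == r i).
Proof. by apply/eqP/eqP => ->; rewrite rev_ordK. Qed.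

Lemma unitary_row : star_relation ->
  v *m (conj_mx v)^T = 1%:M <-> row_relation.
Proof.
move=> hs.
have E i m : (v *m (conj_mx v)^T) i (r m) =
    (eps%:C * lamC (r m)) *: \sum_j lamC (r j) *: (v i j * v m (r j)).
  rewrite !mxE scaler_sumr; apply: eq_bigr => j _.
  by rewrite !mxE hs rev_ordK scalerA -scalerAr.
have one i m : (1%:M : 'M[B]_N) i (r m) = (m == r i)%:R.
  by rewrite mxE eq_rev.
have val i m : (eps%:C * lamC (r m)) * ((m == r i)%:R * lamC (r i)) = (m == r i)%:R.
  have [->|_] := eqVneq m (r i); last by rewrite mul0r mulr0.
  by rewrite rev_ordK mul1r -mulrA lamC_rev epsC_sqr.
have el m : (lamC m) * (eps%:C * lamC (r m)) = 1.
  by rewrite mulrCA lamC_rev epsC_sqr.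
split=> h.
  move=> i m; have := E i m; rewrite h one => /(congr1 (fun b => lamC m *: b)).
  rewrite scalerA el scale1r => <-.
  have [->|_] := eqVneq m (r i); last by rewrite mul0r scale0r scaler0.
  by rewrite mul1r.
apply/matrixP => i m; rewrite -[m]rev_ordK E h scalerA val one.
by rewrite scaler_nat.
Qed.

Lemma unitary_col : star_relation ->
  (conj_mx v)^T *m v = 1%:M <-> col_relation.
Proof.
move=> hs.
have E j m : ((conj_mx v)^T *m v) (r j) m =
    (eps%:C * lamC j) *: \sum_i lamC (r i) *: (v i j * v (r i) m).
  rewrite !mxE scaler_sumr -(sum_rev (fun i => _ *: (lamC (r i) *: _))).
  apply: eq_bigr => i _; rewrite !mxE hs !rev_ordK scalerA -scalerAl.
  by congr (_ *: _); rewrite /star_coef rev_ordK; ring.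
have one j m : (1%:M : 'M[B]_N) (r j) m = (m == r j)%:R.
  by rewrite mxE eq_sym.
have val j : eps%:C * lamC j * lamC (r j) = 1.
  by rewrite -mulrA lamC_rev epsC_sqr.
split=> h.
  move=> j m; have := E j m; rewrite h one => /(congr1 (fun b => lamC (r j) *: b)).
  rewrite scalerA [lamC (r j) * _]mulrC val scale1r => <-.
  have [_|_] := eqVneq m (r j); last by rewrite mul0r scale0r scaler0.
  by rewrite mul1r.
apply/matrixP => j m; rewrite -[j]rev_ordK E h scalerA one.
rewrite mulrCA val mulr1.
by rewrite scaler_nat.
Qed.

(** The relation involving F says that the star of a generator is a multiple of the opposite
    generator. Substituting this into unitarity gives quadratic relations free of the star, which
    can be checked on operators and used in any algebra. *)
Lemma OF_relationsP : OF_relations F v <->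
  [/\ star_relation, row_relation & col_relation].
Proof.
have third : v = scalar_mx_alg B F *m conj_mx v *m scalar_mx_alg B (invmx F) <->
    star_relation.
  split=> h.
    move=> i j; have /matrixP /(_ (r i) (r j)) := h.
    rewrite conj_F_entry !rev_ordK => ->.
    by rewrite scalerA star_coef_rev scale1r.
  apply/matrixP => i j; rewrite conj_F_entry h !rev_ordK scalerA.
  by rewrite star_coef_rev scale1r.
split=> [[h1 h2 /third hs]|[hs h1 h2]].
  by split=> //; [apply/(unitary_row hs) | apply/(unitary_col hs)].
by split; [apply/(unitary_row hs) | apply/(unitary_col hs) | apply/third].
Qed.

End Relations.

(** * The Fock space as a pre-Hilbert space and the generators acting on it *)

Section Model.
Variables (R : realType) (N : nat) (lam : 'I_N -> R) (eps : R).
Hypothesis lam_rev : forall i, lam i * lam (rev_ord i) = eps.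
Hypothesis eps_sqr : eps * eps = 1.
Variable i0 : 'I_N.
Hypothesis i0_rev : rev_ord i0 != i0.
Hypothesis i0_ge1 : 1 <= lam i0 ^+ 2.
Local Notation C := R[i].
Local Notation r := (@rev_ord N).
Local Notation word := (seq 'I_N).
Local Notation l := (lamC lam).
Local Notation s := (lam i0 ^+ 2).

(** The distinct indices i0 and r i0 alone contribute s + s^-1 to \sum_i l_i^2, and mu_k >= s gives
    mu_(k+1) >= s + s^-1 - mu_k^-1 >= s. *)
Lemma mu_ge k : s <= mu lam k.+1.
Proof.
have s0 : 0 < s by apply: lt_le_trans i0_ge1.
have d1 : s + s^-1 <= \sum_(i < N) lam i ^+ 2.
  rewrite (bigD1 i0) //= (bigD1 (r i0)) //= lerD2l.
  have -> : s^-1 = lam (r i0) ^+ 2.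
    apply: (mulfI (lt0r_neq0 s0)); rewrite mulfV ?gt_eqF //.
    by rewrite -exprMn lam_rev expr2.
  by rewrite lerDl sumr_ge0 // => i _; apply: sqr_ge0.
elim: k => [|k IH].
  rewrite muS invr0 subr0; apply: le_trans d1.
  by rewrite lerDl invr_ge0 ltW.
rewrite muS lerBrDr.
apply: le_trans d1; rewrite lerD2l lef_pV2 ?posrE //.
exact: lt_le_trans s0 IH.
Qed.

Lemma mu_gt0 k : 0 < mu lam k.+1.
Proof. exact: lt_le_trans (lt_le_trans ltr01 i0_ge1) (mu_ge k). Qed.

Lemma muC k : mu l k = (mu lam k)%:C.
Proof.
elim: k => [//|k IH].
rewrite !muS IH castD castN castV cast_sum; congr (_ - _).
by apply: eq_bigr => i _; rewrite castX.
Qed.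

Lemma muC_neq0 k : mu l k.+1 != 0.
Proof.
by rewrite muC; apply: contraTneq (mu_gt0 k) => /complexI ->; rewrite ltxx.
Qed.

Lemma qdim_gt0 k : 0 < qdim lam k.
Proof. by elim: k => [|k IH]; rewrite ?ltr01 // mulr_gt0 ?mu_gt0. Qed.

Lemma qdimC k : qdim l k = (qdim lam k)%:C.
Proof.
elim: k => [//|k IH].
by rewrite -[qdim l k.+1]/(mu l k.+1 * qdim l k) IH muC -castM.
Qed.

Local Notation lr := (lamC_rev lam_rev).
Local Notation e2 := (epsC_sqr eps_sqr).
Local Notation m0 := muC_neq0.

Definition conjf (X : word -> word -> C) v w : C := (X v w)^*.

Lemma conj_mu k : (mu l k)^* = mu l k.
Proof. by rewrite muC conj_realC. Qed.

Lemma conj_l i : (l i)^* = l i.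
Proof. exact: conj_realC. Qed.

Lemma cre_conj i (x : word -> C) w :
  cre l i (fun z => (x z)^*) w = (cre l i x w)^*.
Proof.
elim: w i x => [|j w IH] i x; first by rewrite rmorph0.
rewrite !cre_cons IH rmorphB !rmorphM /= fmorphV /= !conj_l conj_mu.
by rewrite conjC_nat.
Qed.

Lemma up_conj i j X v w : up l i j (conjf X) v w = conjf (up l i j X) v w.
Proof.
rewrite /up /rcre /conjf -cre_conj; apply: cre_local => z _.
exact: cre_conj.
Qed.

Lemma gen_conj i j X : gen l i j (conjf X) = conjf (gen l i j X).
Proof.
apply/funext => v; apply/funext => w.
rewrite /gen up_conj /conjf rmorphD; congr (_ + _).
by rewrite /down !rmorphM fmorphV /= !conj_l conj_mu.
Qed.

Lemma bitraceless_conj X : bitraceless l X -> bitraceless l (conjf X).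
Proof.
move=> [h1 h2 h3]; split=> [v w hvw|w p q|v p q].
- by rewrite /conjf h1 ?rmorph0.
- transitivity ((\sum_i l (r i) * X (p ++ i :: r i :: q) w)^*); last by rewrite h2 rmorph0.
  rewrite rmorph_sum.
  by apply: eq_bigr => i _; rewrite rmorphM /= conj_l.
- transitivity ((\sum_i l (r i) * X v (p ++ i :: r i :: q))^*); last by rewrite h3 rmorph0.
  rewrite rmorph_sum.
  by apply: eq_bigr => i _; rewrite rmorphM /= conj_l.
Qed.

Lemma degree_lt_conj n X : degree_lt n X -> degree_lt n (conjf X).
Proof. by move=> h v w hv; rewrite /conjf h ?rmorph0. Qed.

Definition nsq k (X : word -> word -> C) : R :=
  bsum lam k (fun v w => normc (X v w) ^+ 2).

Definition normsq n X : R := \sum_(k < n) (qdim lam k)^-1 * nsq k X.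

Lemma bsum_cast k (f : word -> word -> R) :
  bsum l k (fun v w => (f v w)%:C) = (bsum lam k f)%:C.
Proof.
elim: k f => [//|k IH] f; rewrite !bsumS cast_sum; apply: eq_bigr => i _.
rewrite cast_sum; apply: eq_bigr => j _.
by rewrite castM castX -(IH (slice i j f)).
Qed.

Lemma pairing_self n X : pairing l n X (conjf X) = (normsq n X)%:C.
Proof.
rewrite /pairing /normsq cast_sum; apply: eq_bigr => k _.
rewrite castM castV qdimC -bsum_cast; congr (_ * _).
by apply: bsum_local => v w _ _; rewrite /conjf mulc_conj.
Qed.

Lemma bsum_ge0 k (f : word -> word -> R) :
  (forall v w, 0 <= f v w) -> 0 <= bsum lam k f.
Proof.
elim: k f => [|k IH] f h; first by rewrite bsum0.
rewrite bsumS sumr_ge0 // => i _; rewrite sumr_ge0 // => j _.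
by rewrite mulr_ge0 ?sqr_ge0 // IH // => v w; apply: h.
Qed.

Lemma nsq_ge0 k X : 0 <= nsq k X.
Proof. by apply: bsum_ge0 => v w; apply: sqr_ge0. Qed.

Lemma normsq_ge0 n X : 0 <= normsq n X.
Proof.
by apply: sumr_ge0 => k _; rewrite mulr_ge0 ?nsq_ge0 // invr_ge0 ltW // qdim_gt0.
Qed.

Lemma pairing_conj n X Y :
  (pairing l n X (conjf Y))^* = pairing l n Y (conjf X).
Proof.
have wsum_conj q k f : (forall i, (q i)^* = q i) ->
    (wsum q k f : C)^* = wsum q k (fun w => (f w)^*).
  move=> hq; elim: k f => [//|k IH] f; rewrite !wsumS rmorph_sum.
  by apply: eq_bigr => i _; rewrite rmorphM /= hq IH.
rewrite rmorph_sum; apply: eq_bigr => k _.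
rewrite rmorphM /= fmorphV /= qdimC conj_realC; congr (_ * _).
rewrite /bsum wsum_conj => [|i]; last by rewrite rmorphXn /= conj_l.
apply: wsum_local => v _; rewrite wsum_conj => [|i]; last by rewrite rmorph1.
by apply: wsum_local => w _; rewrite rmorphM /conjf /= conjCK mulrC.
Qed.

Lemma pairing_linear n (a : C) X Y Z :
  pairing l n (fun v w => a * X v w + Y v w) Z =
  a * pairing l n X Z + pairing l n Y Z.
Proof.
rewrite /pairing mulr_sumr -big_split; apply: eq_bigr => k _ /=.
rewrite mulrCA -mulrDr; congr (_ * _); rewrite -bsumZ -bsumD.
by apply: bsum_local => v w _ _; rewrite mulrDl mulrA.
Qed.

Definition fock_pred : pred (word -> word -> C^o) :=
  fun X => `[< bitraceless l X /\ exists n, degree_lt n X >].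

Lemma fock_submod : submod_closed fock_pred.
Proof.
split=> [|a X Y /asboolP[hX [n dX]] /asboolP[hY [m dY]]]; apply/asboolP.
  split; last by exists 0%N.
  by split=> // w p q; rewrite big1 // => i _; rewrite mulr0.
split.
  have -> : a *: X + Y = (fun v w => (fun=> a) (size v) * X v w + Y v w) by [].
  by apply: bitracelessD => //; apply: bitraceless_scale.
exists (maxn n m) => v w; rewrite geq_max => /andP[hn hm].
have -> : (a *: X + Y) v w = a * X v w + Y v w by [].
by rewrite dX // dY // mulr0 addr0.
Qed.
HB.instance Definition _ :=
  GRing.isSubmodClosed.Build C (word -> word -> C^o) fock_pred fock_submod.

Record fock := Fock {
  fock_val :> word -> word -> C^o;
  fockP : fock_pred fock_val }.

HB.instance Definition _ := [isSub for fock_val].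
HB.instance Definition _ := [Choice of fock by <:].
HB.instance Definition _ := [SubChoice_isSubLmodule of fock by <:].

Implicit Types x y z : fock.

Lemma fock_bitraceless x : bitraceless l x.
Proof. by have /asboolP[] := fockP x. Qed.

Lemma fock_degree x : exists n, degree_lt n x.
Proof. by have /asboolP[] := fockP x. Qed.

Lemma fock_ext x y : (forall v w, x v w = y v w) -> x = y.
Proof.
by move=> h; apply/val_inj/funext => v; apply/funext => w; apply: h.
Qed.

Lemma fock_linE (a : C) x y v w : (a *: x + y) v w = a * x v w + y v w.
Proof. by []. Qed.

Lemma fock_scaleE (a : C) x v w : (a *: x) v w = a * x v w.
Proof. by []. Qed.

Lemma fock_addE x y v w : (x + y) v w = x v w + y v w.
Proof. by []. Qed.

Lemma fock_sumE (I : Type) (t : seq I) (f : I -> fock) v w :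
  (\sum_(k <- t) f k) v w = \sum_(k <- t) f k v w.
Proof.
by elim: t => [|k t IH]; rewrite ?big_nil // !big_cons fock_addE IH.
Qed.

Definition degree x : nat := projT1 (cid (fock_degree x)).

Lemma degreeP x : degree_lt (degree x) x.
Proof. exact: projT2 (cid (fock_degree x)). Qed.

Definition fip x y : C := pairing l (degree x) x (conjf y).

Lemma fipE n x y : degree_lt n x \/ degree_lt n y ->
  fip x y = pairing l n x (conjf y).
Proof.
move=> h; rewrite /fip.
rewrite -(@pairing_widen _ _ l (degree x) (maxn (degree x) n)) ?leq_maxl //.
  rewrite (@pairing_widen _ _ l n) ?leq_maxr //.
  by case: h => h; [left | right; apply: degree_lt_conj].
by left; apply: degreeP.
Qed.

Lemma fip_linear (a : C) x y z : fip (a *: x + y) z = a * fip x z + fip y z.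
Proof.
pose n := degree z.
have h : degree_lt n z by exact: degreeP.
have E t : fip t z = pairing l n t (conjf z) by apply: fipE; right.
by rewrite !E -pairing_linear.
Qed.

Lemma fip_conj x y : (fip x y)^* = fip y x.
Proof.
by rewrite (@fipE (degree y) x); [rewrite pairing_conj | right; apply: degreeP].
Qed.

Lemma fip_self n x : degree_lt n x -> fip x x = (normsq n x)%:C.
Proof. by move=> h; rewrite (@fipE n); [rewrite pairing_self | left]. Qed.

Lemma fip_ge0 x : 0 <= fip x x.
Proof. by rewrite (fip_self (@degreeP x)) lecR normsq_ge0. Qed.

Lemma vac_subproof : fock_pred (vac C (N := N)).
Proof.
apply/asboolP; split; first exact: bitraceless_vac.
by exists 1%N; apply: degree_lt_vac.
Qed.

Definition fvac := Fock vac_subproof.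

Lemma fip_vac x : fip x fvac = x [::] [::].
Proof.
rewrite (@fipE 1); last by right; apply: degree_lt_vac.
rewrite /pairing big_ord_recl big_ord0 addr0 bsum0 /= invr1 mul1r.
by rewrite /conjf /vac /= rmorph1 mulr1.
Qed.

Lemma fip_vac1 : fip fvac fvac = 1.
Proof. by rewrite fip_vac. Qed.

Canonical fock_space : preHilbert R :=
  PreHilbert fip_linear fip_conj fip_ge0 fip_vac1.

Lemma fgen_subproof i j x : fock_pred (gen l i j x).
Proof.
apply/asboolP; split.
  exact: (bitraceless_gen lr e2 m0 _ _ (fock_bitraceless x)).
by exists (degree x).+1; apply: degree_lt_gen; apply: degreeP.
Qed.

Definition fgen i j x := Fock (fgen_subproof i j x).

Lemma fgenE i j x v w : fgen i j x v w = up l i j x v w + down l i j x v w.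
Proof. by []. Qed.

Lemma fip_fgen i j x y :
  fip (fgen i j x) y = star_coef lam eps i j * fip x (fgen (r i) (r j) y).
Proof.
pose n := maxn (degree x) (degree y).
have dx : degree_lt n x by apply: degree_lt_mono (@degreeP x); rewrite leq_maxl.
have dy : degree_lt n y by apply: degree_lt_mono (@degreeP y); rewrite leq_maxr.
rewrite (@fipE n.+1); last by left; apply: degree_lt_gen.
rewrite (@fipE n.+1); last by left; apply: degree_lt_mono dx.
rewrite (pairing_gen lr e2 i j (fock_bitraceless x)
  (bitraceless_conj (fock_bitraceless y)) dx (degree_lt_conj dy)).
by rewrite gen_conj.
Qed.

Lemma fgen_row i m x :
  \sum_j l (r j) *: fgen i j (fgen m (r j) x) = ((m == r i)%:R * l (r i)) *: x.
Proof.
apply: fock_ext => v w; rewrite fock_sumE fock_scaleE.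
exact: (gen_row_relation lr e2 m0 i m v w (fock_bitraceless x)).
Qed.

Lemma fgen_col j m x :
  \sum_i l (r i) *: fgen i j (fgen (r i) m x) = ((m == r j)%:R * l (r j)) *: x.
Proof.
apply: fock_ext => v w; rewrite fock_sumE fock_scaleE.
exact: (gen_col_relation lr e2 m0 j m v w (fock_bitraceless x)).
Qed.

(** Adjointness and the column relation give \sum_i |u_ij x|^2 = |x|^2, of which the left-hand side
    is a single summand. *)
Lemma fgen_le i j x : phnorm (fgen i j x : fock_space) <= phnorm (x : fock_space).
Proof.
rewrite -(@ler_pXn2r _ 2) ?nnegrE ?phnorm_ge0 //.
have key : \sum_i fip (fgen i j x) (fgen i j x) = fip x x.
  transitivity (fip (\sum_i (eps%:C * l (r j)) *: (l i *: fgen (r i) (r j) (fgen i j x))) x).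
    rewrite (@ip_sum _ fock_space); apply: eq_bigr => m _.
    rewrite -fip_conj fip_fgen rmorphM /= fip_conj scalerA (@ipZ _ fock_space).
    congr (_ * _); rewrite /star_coef !rmorphM /= !conj_l conj_realC; ring.
  rewrite -scaler_sumr.
  have -> : \sum_i l i *: fgen (r i) (r j) (fgen i j x) = l j *: x.
    rewrite -(sum_rev (fun i => l i *: fgen (r i) (r j) (fgen i j x))).
    under eq_bigr do rewrite rev_ordK.
    by rewrite fgen_col rev_ordK eqxx mul1r.
  rewrite scalerA (@ipZ _ fock_space).
  have -> : eps%:C * l (r j) * l j = 1 by rewrite -mulrA [l (r j) * _]mulrC lr e2.
  exact: mul1r.
rewrite -lecR -!(@ip_self _ fock_space) -[X in _ <= X]/(fip x x) -key.
rewrite (bigD1 i) //= lerDl sumr_ge0 // => m _.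
exact: fip_ge0.
Qed.

Lemma fgen_adjointable i j : adjointable (H := fock_space) (fgen i j)
  (fun x => star_coef lam eps i j *: fgen (r i) (r j) x).
Proof.
have bg i' j' : bounded_op (H := fock_space) (fgen i' j').
  by exists 1 => // x; rewrite mul1r; apply: fgen_le.
split; [ | exact: bg | exact: bounded_opZ].
move=> x y; rewrite [LHS]fip_fgen (@ipZr _ fock_space).
by rewrite /star_coef !rmorphM /= !conj_l conj_realC.
Qed.

Definition fock_alg : cstarType R := boundedForm fock_space.

Definition ualg i j : fock_alg := op_elt (fgen_adjointable i j).

Lemma fock_alg_sum (I : Type) (t : seq I) (f : I -> fock_alg) x y :
  bform (\sum_(k <- t) f k) x y = \sum_(k <- t) bform (f k) x y.
Proof.
elim: t => [|k t IH]; first by rewrite !big_nil.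
by rewrite !big_cons bformDE IH.
Qed.

Lemma ualg_mul i j m n x y :
  bform (ualg i j * ualg m n) x y = fip (fgen i j (fgen m n x)) y.
Proof. by rewrite op_elt_comp. Qed.

Lemma ualg_star i j :
  star (ualg i j) = star_coef lam eps i j *: ualg (r i) (r j).
Proof.
apply: bform_ext => x y; rewrite bformZE.
have -> : bform (star (ualg i j)) = op_form (H := fock_space)
   (fun x => star_coef lam eps i j *: fgen (r i) (r j) x) by exact: op_elt_star.
by rewrite /op_form (@ipZ _ fock_space).
Qed.

Variable F : 'M[C]_N.
Hypothesis F_entry : forall i j, F i j = (lam i)%:C * (j == r i)%:R.

Lemma ualg_relations : OF_relations F (\matrix_(i, j) ualg i j).
Proof.
apply/(OF_relationsP lam_rev eps_sqr F_entry); split.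
- by move=> i j; rewrite !mxE ualg_star.
- move=> i m; apply: bform_ext => x y; rewrite fock_alg_sum bformZE.
  rewrite -[bform 1 x y]/(fip x y) -(@ipZ _ fock_space) -fgen_row.
  rewrite (@ip_sum _ fock_space); apply: eq_bigr => j _.
  by rewrite bformZE !mxE ualg_mul (@ipZ _ fock_space).
- move=> j m; apply: bform_ext => x y; rewrite fock_alg_sum bformZE.
  rewrite -[bform 1 x y]/(fip x y) -(@ipZ _ fock_space) -fgen_col.
  rewrite (@ip_sum _ fock_space); apply: eq_bigr => i _.
  by rewrite bformZE !mxE ualg_mul (@ipZ _ fock_space).
Qed.

End Model.

(** * The Haar state *)

Section Representation.
Variables (R : realType) (H : preHilbert R).
Implicit Types (f g : boundedForm H) (T S : H -> H).

(** Elements of the algebra are only forms. This records that a form comes from an operator on the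
    algebraic Fock space, so that polynomials in the generators can be evaluated on vectors. *)
Definition represents f T := exists S (a : adjointable T S), f = op_elt a.

Lemma representsP f T S : adjointable T S -> bform f = op_form T -> represents f T.
Proof.
by move=> a h; exists S, a; apply: bform_ext => x y; rewrite h.
Qed.

Lemma represents_form f T : represents f T -> bform f = op_form T.
Proof. by case=> S [a ->]. Qed.

Lemma represents1 : represents 1 id.
Proof. exact: representsP (adjointable_id H) _. Qed.

Lemma represents0 : represents 0 (fun=> 0).
Proof.
have b0 : bounded_op (fun=> 0 : H).
  by exists 0 => // x; rewrite phnorm0 mul0r.
apply: (@representsP _ _ (fun=> 0)).
  by split=> // x y; rewrite ip0l -ip_conj ip0l rmorph0.
by apply/funext => x; apply/funext => y; rewrite /op_form ip0l.
Qed.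

Lemma representsD f g T S : represents f T -> represents g S ->
  represents (f + g) (fun x => T x + S x).
Proof.
move=> [T' [aT ->]] [S' [aS ->]]; apply: representsP (adjointableD aT aS) _.
by apply/funext => x; apply/funext => y; rewrite bformDE /op_form ipD.
Qed.

Lemma representsZ (a : R[i]) f T : represents f T ->
  represents (a *: f) (fun x => a *: T x).
Proof.
move=> [T' [aT ->]]; apply: representsP (adjointableZ a aT) _.
by apply/funext => x; apply/funext => y; rewrite bformZE /op_form ipZ.
Qed.

Lemma representsM f g T S : represents f T -> represents g S ->
  represents (f * g) (T \o S).
Proof.
move=> [T' [aT ->]] [S' [aS ->]]; apply: representsP (adjointable_comp aT aS) _.
exact: op_elt_comp.
Qed.

Lemma represents_sum (I : Type) (t : seq I) (f : I -> boundedForm H)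
    (T : I -> H -> H) : (forall k, represents (f k) (T k)) ->
  represents (\sum_(k <- t) f k) (fun x => \sum_(k <- t) T k x).
Proof.
move=> h; elim: t => [|k t IH].
  rewrite big_nil (_ : (fun _ => _) = fun=> 0); first exact: represents0.
  by apply/funext => x; rewrite big_nil.
rewrite big_cons (_ : (fun _ => _) = fun x => T k x + \sum_(k <- t) T k x).
  exact: representsD.
by apply/funext => x; rewrite big_cons.
Qed.

End Representation.

Section StarAlgebra.
Variables (R : realType) (A : cstarType R).

Lemma star1 : star (1 : A) = 1.
Proof. by rewrite -[LHS]mul1r -[X in X * _](starK 1) -starM mul1r starK. Qed.

Lemma star_sum (I : Type) (t : seq I) (f : I -> A) :
  star (\sum_(k <- t) f k) = \sum_(k <- t) star (f k).
Proof.
elim: t => [|k t IH]; last by rewrite !big_cons starD IH.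
by rewrite !big_nil -[X in star X](scale0r 1) starZ rmorph0 scale0r.
Qed.

End StarAlgebra.

Section HaarState.
Variables (R : realType) (N : nat) (lam : 'I_N -> R) (eps : R).
Hypothesis lam_rev : forall i, lam i * lam (rev_ord i) = eps.
Hypothesis eps_sqr : eps * eps = 1.
Variable i0 : 'I_N.
Hypothesis i0_rev : rev_ord i0 != i0.
Hypothesis i0_ge1 : 1 <= lam i0 ^+ 2.
Local Notation C := R[i].
Local Notation r := (@rev_ord N).
Local Notation word := (seq 'I_N).
Local Notation l := (lamC lam).
Local Notation lr := (lamC_rev lam_rev).
Local Notation e2 := (epsC_sqr eps_sqr).
Local Notation m0 := (muC_neq0 lam_rev eps_sqr i0_rev i0_ge1).
Variable F : 'M[C]_N.
Hypothesis F_entry : forall i j, F i j = (lam i)%:C * (j == r i)%:R.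
Variables (A : cstarType R) (u : 'M[A]_N).
Hypothesis A_COF : is_COF F u.
Variables (Delta : A -> seq (A * A)) (h : {scalar A}).
Hypothesis A_coproduct : is_coproduct u Delta.
Hypothesis A_Haar : is_Haar_state u Delta h.
Local Notation fock := (fock lam).
Local Notation gen := (fgen lam_rev eps_sqr i0_rev i0_ge1).
Implicit Types (x y : fock) (X Y : word -> word -> C).

Lemma u_rel : [/\ star_relation lam eps u, row_relation lam u & col_relation lam u].
Proof. by case: A_COF => /(OF_relationsP lam_rev eps_sqr F_entry). Qed.

Lemma u_star : star_relation lam eps u. Proof. by case: u_rel. Qed.
Lemma u_row : row_relation lam u. Proof. by case: u_rel. Qed.
Lemma u_col : col_relation lam u. Proof. by case: u_rel. Qed.

Local Notation coef := (@coef C N A u).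

Definition emb x : A := embed u (degree x) x.

Lemma embE n x : degree_lt n x -> emb x = embed u n x.
Proof.
move=> hn; rewrite /emb -(@embedE _ _ _ _ (degree x) (maxn (degree x) n)) ?leq_maxl //.
  by rewrite (@embedE _ _ _ _ n) ?leq_maxr.
exact: degreeP.
Qed.

Lemma emb_linear (a : C) x y : emb (a *: x + y) = a *: emb x + emb y.
Proof.
pose n := maxn (degree x) (degree y).
have dx : degree_lt n x by apply: degree_lt_mono (@degreeP _ _ _ x); rewrite leq_maxl.
have dy : degree_lt n y by apply: degree_lt_mono (@degreeP _ _ _ y); rewrite leq_maxr.
have dxy : degree_lt n (a *: x + y).
  by move=> v w hv; rewrite fock_linE dx // dy // mulr0 addr0.
rewrite (embE dx) (embE dy) (embE dxy) /embed scaler_sumr -big_split /=.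
by apply: eq_bigr => k _; rewrite -coefZ -coefD.
Qed.

Lemma embD x y : emb (x + y) = emb x + emb y.
Proof. by rewrite -[x]scale1r emb_linear !scale1r. Qed.

Lemma emb0 : emb 0 = 0.
Proof. by apply: (addrI (emb 0)); rewrite -embD !addr0. Qed.

Lemma embZ (a : C) x : emb (a *: x) = a *: emb x.
Proof. by rewrite -[a *: x]addr0 emb_linear emb0 addr0. Qed.

Lemma embB x y : emb (x - y) = emb x - emb y.
Proof. by rewrite embD -scaleN1r embZ scaleN1r. Qed.

Lemma emb_vac : emb (fvac lam) = 1.
Proof.
by rewrite (embE (n := 1)); [exact: embed_vac | exact: degree_lt_vac].
Qed.

Lemma emb_gen i j x : emb (gen i j x) = u i j * emb x.
Proof.
rewrite (embE (n := (degree x).+1)); last first.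
  by apply: degree_lt_gen; apply: degreeP.
apply: (embed_gen lr e2 m0 u_row u_col); first exact: fock_bitraceless.
exact: degreeP.
Qed.

Lemma act_subproof k X x : fock_pred lam (act l k X x).
Proof.
apply/asboolP; split.
  exact: (bitraceless_act lr e2 m0 _ _ (fock_bitraceless x)).
by exists (degree x + k)%N; apply: degree_lt_act; apply: degreeP.
Qed.

Definition fact k X x : fock := Fock (act_subproof k X x).

Lemma emb_fact k X x : emb (fact k X x) = coef k X * emb x.
Proof.
rewrite (embE (n := degree x + k)); last first.
  by apply: degree_lt_act; apply: degreeP.
apply: (embed_act lr e2 m0 u_row u_col); first exact: fock_bitraceless.
exact: degreeP.
Qed.

Lemma fact0 X x : fact 0 X x = X [::] [::] *: x.
Proof. exact: fock_ext. Qed.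

Lemma factS k X x :
  fact k.+1 X x = \sum_i \sum_j gen i j (fact k (slice i j X) x).
Proof.
apply: fock_ext => v w; rewrite fock_sumE [LHS]actS; apply: eq_bigr => i _.
by rewrite fock_sumE.
Qed.

Lemma Pol_u i j : Pol u (u i j).
Proof. by move=> S _; apply. Qed.

Lemma Pol1 : Pol u 1.
Proof. by move=> S [S1 _ _ _ _] _. Qed.

Lemma PolD a b : Pol u a -> Pol u b -> Pol u (a + b).
Proof.
move=> ha hb S hS hu; case: (hS) => [_ SD _ _ _].
by apply: SD; [apply: ha | apply: hb].
Qed.

Lemma PolZ (c : C) a : Pol u a -> Pol u (c *: a).
Proof.
by move=> ha S hS hu; case: (hS) => [_ _ SZ _ _]; apply: SZ; apply: ha.
Qed.

Lemma PolM a b : Pol u a -> Pol u b -> Pol u (a * b).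
Proof.
move=> ha hb S hS hu; case: (hS) => [_ _ _ SM _].
by apply: SM; [apply: ha | apply: hb].
Qed.

Lemma Pol_star a : Pol u a -> Pol u (star a).
Proof.
by move=> ha S hS hu; case: (hS) => [_ _ _ _ SS]; apply: SS; apply: ha.
Qed.

Lemma Pol_sum (I : Type) (t : seq I) (f : I -> A) :
  (forall k, Pol u (f k)) -> Pol u (\sum_(k <- t) f k).
Proof.
move=> hf; elim: t => [|k t IH]; last by rewrite big_cons; apply: PolD.
by rewrite big_nil -(scale0r 1); apply: PolZ; apply: Pol1.
Qed.

Lemma Pol_coef k X : Pol u (coef k X).
Proof.
elim: k X => [|k IH] X; first by apply: PolZ; apply: Pol1.
rewrite coefS; apply: Pol_sum => i; apply: Pol_sum => j.
by apply: PolM; [apply: Pol_u | apply: IH].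
Qed.

Definition left_stable (a : A) := forall x, exists y, a * emb x = emb y.

Lemma left_stable_star_subalg :
  unital_star_subalg [set a : A | left_stable a /\ left_stable (star a)].
Proof.
have D a b : left_stable a -> left_stable b -> left_stable (a + b).
  move=> ha hb x; have [[y hy] [z hz]] := (ha x, hb x).
  by exists (y + z); rewrite mulrDl hy hz embD.
have Z (c : C) a : left_stable a -> left_stable (c *: a).
  by move=> ha x; have [y hy] := ha x; exists (c *: y); rewrite -scalerAl hy embZ.
have M a b : left_stable a -> left_stable b -> left_stable (a * b).
  move=> ha hb x; have [y hy] := hb x; have [z hz] := ha y.
  by exists z; rewrite -mulrA hy hz.
have o : left_stable 1 by move=> x; exists x; rewrite mul1r.
split=> /=.
- by rewrite star1.
- by move=> a b [a1 a2] [b1 b2]; rewrite starD; split; apply: D.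
- by move=> c a [a1 a2]; rewrite starZ; split; apply: Z.
- by move=> a b [a1 a2] [b1 b2]; rewrite starM; split; apply: M.
- by move=> a [a1 a2]; rewrite starK.
Qed.

(** The image of [emb] contains 1 and is stable under left multiplication by generators and their
    stars. Since [Pol u] is defined through star subalgebras, stability is carried for a and
    [star a] together. *)
Lemma Pol_embP a : Pol u a -> exists x, a = emb x.
Proof.
move=> /(_ _ left_stable_star_subalg) [].
  move=> i j; have hu m n : left_stable (u m n).
    by move=> x; exists (gen m n x); rewrite emb_gen.
  split=> //; rewrite u_star => x.
  exists (star_coef lam eps i j *: gen (r i) (r j) x).
  by rewrite embZ emb_gen scalerAl.
by move=> /(_ (fvac lam)) [x] + _; rewrite emb_vac mulr1 => ->; exists x.
Qed.

(* The vector state of the vacuum, pulled back to A by universality. *)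
Lemma vacuum_functional : exists psi : A -> C,
  [/\ forall (c : C) a b, psi (c *: a + b) = c * psi a + psi b,
      psi 1 = 1
    & forall k X, psi (coef k X) = act l k X (fvac lam) [::] [::]].
Proof.
have [_ _ /(_ (fock_alg lam_rev eps_sqr i0_rev i0_ge1) _
  (ualg_relations lam_rev eps_sqr i0_rev i0_ge1 F_entry)) [pi [_ pi_u]]] := A_COF.
pose H := fock_space lam_rev eps_sqr i0_rev i0_ge1.
have rep k X : represents (pi (coef k X) : boundedForm H) (fact k X).
  elim: k X => [|k IH] X.
    rewrite (_ : fact 0 X = fun x => X [::] [::] *: x).
      by rewrite linearZ rmorph1; apply: (representsZ _ (represents1 H)).
    by apply/funext => x; rewrite fact0.
  rewrite (_ : fact k.+1 X = fun x => \sum_i \sum_j gen i j (fact k (slice i j X) x)).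
    rewrite coefS rmorph_sum; apply: (represents_sum (H := H)) => i.
    rewrite rmorph_sum; apply: (represents_sum (H := H)) => j.
    rewrite rmorphM /= pi_u mxE; apply: (representsM (H := H)) (IH _).
    by exists _, (fgen_adjointable lam_rev eps_sqr i0_rev i0_ge1 i j).
  by apply/funext => x; rewrite factS.
exists (fun a => bform (pi a : boundedForm H) (fvac lam) (fvac lam)); split.
- by move=> c a b; rewrite linearD linearZ bformDE bformZE.
- by rewrite rmorph1; exact: (fip_vac1 lam).
- by move=> k X; rewrite (represents_form (rep k X)); exact: fip_vac.
Qed.

Definition linear_fun (phi : A -> C) :=
  forall (c : C) a b, phi (c *: a + b) = c * phi a + phi b.

Lemma linear_fun0 phi : linear_fun phi -> phi 0 = 0.
Proof.
by move=> hp; have := hp 1 0 0; rewrite scaler0 addr0 mul1r => /esym/eqP;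
  rewrite -subr_eq0 addrK => /eqP.
Qed.

Lemma linear_funZ phi (c : C) a : linear_fun phi -> phi (c *: a) = c * phi a.
Proof. by move=> hp; rewrite -[c *: a]addr0 hp linear_fun0 // addr0. Qed.

Lemma linear_fun_sum phi (I : Type) (t : seq I) (f : I -> A) : linear_fun phi ->
  phi (\sum_(k <- t) f k) = \sum_(k <- t) phi (f k).
Proof.
move=> hp; elim: t => [|k t IH]; first by rewrite !big_nil linear_fun0.
by rewrite !big_cons -IH -[f k]scale1r hp mul1r scale1r.
Qed.

Lemma linear_fun_mul phi a : linear_fun phi -> linear_fun (fun b => phi (a * b)).
Proof. by move=> hp c b b'; rewrite mulrDr -scalerAr hp. Qed.

Definition bilinear_fun (beta : A -> A -> C) :=
  (forall a, linear_fun (beta a)) /\ (forall b, linear_fun (beta^~ b)).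

(** Equality of tensors is tested by bilinear forms, so the coproduct enters only through these
    pairings. *)
Definition Delta_sum (beta : A -> A -> C) a := \sum_(p <- Delta a) beta p.1 p.2.

Lemma Delta_sumZ beta (c : C) a : bilinear_fun beta -> Pol u a ->
  Delta_sum beta (c *: a) = c * Delta_sum beta a.
Proof.
move=> [b1 b2] ha; have [_ [_ _ hZ] _ _ _] := A_coproduct.
rewrite /Delta_sum (hZ c a ha beta b1 b2) big_map mulr_sumr.
by apply: eq_bigr => p _; rewrite (linear_funZ _ _ (b2 _)).
Qed.

Lemma Delta_sumD beta a b : bilinear_fun beta -> Pol u a -> Pol u b ->
  Delta_sum beta (a + b) = Delta_sum beta a + Delta_sum beta b.
Proof.
move=> [b1 b2] ha hb; have [_ [_ hD _] _ _ _] := A_coproduct.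
by rewrite /Delta_sum (hD a b ha hb beta b1 b2) big_cat.
Qed.

Lemma Delta_sum_sum beta (I : Type) (t : seq I) (f : I -> A) :
  bilinear_fun beta -> (forall k, Pol u (f k)) ->
  Delta_sum beta (\sum_(k <- t) f k) = \sum_(k <- t) Delta_sum beta (f k).
Proof.
move=> hb hf; elim: t => [|k t IH].
  rewrite !big_nil -(scale0r 1) Delta_sumZ //; last exact: Pol1.
  by rewrite mul0r.
by rewrite !big_cons Delta_sumD ?IH //; apply: Pol_sum.
Qed.

Lemma Delta_sum_gen beta i j b : bilinear_fun beta -> Pol u b ->
  Delta_sum beta (u i j * b) =
  \sum_m Delta_sum (fun a a' => beta (u i m * a) (u m j * a')) b.
Proof.
move=> [b1 b2] hb; have [_ _ hM _ hu] := A_coproduct.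
rewrite /Delta_sum (hM _ _ (Pol_u i j) hb beta b1 b2) big_allpairs_dep /=.
pose gamma (a a' : A) := \sum_(q <- Delta b) beta (a * q.1) (a' * q.2).
have g1 a : linear_fun (gamma a).
  move=> c a1 a2; rewrite /gamma mulr_sumr -big_split; apply: eq_bigr => q _.
  by rewrite mulrDl -scalerAl b1.
have g2 a' : linear_fun (gamma^~ a').
  move=> c a1 a2; rewrite /gamma mulr_sumr -big_split; apply: eq_bigr => q _.
  by rewrite mulrDl -scalerAl b2.
rewrite -[LHS]/(\sum_(p <- Delta (u i j)) gamma p.1 p.2) (hu i j gamma g1 g2).
by rewrite big_map big_enum.
Qed.

Fixpoint coprod k X (beta : A -> A -> C) : C :=
  if k is k'.+1 then
    \sum_i \sum_j \sum_m
      coprod k' (slice i j X) (fun a b => beta (u i m * a) (u m j * b))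
  else X [::] [::] * beta 1 1.

Lemma Delta_sum_coef k X beta : bilinear_fun beta ->
  Delta_sum beta (coef k X) = coprod k X beta.
Proof.
elim: k X beta => [|k IH] X beta hb.
  rewrite Delta_sumZ //; last exact: Pol1.
  have [b1 b2] := hb; have [_ [h1 _ _] _ _ _] := A_coproduct.
  by rewrite /Delta_sum (h1 beta b1 b2) big_seq1.
rewrite coefS Delta_sum_sum //; last first.
  by move=> i; apply: Pol_sum => j; apply: PolM; [apply: Pol_u | apply: Pol_coef].
apply: eq_bigr => i _; rewrite Delta_sum_sum //; last first.
  by move=> j; apply: PolM; [apply: Pol_u | apply: Pol_coef].
apply: eq_bigr => j _; rewrite Delta_sum_gen //; last exact: Pol_coef.
apply: eq_bigr => m _; apply: IH.
have [b1 b2] := hb; split=> [a|b]; first exact: (linear_fun_mul _ (b1 _)).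
exact: (linear_fun_mul _ (b2 _)).
Qed.

Fixpoint uword (v w : word) : A :=
  match v, w with
  | i :: v', j :: w' => u i j * uword v' w'
  | _, _ => 1
  end.

Local Notation sum1 := (wsum (fun=> 1 : C)).

Lemma linear_fun_coef phi k X : linear_fun phi ->
  phi (coef k X) = sum1 k (fun v => sum1 k (fun w => X v w * phi (uword v w))).
Proof.
elim: k X phi => [|k IH] X phi hp; first by rewrite linear_funZ.
rewrite coefS linear_fun_sum // wsumS; apply: eq_bigr => i _.
rewrite mul1r linear_fun_sum // -[RHS]mul1r.
rewrite mul1r; under [RHS]wsum_local do rewrite wsumS; rewrite wsum_sum.
apply: eq_bigr => j _; under [RHS]wsum_local do rewrite mul1r.
exact: (IH (slice i j X) _ (linear_fun_mul _ hp)).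
Qed.

Lemma coprod_tensor k X phi psi : linear_fun phi -> linear_fun psi ->
  coprod k X (fun a b => phi a * psi b) =
  sum1 k (fun v => sum1 k (fun z => phi (uword v z) *
    sum1 k (fun w => X v w * psi (uword z w)))).
Proof.
elim: k X phi psi => [|k IH] X phi psi hp hq; first by rewrite /= mulrCA.
rewrite wsumS; apply: eq_bigr => i _; rewrite mul1r.
under [RHS]wsum_local do rewrite wsumS.
rewrite wsum_sum exchange_big; apply: eq_bigr => m _.
under [RHS]wsum_local do rewrite mul1r.
transitivity (\sum_j sum1 k (fun v => sum1 k (fun z => phi (u i m * uword v z) *
    sum1 k (fun w => slice i j X v w * psi (u m j * uword z w))))).
  apply: eq_bigr => j _.
  exact: (IH (slice i j X) _ _ (linear_fun_mul _ hp) (linear_fun_mul _ hq)).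
rewrite -wsum_sum; apply: wsum_local => v _.
rewrite -wsum_sum; apply: wsum_local => z _.
rewrite -mulr_sumr wsumS; congr (_ * _); apply: eq_bigr => j _.
by rewrite mul1r.
Qed.

Lemma wsum_delta k (f : word -> C) z : size z = k ->
  sum1 k (fun t => (t == z)%:R * f t) = f z.
Proof.
elim: k f z => [|k IH] f [|i z] // hz; first by rewrite /= mul1r.
rewrite wsumS (bigD1 i) //= mul1r big1 ?addr0.
  rewrite -(IH (fun t => f (i :: t)) z); last by case: hz.
  by apply: wsum_local => t _; rewrite eqseq_cons eqxx.
move=> j /negPf hj; rewrite mul1r (@wsum_local _ _ _ _ _ (fun=> 0)) ?wsum0 //.
by move=> t _; rewrite eqseq_cons hj mul0r.
Qed.

Lemma h_lin : linear_fun h.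
Proof. by move=> c a b; rewrite linearD linearZ. Qed.

(** Let psi be the vacuum functional. By invariance h(a) = psi(h(a) 1) is the value of h \otimes psi
    on the coproduct of a, and there every second leg is a coefficient of degree k + 1, on which psi
    vanishes. *)
Lemma Haar_coef k X : col_traceless l X -> h (coef k.+1 X) = 0.
Proof.
move=> cX; have [psi [psi_lin psi1 psi_coef]] := vacuum_functional.
have h_lin := h_lin.
have [_ _ inv _] := A_Haar.
have ha := Pol_coef k.+1 X.
have : psi (\sum_(p <- Delta (coef k.+1 X)) h p.1 *: p.2) = h (coef k.+1 X).
  by rewrite inv // linear_funZ // psi1 mulr1.
rewrite linear_fun_sum //; under eq_bigr do rewrite linear_funZ //.
move=> <-; rewrite -[LHS]/(Delta_sum (fun a b => h a * psi b) (coef k.+1 X)).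
rewrite Delta_sum_coef; last first.
  split=> [a|b] c a1 a2; rewrite ?psi_lin ?h_lin; ring.
rewrite coprod_tensor // (@wsum_local _ _ _ _ _ (fun=> 0)) ?wsum0 // => v _.
rewrite (@wsum_local _ _ _ _ _ (fun=> 0)) ?wsum0 // => z hz.
set s := wsum _ _ _; suff -> : s = 0 by rewrite mulr0.
(* Freezing the row word at z writes the inner sum as psi of one coefficient with traceless columns,
   the case covered by [act_vac]. *)
have <- : psi (coef k.+1 (fun z' w => (z' == z)%:R * X v w)) = s.
  rewrite linear_fun_coef //.
  transitivity (sum1 k.+1 (fun t => (t == z)%:R *
    sum1 k.+1 (fun w => X v w * psi (uword t w)))); last exact: (wsum_delta _ hz).
  apply: wsum_local => t _; rewrite -wsumZ; apply: wsum_local => w _.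
  by rewrite mulrA.
rewrite psi_coef act_vac ?mul0r // => t p q.
under eq_bigr do rewrite mulrCA.
by rewrite -mulr_sumr cX mulr0.
Qed.

Lemma Haar_emb x : h (emb x) = x [::] [::].
Proof.
have [[h1 _] _ _ _] := A_Haar.
have hx := fock_bitraceless x; have [_ _ cx] := hx.
rewrite (embE (n := (degree x).+1)); last first.
  by apply: degree_lt_mono (@degreeP _ _ _ x).
rewrite /embed (linear_fun_sum _ _ h_lin) big_ord_recl big1 ?addr0 => [|k _]; last exact: Haar_coef.
by rewrite (linear_funZ _ _ h_lin) h1 mulr1.
Qed.

(** The vacuum is cyclic: the degree k part of x, acting on it, yields that part again, since the
    projections fix traceless functions. *)
Lemma fact_vac_sum n x : degree_lt n x ->
  \sum_(k < n) fact k x (fvac lam) = x.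
Proof.
move=> dx; apply: fock_ext => v w; rewrite fock_sumE.
have [bx rx cx] := fock_bitraceless x.
have [hvw|hvw] := eqVneq (size v) (size w); last first.
  rewrite bx // big1 // => k _.
  by have [-> //] := fock_bitraceless (fact k x (fvac lam)).
have E (k : nat) : fact k x (fvac lam) v w = (size v == k)%:R * x v w.
  rewrite [LHS]act_vac //.
  by case: eqP => [hk|]; rewrite ?mul0r // (rproj_id (rx w)).
under eq_bigr do rewrite E.
have [hn|hn] := leqP n (size v); first by rewrite dx // big1 // => k _; rewrite mulr0.
rewrite (bigD1 (Ordinal hn)) //= eqxx mul1r big1 ?addr0 // => k.
by rewrite -val_eqE /= eq_sym => /negPf ->; rewrite mul0r.
Qed.

(** Generators are moved one at a time across the inner product. Their stars in A and their adjoints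
    on the Fock space carry the same scalar [star_coef]. *)
Lemma Haar_star_coef k X y :
  h (star (coef k X) * emb y) = fip y (fact k X (fvac lam)).
Proof.
elim: k X y => [|k IH] X y.
  rewrite starZ star1 -scalerAl mul1r (linear_funZ _ _ h_lin) Haar_emb fact0.
  rewrite -fip_conj (@ipZ _ (fock_space lam_rev eps_sqr i0_rev i0_ge1)) rmorphM /=.
  by rewrite -[ip _ _]/(fip (fvac lam) y) fip_conj fip_vac.
rewrite coefS factS star_sum mulr_suml (linear_fun_sum _ _ h_lin).
rewrite -fip_conj (@ip_sum _ (fock_space lam_rev eps_sqr i0_rev i0_ge1)) rmorph_sum.
apply: eq_bigr => i _; rewrite star_sum mulr_suml (linear_fun_sum _ _ h_lin).
rewrite (@ip_sum _ (fock_space lam_rev eps_sqr i0_rev i0_ge1)) rmorph_sum.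
apply: eq_bigr => j _.
rewrite starM -mulrA u_star -scalerAl -emb_gen -embZ IH.
rewrite /= fip_conj.
have [H _ _] := fgen_adjointable lam_rev eps_sqr i0_rev i0_ge1 i j.
rewrite -[RHS]fip_conj -[fip (gen _ _ _) y]/(ip (gen i j _ : fock_space lam_rev eps_sqr i0_rev i0_ge1) y) H.
exact: esym (fip_conj _ _).
Qed.

Lemma Haar_inner x y : h (star (emb x) * emb y) = fip y x.
Proof.
rewrite (embE (@degreeP _ _ _ x)) /embed star_sum mulr_suml (linear_fun_sum _ _ h_lin).
under eq_bigr do rewrite Haar_star_coef.
rewrite -[X in fip y X](fact_vac_sum (@degreeP _ _ _ x)) -[RHS]fip_conj.
rewrite (@ip_sum _ (fock_space lam_rev eps_sqr i0_rev i0_ge1)) rmorph_sum.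
by apply: eq_bigr => k _; rewrite /= fip_conj.
Qed.

Lemma L2norm_emb n x : degree_lt n x -> L2norm h (emb x) = Num.sqrt (normsq lam n x).
Proof. by move=> dx; rewrite /L2norm Haar_inner (fip_self dx). Qed.

Local Notation fspace := (fock_space lam_rev eps_sqr i0_rev i0_ge1).

Lemma L2norm_phnorm x : L2norm h (emb x) = phnorm (x : fspace).
Proof. by rewrite /L2norm Haar_inner. Qed.

Lemma low_vanish p X Y v w :
  (forall t z, size t = (p + size v)%N -> Y t z = 0) -> low l p X Y v w = 0.
Proof.
elim: p X v w => [|p IH] X v w hY; first by rewrite /= hY ?mulr0.
rewrite lowS big1 // => i _; rewrite big1 // => j _.
by rewrite /down IH ?mulr0 // => t z ht; apply: hY; rewrite ht addnS.
Qed.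

Lemma Haar_gen_left i j x : h (u i j * emb x) =
  (mu l 1)^-1 * l (r i) * l (r j) * x [:: r i] [:: r j].
Proof. by rewrite -emb_gen Haar_emb fgenE add0r. Qed.

(** Compared with [Haar_gen_left], the indices are replaced by their opposites: this is the modular
    twist of h on a generator. *)
Lemma Haar_gen_right i j x : h (emb x * u i j) =
  (mu l 1)^-1 * l i * l j * x [:: r i] [:: r j].
Proof.
have [bx rx cx] := fock_bitraceless x.
pose z := gen i j (fvac lam).
have -> : u i j = emb z by rewrite emb_gen emb_vac mulr1.
have zE v w : z v w = up l i j (vac C (N := N)) v w.
  by rewrite /z fgenE /down /vac /nilp /= mulr0 addr0.
have hz v w : size v != 1%N -> z v w = 0.
  move=> hv; rewrite zE; case: v hv => [|a [|b v]] // _.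
  rewrite (@up_local _ _ _ _ _ _ (fun _ _ => 0)) => [|t y [ht] _].
    by rewrite /up /rcre cre_zero // => y; rewrite /ccre cre0.
  by rewrite /vac /nilp ht.
(* At the empty word only the normally ordered summand that creates nothing survives, and z lives in
   degree 1. *)
have term k : h (coef k x * emb z) = (k == 1%N)%:R * low l 1 x z [::] [::].
  rewrite -emb_fact Haar_emb [LHS](act_expand lr e2) //; last first.
    by have [] := fock_bitraceless z.
  rewrite big_ord_recr /= subnn /= big1 ?add0r => [|p _]; last first.
    by rewrite mix_short ?mulr0 // subn_gt0.
  case: k => [|[|k]]; rewrite ?mul0r ?mul1r.
  - by rewrite low_vanish ?mulr0 // => t y ht; apply: hz; rewrite ht.
  - by rewrite /= mul1r add0r mul1r.
  - by rewrite low_vanish ?mulr0 // => t y ht; apply: hz; rewrite ht.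
rewrite (embE (n := (degree x).+2)); last first.
  by apply: degree_lt_mono (@degreeP _ _ _ x); rewrite ltnW.
rewrite /embed mulr_suml (linear_fun_sum _ _ h_lin).
under eq_bigr do rewrite [h _]term.
rewrite big_ord_recl mul0r add0r big_ord_recl mul1r big1 ?addr0 => [|k _]; last first.
  by rewrite mul0r.
have -> : low l 1 x z [::] [::] = low l 1 x (up l i j (vac C (N := N))) [::] [::].
  by congr low; apply/funext => v; apply/funext => w; apply: zE.
rewrite /= (bigD1 (r i)) //= (bigD1 (r j)) //= [X in _ + X + _]big1 ?addr0; last first.
  move=> b hb; rewrite /down /up /rcre /ccre /= !mulr0 subr0.
  have /negPf -> : j != r b by apply: contra hb => /eqP ->; rewrite rev_ordK.
  by rewrite !(mulr0, mul0r, subr0).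
rewrite [X in _ + X]big1 ?addr0; last first.
  move=> a ha; rewrite big1 // => b _; rewrite /down /up /rcre /ccre /= !mulr0 !subr0.
  have /negPf -> : i != r a by apply: contra ha => /eqP ->; rewrite rev_ordK.
  by rewrite !(mulr0, mul0r, subr0).
rewrite /down /up /rcre /ccre /= !rev_ordK !mulr0 !subr0 !eqxx.
by rewrite /vac /= /slice; ring.
Qed.

(** If l_i^2 = 1, then l_(r i) = eps l_i, and the two values of h with a generator on the left or on
    the right agree because eps^2 = 1. Commutation under h then spreads from generators to
    products. *)
Lemma Kac_of_unit : (forall i, lam i ^+ 2 = 1) -> Kac_type u h.
Proof.
move=> lam1.
have lam_eps i : l (r i) = eps%:C * l i.
  rewrite -(lr i); transitivity (l i ^+ 2 * l (r i)); last by ring.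
  by rewrite /lamC -castX lam1 mul1r.
have comm i j a : Pol u a -> h (u i j * a) = h (a * u i j).
  move=> /Pol_embP[x ->]; rewrite Haar_gen_left Haar_gen_right !lam_eps.
  transitivity (eps%:C * eps%:C * ((mu l 1)^-1 * l i * l j * x [:: r i] [:: r j])).
    by ring.
  by rewrite e2 mul1r.
(* Both b and [star b] are included so that S is closed under the star. *)
pose S := [set b | Pol u b /\
  (forall a, Pol u a -> h (b * a) = h (a * b)) /\
  (forall a, Pol u a -> h (star b * a) = h (a * star b))].
suff hS : forall b, Pol u b -> S b.
  by move=> a b ha /hS[_ [+ _]] => /(_ a ha) ->.
have D b b' : (forall a, Pol u a -> h (b * a) = h (a * b)) ->
   (forall a, Pol u a -> h (b' * a) = h (a * b')) ->
   forall a, Pol u a -> h ((b + b') * a) = h (a * (b + b')).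
  move=> h1 h2 a ha; rewrite mulrDl mulrDr.
  have hD (p q : A) : h (p + q) = h p + h q by have := h_lin 1 p q; rewrite scale1r mul1r.
  by rewrite !hD h1 ?h2.
have Z (c : C) b : (forall a, Pol u a -> h (b * a) = h (a * b)) ->
   forall a, Pol u a -> h ((c *: b) * a) = h (a * (c *: b)).
  by move=> h1 a ha; rewrite -scalerAl -scalerAr !(linear_funZ _ _ h_lin) h1.
have M b b' : Pol u b -> Pol u b' -> (forall a, Pol u a -> h (b * a) = h (a * b)) ->
   (forall a, Pol u a -> h (b' * a) = h (a * b')) ->
   forall a, Pol u a -> h ((b * b') * a) = h (a * (b * b')).
  move=> pb pb' h1 h2 a ha; rewrite -mulrA h1; last exact: PolM.
  by rewrite -mulrA h2 ?mulrA //; apply: PolM.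
move=> b; apply.
  split=> /=.
  - split; first exact: Pol1.
    by split=> a _; rewrite ?star1 mul1r mulr1.
  - move=> p q [p1 [p2 p3]] [q1 [q2 q3]]; split; first exact: PolD.
    by split; [apply: D | rewrite starD; apply: D].
  - move=> c p [p1 [p2 p3]]; split; first exact: PolZ.
    by split; [apply: Z | rewrite starZ; apply: Z].
  - move=> p q [p1 [p2 p3]] [q1 [q2 q3]]; split; first exact: PolM.
    by split; [apply: M | rewrite starM; apply: M => //; apply: Pol_star].
  - move=> p [p1 [p2 p3]]; split; first exact: Pol_star.
    by rewrite starK.
move=> i j; split; first exact: Pol_u.
split; first by move=> a; apply: comm.
by rewrite u_star; apply: Z => a; apply: comm.
Qed.

Lemma PolB a b : Pol u a -> Pol u b -> Pol u (a - b).
Proof. by move=> ha hb; rewrite -scaleN1r; apply: PolD => //; apply: PolZ. Qed.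

Lemma L2norm_triangle a b : Pol u a -> Pol u b ->
  `|L2norm h a - L2norm h b| <= L2norm h (a - b).
Proof.
move=> /Pol_embP[x ->] /Pol_embP[y ->]; rewrite -embB !L2norm_phnorm.
have t (p q : fspace) : phnorm p - phnorm q <= phnorm (p - q).
  by rewrite lerBlDr; apply: le_trans (phnormD _ _); rewrite subrK.
rewrite ler_norml t andbT lerNl opprB; apply: le_trans (t y x) _.
have -> : (y : fspace) - x = - (x - y) by rewrite opprB.
by rewrite -scaleN1r phnormZ normc_opp normc1 mul1r.
Qed.

Lemma L2vec_cvg (x : nat -> A) : L2vec u h x -> cvgn (fun n => L2norm h (x n)).
Proof.
move=> [Px hx]; apply/cauchy_cvgP/cauchy_ballP => e e0.
near_simpl; have [M hM] := hx e e0.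
near=> m n => /=; rewrite /ball /=.
apply: le_lt_trans (L2norm_triangle (Px _) (Px _)) _.
apply: hM; first by near: m; exists M.
by near: n; exists M.
Unshelve. all: by end_near.
Qed.

(** * The operator norm of left multiplication, from estimates on polynomials *)

Section LeftMultiplication.
Variables (f : A) (c : R).
Hypothesis Pf : Pol u f.
Hypothesis c_ge0 : 0 <= c.
Hypothesis f_bound : forall a, Pol u a -> L2norm h (f * a) <= c * L2norm h a.

Lemma L2vec_mul (x : nat -> A) : L2vec u h x -> L2vec u h (fun n => f * x n).
Proof.
move=> [Px hx]; split=> [n|e e0]; first exact: PolM.
have c1 : 0 < c + 1 by rewrite ltr_wpDl.
have [M hM] := hx _ (divr_gt0 e0 c1); exists M => m n hm hn.
rewrite -mulrBr; apply: le_lt_trans (f_bound (PolB (Px m) (Px n))) _.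
have := hM m n hm hn; rewrite ltr_pdivlMr // mulrC => h1.
apply: le_lt_trans h1; rewrite ler_wpM2r ?lerDl //.
exact: sqrtr_ge0.
Qed.

Lemma L2vec_mul_le (x : nat -> A) : L2vec u h x -> L2vec_norm h x <= 1 ->
  L2vec_norm h (fun n => f * x n) <= c.
Proof.
move=> hx x1.
have cx := L2vec_cvg hx; have cfx := L2vec_cvg (L2vec_mul hx).
apply: (@le_trans _ _ (c * L2vec_norm h x)); last by rewrite ler_piMr.
have -> : c * L2vec_norm h x = limn (fun n => c * L2norm h (x n)).
  by rewrite (limM (is_cvg_cst _) cx) (lim_cst (@norm_hausdorff _ _)).
have ccx : cvgn (fun n => c * L2norm h (x n)) by apply: is_cvgM => //; apply: is_cvg_cst.
apply: ler_lim => //; apply: nearW => n.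
by apply: f_bound; case: hx.
Qed.

Definition L2_image := [set L2vec_norm h (fun n => f * x n)
  | x in [set x : nat -> A | L2vec u h x /\ L2vec_norm h x <= 1]].

Lemma L2vec_const a : Pol u a -> L2vec u h (fun=> a).
Proof.
move=> ha; split=> // e e0; exists 0%N => m n _ _.
rewrite subrr -[X in L2norm h X](scale0r 1) /L2norm starZ rmorph0 scale0r mul0r.
by rewrite -(scale0r (1 : A)) (linear_funZ _ _ h_lin) mul0r /= sqrtr0.
Qed.

Lemma L2vec_norm_const a : L2vec_norm h (fun=> a) = L2norm h a.
Proof. exact: (lim_cst (@norm_hausdorff _ _)). Qed.

Lemma L2norm0 : L2norm h 0 = 0.
Proof. by rewrite -emb0 L2norm_phnorm phnorm0. Qed.

Lemma L2norm_scale (k : C) a : Pol u a -> L2norm h (k *: a) = normc k * L2norm h a.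
Proof. by move=> /Pol_embP[x ->]; rewrite -embZ !L2norm_phnorm phnormZ. Qed.

Lemma L2_image_has_sup : has_sup L2_image.
Proof.
split; last by exists c => _ [x [hx x1] <-]; apply: L2vec_mul_le.
exists (L2vec_norm h (fun=> f * 0)); exists (fun=> 0) => //.
split; last by rewrite L2vec_norm_const L2norm0.
by apply: L2vec_const; rewrite -(scale0r 1); apply: PolZ; apply: Pol1.
Qed.

Lemma Crnorm_le : Crnorm u h f <= c.
Proof.
apply: ge_sup; first by case: L2_image_has_sup.
by move=> _ [x [hx x1] <-]; apply: L2vec_mul_le.
Qed.

(** The bound c ensures that [sup] is taken over a bounded set and is a true supremum. The test
    vector is the constant sequence of a divided by its norm. *)
Lemma Crnorm_ge a : Pol u a -> L2norm h (f * a) <= Crnorm u h f * L2norm h a.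
Proof.
move=> ha; have a0 : 0 <= L2norm h a by apply: sqrtr_ge0.
have [an|an] := eqVneq (L2norm h a) 0.
  by have := f_bound ha; rewrite an !mulr0.
have ap : 0 < L2norm h a by rewrite lt_neqAle eq_sym an.
rewrite -ler_pdivrMr //; apply: ub_le_sup; first by case: L2_image_has_sup.
have nv : normc ((L2norm h a)^-1)%:C = (L2norm h a)^-1.
  by rewrite normc_real ger0_norm // invr_ge0.
exists (fun=> ((L2norm h a)^-1)%:C *: a).
  split; first by apply: L2vec_const; apply: PolZ.
  by rewrite L2vec_norm_const L2norm_scale // nv mulVf.
by rewrite L2vec_norm_const -scalerAr L2norm_scale ?nv 1?mulrC //; apply: PolM.
Qed.

End LeftMultiplication.

Lemma Haar_le_L2norm a : Pol u a -> normc (h a) <= L2norm h a.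
Proof.
move=> /Pol_embP[x ->]; rewrite Haar_emb -fip_vac L2norm_phnorm.
have := @cauchy_schwarz _ fspace x (fvac lam).
by rewrite (@phnorm_vec _ fspace) mulr1.
Qed.

Lemma L2norm_star_mul a : Pol u a -> normc (h (star a * a)) = L2norm h a ^+ 2.
Proof.
move=> /Pol_embP[x ->]; rewrite Haar_inner L2norm_phnorm.
by rewrite -[fip x x]/(ip (x : fspace) x) ip_self normc_real ger0_norm ?sqr_ge0.
Qed.
End HaarState.

(** * The upper bound *)

Section Estimates.
Variables (R : realType) (N : nat) (lam : 'I_N -> R) (eps : R).
Hypothesis lam_rev : forall i, lam i * lam (rev_ord i) = eps.
Hypothesis eps_sqr : eps * eps = 1.
Variable i0 : 'I_N.
Hypothesis i0_rev : rev_ord i0 != i0.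
Hypothesis i0_gt1 : 1 < lam i0 ^+ 2.
Hypothesis i0_max : forall i, lam i ^+ 2 <= lam i0 ^+ 2.
Local Notation C := R[i].
Local Notation r := (@rev_ord N).
Local Notation word := (seq 'I_N).
Local Notation l := (lamC lam).
Local Notation s := (lam i0 ^+ 2).
Local Notation i0_ge1 := (ltW i0_gt1).
Local Notation lr := (lamC_rev lam_rev).
Local Notation e2 := (epsC_sqr eps_sqr).
Local Notation m0 := (muC_neq0 lam_rev eps_sqr i0_rev i0_ge1).
Local Notation nsq := (@nsq R N lam).
Local Notation d := (qdim lam).
Implicit Types (X Y Z : word -> word -> C).

Lemma sqrt_amgm (t a b : R) : 0 <= a -> 0 <= b -> t ^+ 2 <= a * b -> 2 * t <= a + b.
Proof.
move=> a0 b0 h; have [t0|t0] := leP t 0.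
  by apply: le_trans (addr_ge0 a0 b0); rewrite mulr_ge0_le0.
rewrite -(@ler_pXn2r _ 2) ?nnegrE ?addr_ge0 ?mulr_ge0 ?(ltW t0) //.
have : 0 <= (a - b) ^+ 2 by apply: sqr_ge0.
by rewrite exprMn sqrrB sqrrD; lra.
Qed.

Lemma sum_cauchy_schwarz (I : finType) (a x y : I -> R) :
  (forall i, 0 <= x i) -> (forall i, 0 <= y i) ->
  (forall i, a i ^+ 2 <= x i * y i) ->
  (\sum_i a i) ^+ 2 <= (\sum_i x i) * (\sum_i y i).
Proof.
move=> x0 y0 h.
have E : 2 * (\sum_i a i) ^+ 2 <= \sum_i \sum_j (x i * y j + x j * y i).
  rewrite expr2 mulr_suml mulr_sumr; apply: ler_sum => i _.
  rewrite mulr_sumr mulr_sumr; apply: ler_sum => j _.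
  apply: sqrt_amgm; rewrite ?mulr_ge0 //.
  have := ler_pM (sqr_ge0 _) (sqr_ge0 _) (h i) (h j).
  by rewrite exprMn; move/le_trans; apply; rewrite mulrACA [y i * _]mulrC mulrACA.
have T : \sum_i \sum_j x i * y j = (\sum_i x i) * (\sum_i y i).
  by rewrite mulr_suml; apply: eq_bigr => i _; rewrite mulr_sumr.
have S : \sum_i \sum_j (x i * y j + x j * y i) = 2 * ((\sum_i x i) * (\sum_i y i)).
  under eq_bigr do rewrite big_split /=.
  by rewrite big_split /= [X in _ + X]exchange_big /= T mulr_natl mulr2n.
by rewrite S ler_pM2l in E.
Qed.

Lemma normc_sum_sqr (I : finType) (f : I -> C) :
  normc (\sum_i f i) ^+ 2 <= (\sum_i normc (f i)) ^+ 2.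
Proof.
rewrite ler_pXn2r ?nnegrE ?normc_nneg ?sumr_ge0 // => [|i _]; last exact: normc_nneg.
elim/big_rec2: _ => [|i a b _ h]; first by rewrite normc0.
by apply: le_trans (normc_triangle _ _) _; rewrite lerD2l.
Qed.

Lemma normc_sum_cs (I : finType) (f : I -> C) (x y : I -> R) :
  (forall i, 0 <= x i) -> (forall i, 0 <= y i) ->
  (forall i, normc (f i) ^+ 2 <= x i * y i) ->
  normc (\sum_i f i) ^+ 2 <= (\sum_i x i) * (\sum_i y i).
Proof.
move=> x0 y0 h; apply: le_trans (normc_sum_sqr f) _.
exact: sum_cauchy_schwarz.
Qed.

Lemma lam_sqr_rev i : lam i ^+ 2 * lam (r i) ^+ 2 = 1.
Proof. by rewrite -exprMn lam_rev expr2. Qed.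

Lemma nsqS k X : nsq k.+1 X = \sum_i \sum_j lam i ^+ 2 * nsq k (slice i j X).
Proof. exact: bsumS. Qed.

Lemma bsum_le k (f g : word -> word -> R) :
  (forall v w, size v = k -> size w = k -> f v w <= g v w) ->
  bsum lam k f <= bsum lam k g.
Proof.
elim: k f g => [|k IH] f g hfg; first by rewrite !bsum0 hfg.
rewrite !bsumS; apply: ler_sum => i _; apply: ler_sum => j _.
rewrite ler_wpM2l ?sqr_ge0 // IH // => v w hv hw.
by apply: hfg; rewrite /= ?hv ?hw.
Qed.

Lemma Re_sum (I : Type) (t : seq I) (f : I -> C) :
  complex.Re (\sum_(k <- t) f k) = \sum_(k <- t) complex.Re (f k).
Proof.
by elim: t => [|k t IH]; rewrite ?big_nil // !big_cons ReD IH.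
Qed.

Lemma Re_bsum k (f : word -> word -> C) :
  complex.Re (bsum l k f) = bsum lam k (fun v w => complex.Re (f v w)).
Proof.
elim: k f => [//|k IH] f; rewrite !bsumS Re_sum; apply: eq_bigr => i _.
rewrite Re_sum; apply: eq_bigr => j _.
by rewrite -castX ReZ IH.
Qed.

Lemma Re_bsum_le k X Z :
  2 * complex.Re (bsum l k (fun v w => X v w * conjf Z v w)) <= nsq k X + nsq k Z.
Proof.
rewrite Re_bsum -bsumZ -bsumD; apply: bsum_le => v w _ _.
apply: (@le_trans _ _ (2 * (normc (X v w) * normc (Z v w)))).
  rewrite ler_pM2l //; apply: le_trans (ler_norm _) _.
  by apply: le_trans (Re_le_normc _) _; rewrite normcM normc_conj.
by apply: sqrt_amgm; rewrite ?sqr_ge0 // exprMn.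
Qed.

(** Creation is adjoint to slicing, and slicing preserves the total squared norm by [nsqS]. So 2
    |W|^2 is at most the right-hand side plus |W|^2, where W is the function on the left. *)
Lemma nsq_sum_up k (G : 'I_N -> 'I_N -> word -> word -> C) :
  (forall i j, bitraceless l (G i j)) ->
  nsq k.+1 (fun v w => \sum_i \sum_j up l i j (G i j) v w) <=
  \sum_i \sum_j lam i ^+ 2 * nsq k (G i j).
Proof.
move=> hG; pose W v w := \sum_i \sum_j up l i j (G i j) v w.
have hW : bitraceless l W.
  apply: (@bitraceless_sum _ _ _ _ _ (fun i v w => \sum_j up l i j (G i j) v w)) => i.
  by apply: bitraceless_sum => j; apply: (bitraceless_up lr e2 m0).
have E : nsq k.+1 W = \sum_i \sum_j lam i ^+ 2 *
    complex.Re (bsum l k (fun v w => G i j v w * conjf (slice i j W) v w)).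
  have -> : nsq k.+1 W = complex.Re (bsum l k.+1 (fun v w => W v w * conjf W v w)).
    rewrite Re_bsum; apply: bsum_local => v w _ _.
    by rewrite /conjf mulc_conj.
  rewrite (@bsum_local _ _ _ _ _ (fun v w => \sum_i \sum_j up l i j (G i j) v w * conjf W v w)).
    rewrite bsum_sum Re_sum; apply: eq_bigr => i _.
    rewrite bsum_sum Re_sum; apply: eq_bigr => j _.
    rewrite (bsum_up lr e2) -?castX ?ReZ //.
    exact: (bitraceless_conj (lam := lam)).
  by move=> v w _ _; rewrite {1}/W mulr_suml; apply: eq_bigr => i _; rewrite mulr_suml.
have F : 2 * nsq k.+1 W <= (\sum_i \sum_j lam i ^+ 2 * nsq k (G i j)) + nsq k.+1 W.
  rewrite {1}E nsqS -big_split mulr_sumr; apply: ler_sum => i _ /=.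
  rewrite -big_split mulr_sumr; apply: ler_sum => j _ /=.
  by rewrite -mulrDr mulrCA ler_wpM2l ?sqr_ge0 // Re_bsum_le.
by rewrite -/W; lra.
Qed.

(** The factor belonging to Y when Cauchy-Schwarz is applied to [low] letter by letter. Of l_i^4,
    one square comes from the scalar of [down] and the other is the inverse of the row weight given
    to X; l_k^2 comes from [down] alone. *)
Fixpoint low_sqr j Y v w : R :=
  if j is j'.+1 then
    (mu lam (size v).+1) ^- 2 *
      \sum_i \sum_k lam i ^+ 4 * lam k ^+ 2 * low_sqr j' Y (i :: v) (k :: w)
  else normc (Y v w) ^+ 2.

Lemma low_sqr_ge0 j Y v w : 0 <= low_sqr j Y v w.
Proof.
elim: j v w => [|j IH] v w; first exact: sqr_ge0.
rewrite /= mulr_ge0 ?invr_ge0 ?exprn_even_ge0 // sumr_ge0 // => i _.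
rewrite sumr_ge0 // => k _; rewrite mulr_ge0 ?IH // mulr_ge0 ?exprn_even_ge0 //.
Qed.

Lemma low_le j X Y v w :
  normc (low l j X Y v w) ^+ 2 <= nsq j X * low_sqr j Y v w.
Proof.
elim: j X v w => [|j IH] X v w.
  by rewrite /= normcM exprMn /nsq bsum0.
rewrite lowS nsqS.
have -> : low_sqr j.+1 Y v w = \sum_i \sum_k (lam (r i)) ^+ 2 *
   ((mu lam (size v).+1) ^- 2 * lam (r i) ^+ 2 * lam (r k) ^+ 2 *
    low_sqr j Y (r i :: v) (r k :: w)).
  rewrite /= mulr_sumr -(sum_rev (fun i => _ * \sum_k lam i ^+ 4 * lam k ^+ 2 * _)).
  apply: eq_bigr => i _; rewrite mulr_sumr.
  rewrite -(sum_rev (fun k => _ * (lam (r i) ^+ 4 * lam k ^+ 2 * _))).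
  by apply: eq_bigr => k _; ring.
rewrite !pair_big /=.
apply: (normc_sum_cs (x := fun p => lam p.1 ^+ 2 * nsq j (slice p.1 p.2 X))
  (y := fun p => (lam (r p.1)) ^+ 2 *
   ((mu lam (size v).+1) ^- 2 * lam (r p.1) ^+ 2 * lam (r p.2) ^+ 2 *
    low_sqr j Y (r p.1 :: v) (r p.2 :: w)))) => [[i k]|[i k]|[i k]] /=.
- by rewrite mulr_ge0 ?sqr_ge0 ?nsq_ge0.
- by do ![rewrite sqr_ge0 | rewrite low_sqr_ge0 | rewrite invr_ge0 | apply: mulr_ge0].
have -> : lam i ^+ 2 * nsq j (slice i k X) * (lam (r i) ^+ 2 *
   ((mu lam (size v).+1) ^- 2 * lam (r i) ^+ 2 * lam (r k) ^+ 2 *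
    low_sqr j Y (r i :: v) (r k :: w))) =
  (mu lam (size v).+1) ^- 2 * lam (r i) ^+ 2 * lam (r k) ^+ 2 *
   (nsq j (slice i k X) * low_sqr j Y (r i :: v) (r k :: w)).
  transitivity (lam i ^+ 2 * lam (r i) ^+ 2 *
   ((mu lam (size v).+1) ^- 2 * lam (r i) ^+ 2 * lam (r k) ^+ 2 *
   (nsq j (slice i k X) * low_sqr j Y (r i :: v) (r k :: w)))); first by ring.
  by rewrite lam_sqr_rev mul1r.
have -> : down l i k (low l j (slice i k X) Y) v w =
   ((mu lam (size v).+1)^-1 * lam (r i) * lam (r k))%:C *
   low l j (slice i k X) Y (r i :: v) (r k :: w).
  by rewrite /down muC !castM castV.
rewrite normcM exprMn normc_real real_normK ?num_real // !exprMn exprVn.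
rewrite ler_wpM2l //.
by do ![rewrite sqr_ge0 | rewrite invr_ge0 | apply: mulr_ge0].
Qed.

(** In l_i^4 l_k^2 one l_i^2 is kept as the row weight of the longer word and the rest is at most
    s^2. So each annihilated letter costs s in norm, while the factors mu^-1 telescope to d_p /
    d_(p+j). *)
Lemma bsum_low_sqr p j Y :
  bsum lam p (low_sqr j Y) <= (s ^+ j * (d p / d (p + j))) ^+ 2 * nsq (p + j) Y.
Proof.
have dn k : d k != 0.
  by rewrite gt_eqF // (qdim_gt0 lam_rev eps_sqr i0_rev i0_ge1).
have mun k : mu lam k.+1 != 0.
  by rewrite gt_eqF // (mu_gt0 lam_rev eps_sqr i0_rev i0_ge1).
elim: j p => [|j IH] p.
  by rewrite addn0 expr0 mul1r divff // expr1n mul1r.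
have -> : bsum lam p (low_sqr j.+1 Y) = (mu lam p.+1) ^- 2 *
   \sum_i \sum_k lam i ^+ 4 * lam k ^+ 2 * bsum lam p (slice i k (low_sqr j Y)).
  transitivity (bsum lam p (fun v w => (mu lam p.+1) ^- 2 *
      \sum_i \sum_k lam i ^+ 4 * lam k ^+ 2 * low_sqr j Y (i :: v) (k :: w))).
    by apply: bsum_local => v w hv _; rewrite /= hv.
  rewrite bsumZ bsum_sum; congr (_ * _); apply: eq_bigr => i _.
  by rewrite bsum_sum; apply: eq_bigr => k _; rewrite bsumZ.
apply: (@le_trans _ _ ((mu lam p.+1) ^- 2 * (s ^+ 2 * bsum lam p.+1 (low_sqr j Y)))).
  rewrite ler_wpM2l ?invr_ge0 ?sqr_ge0 // bsumS mulr_sumr; apply: ler_sum => i _.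
  rewrite mulr_sumr; apply: ler_sum => k _.
  have B0 : 0 <= bsum lam p (slice i k (low_sqr j Y)).
    by apply: bsum_ge0 => v w; apply: low_sqr_ge0.
  rewrite [X in _ <= X]mulrA; apply: ler_wpM2r => //.
  have -> : lam i ^+ 4 * lam k ^+ 2 = (lam i ^+ 2 * lam k ^+ 2) * lam i ^+ 2 by ring.
  apply: ler_wpM2r; first exact: sqr_ge0.
  by rewrite [s ^+ 2]expr2; apply: ler_pM; rewrite ?sqr_ge0.
apply: (@le_trans _ _ ((mu lam p.+1) ^- 2 * (s ^+ 2 *
   ((s ^+ j * (d p.+1 / d (p.+1 + j))) ^+ 2 * nsq (p.+1 + j) Y)))).
  by rewrite ler_wpM2l ?invr_ge0 ?sqr_ge0 // ler_wpM2l ?sqr_ge0 // IH.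
rewrite addSnnS qdimS [s ^+ j.+1]exprS le_eqVlt; apply/orP; left; apply/eqP.
move: (s ^+ j) (nsq _ Y) => t n.
by field; rewrite dn mun.
Qed.

Lemma nsq_low p j X Y :
  nsq p (low l j X Y) <= (s ^+ j * (d p / d (p + j))) ^+ 2 * nsq j X * nsq (p + j) Y.
Proof.
apply: (@le_trans _ _ (nsq j X * bsum lam p (low_sqr j Y))).
  by rewrite -bsumZ; apply: bsum_le => v w _ _; apply: low_le.
rewrite [X in _ <= X]mulrAC [X in X <= _]mulrC.
by rewrite ler_wpM2r ?nsq_ge0 // bsum_low_sqr.
Qed.

Lemma bitraceless_low j X Y : bitraceless l Y -> bitraceless l (low l j X Y).
Proof.
move=> hY; elim: j X => [|j IH] X.
  exact: (bitraceless_scale (fun=> X [::] [::]) hY).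
apply: (@bitraceless_sum _ _ _ _ _ (fun i v w => \sum_k down l i k (low l j (slice i k X) Y) v w)) => i.
by apply: bitraceless_sum => k; apply: bitraceless_down.
Qed.

Lemma bitraceless_mix m j X Y : bitraceless l Y -> bitraceless l (mix l m j X Y).
Proof.
move=> hY; elim: m X => [|m IH] X; first exact: bitraceless_low.
apply: (@bitraceless_sum _ _ _ _ _ (fun i v w => \sum_k up l i k (mix l m j (slice i k X) Y) v w)) => i.
by apply: bitraceless_sum => k; apply: (bitraceless_up lr e2 m0).
Qed.

Lemma nsq_mix m p j X Y : bitraceless l Y ->
  nsq (m + p) (mix l m j X Y) <=
  (s ^+ j * (d p / d (p + j))) ^+ 2 * nsq (m + j) X * nsq (p + j) Y.
Proof.
move=> hY; elim: m X => [|m IH] X; first exact: nsq_low.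
apply: le_trans (nsq_sum_up _ (fun i k => bitraceless_mix m j (slice i k X) hY)) _.
rewrite [nsq (m.+1 + j) X]nsqS mulr_sumr mulr_suml; apply: ler_sum => i _.
rewrite mulr_sumr mulr_suml; apply: ler_sum => k _.
apply: le_trans (ler_wpM2l (sqr_ge0 _) (IH (slice i k X))) _.
by rewrite le_eqVlt; apply/orP; left; apply/eqP; ring.
Qed.

(** * Uniform bounds for the coefficients of the normal ordering *)

Lemma s_gt0 : 0 < s. Proof. exact: lt_trans ltr01 i0_gt1. Qed.

Local Notation mu_ge := (mu_ge lam_rev eps_sqr i0_rev i0_ge1).
Local Notation mu_gt0 := (mu_gt0 lam_rev eps_sqr i0_rev i0_ge1).
Local Notation qdim_gt0 := (qdim_gt0 lam_rev eps_sqr i0_rev i0_ge1).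

Lemma swap_coefC m n : swap_coef l m n = (swap_coef lam m n)%:C.
Proof. by elim: m n => [//|m IH] n; rewrite /= IH !muC -castM -castV -castM. Qed.

Lemma act_coefC k j n : act_coef l k j n = (act_coef lam k j n)%:C.
Proof.
elim: k j n => [|k IH] j n /=; first by rewrite cast_nat.
by case: j => [|j]; rewrite castD -IH // castM -IH -swap_coefC.
Qed.

Lemma swap_coef_ge0 m n : 0 <= swap_coef lam m n.
Proof.
elim: m n => [|m IH] n //=; rewrite mulr_ge0 ?IH // invr_ge0.
by case: n => [|n]; rewrite ?mul0r // mulr_ge0 ?ltW ?mu_gt0.
Qed.

Local Notation x0 := (s ^- 2).

Lemma x0_gt0 : 0 < x0. Proof. by rewrite invr_gt0 exprn_gt0 ?s_gt0. Qed.
Lemma x0_lt1 : x0 < 1.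
Proof.
have s2 : 1 < s ^+ 2 by apply: exprn_egt1.
by rewrite invf_lt1 // (lt_trans ltr01).
Qed.

(** The two factors [mu] are at least s, whence x0 = s^-2 as ratio of the Euler product. At n = 0
    the default inverse of 0 makes the middle term 0. *)
Lemma inv_mu_le n : 0 <= (mu lam n * mu lam n.+1)^-1 <= x0.
Proof.
case: n => [|n].
  by rewrite -[mu lam 0]/(0 : R) mul0r invr0 lexx ltW ?x0_gt0.
have p0 : 0 < mu lam n.+1 * mu lam n.+2 by apply: mulr_gt0; apply: mu_gt0.
have q0 : 0 < s ^+ 2 by rewrite exprn_gt0 ?s_gt0.
rewrite invr_ge0 (ltW p0) /= lef_pV2 ?posrE // [s ^+ 2]expr2.
by apply: ler_pM; rewrite ?mu_ge // ltW ?s_gt0.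
Qed.

Lemma swap_coef_le m n : swap_coef lam m n <= x0 ^+ m.
Proof.
elim: m n => [|m IH] n //=; rewrite exprS.
have /andP[h1 h2] := inv_mu_le n.
by apply: ler_pM => //; apply: swap_coef_ge0.
Qed.

(* Partial products of an Euler product, which dominate the Gaussian binomial
   coefficients counting the rearrangements of creations and annihilations. *)
Fixpoint euler (x : R) m : R :=
  if m is m'.+1 then euler x m' / (1 - x ^+ m) else 1.

Lemma expr_x0_lt1 m : x0 ^+ m.+1 < 1.
Proof. by rewrite exprn_ilt1 ?x0_lt1 // ltW ?x0_gt0. Qed.

Lemma euler_gt0 m : 0 < euler x0 m.
Proof.
by elim: m => [|m IH] //=; rewrite divr_gt0 // subr_gt0 expr_x0_lt1.
Qed.

Lemma eulerS m : euler x0 m.+1 = euler x0 m + euler x0 m.+1 * x0 ^+ m.+1.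
Proof.
have h : 1 - x0 ^+ m.+1 != 0 by rewrite gt_eqF // subr_gt0 expr_x0_lt1.
have -> : euler x0 m = euler x0 m.+1 * (1 - x0 ^+ m.+1).
  by rewrite [euler _ m.+1]/= divfK.
by rewrite mulrBr mulr1 subrK.
Qed.

Lemma euler_le_S m : euler x0 m <= euler x0 m.+1.
Proof.
rewrite [X in _ <= X]eulerS lerDl mulr_ge0 ?(ltW (euler_gt0 _)) //.
by rewrite exprn_ge0 // ltW ?x0_gt0.
Qed.

Lemma act_coef_ge0 k j n : 0 <= act_coef lam k j n.
Proof.
elim: k j n => [|k IH] j n /=; first exact: ler0n.
by case: j => [|j]; rewrite addr_ge0 ?IH // mulr_ge0 ?IH ?swap_coef_ge0.
Qed.

(** The recursion of [act_coef] is matched with [eulerS]. With m = k - j, a first letter that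
    creates is bounded by the product up to m - 1; one that annihilates passes m creations and is
    bounded by x0^m times the product up to m. *)
Lemma act_coef_le k j n : act_coef lam k j n <= euler x0 (k - j).
Proof.
elim: k j n => [|k IH] j n /=; first by case: eqP; rewrite ?lexx ?ler01.
case: j => [|j]; rewrite ?addr0.
- rewrite subn0; apply: le_trans (IH 0%N n.-1) _; rewrite subn0.
  exact: euler_le_S.
rewrite subSS; case: (ltngtP k j) => hkj.
- by rewrite !act_coef_small ?ltnS // ?(ltnW hkj) // mul0r addr0 ltW ?euler_gt0.
- have E : (k - j)%N = (k - j.+1).+1 by rewrite subnSK.
  rewrite [in X in _ <= X]E eulerS; apply: lerD; first exact: IH.
  rewrite -E; apply: ler_pM; [exact: act_coef_ge0 | exact: swap_coef_ge0 | | ].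
    exact: IH.
  exact: swap_coef_le.
- rewrite hkj act_coef_small // add0r subnn /= mulr1.
  by have := IH j n.+1; rewrite hkj subnn.
Qed.

Lemma euler_bounded : exists2 B, 0 < B & forall m, euler x0 m <= B.
Proof.
pose c := (1 - x0)^-1.
have x1 : 0 < 1 - x0 by rewrite subr_gt0 x0_lt1.
have c0 : 0 < c by rewrite invr_gt0.
have step m : (1 - x0 ^+ m.+1)^-1 <= expR (c * x0 ^+ m.+1).
  apply: le_trans (expR_ge1Dx _).
  have xm : 0 < 1 - x0 ^+ m.+1 by rewrite subr_gt0 expr_x0_lt1.
  have xm0 : 0 <= x0 ^+ m.+1 by rewrite exprn_ge0 // ltW ?x0_gt0.
  rewrite -[X in X <= _]mul1r ler_pdivrMr // mulrDl mul1r.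
  have h : 1 <= c * (1 - x0 ^+ m.+1).
    rewrite mulrC ler_pdivlMr // mul1r lerD2l lerN2.
    rewrite exprS ger_pMr ?x0_gt0 //.
    by rewrite exprn_ile1 // ltW ?x0_gt0 ?x0_lt1.
  rewrite mulrAC; have := ler_wpM2r xm0 h; rewrite mul1r; lra.
(* The empty sum is 0, so the bound is exp(c^2): each factor 1/(1 - x0^m) is at most exp(c x0^m),
   and the geometric sum of the exponents is at most c. *)
exists (expR (c * (\sum_(i < 0) x0 ^+ i + c))); first exact: expR_gt0.
move=> m; rewrite big_ord0 add0r.
suff: euler x0 m <= expR (c * (\sum_(i < m) x0 ^+ i.+1)).
  move/le_trans; apply; rewrite ler_expR ler_pM2l //.
  have -> : \sum_(i < m) x0 ^+ i.+1 = x0 * \sum_(i < m) x0 ^+ i.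
    by rewrite mulr_sumr; apply: eq_bigr => i _; rewrite exprS.
  have e : (1 - x0) * (\sum_(i < m) x0 ^+ i) = 1 - x0 ^+ m.
    rewrite -[X in _ = X - _](expr1n _ m) subrXX; congr (_ * _).
    by apply: eq_bigr => i _; rewrite expr1n mul1r.
  have S0 : 0 <= \sum_(i < m) x0 ^+ i.
    by apply: sumr_ge0 => i _; rewrite exprn_ge0 // ltW ?x0_gt0.
  apply: (@le_trans _ _ (\sum_(i < m) x0 ^+ i)).
    by rewrite -[X in _ <= X]mul1r; apply: ler_wpM2r => //; rewrite ltW ?x0_lt1.
  rewrite -[c]mul1r ler_pdivlMr // mulrC e lerBlDr lerDl.
  by rewrite exprn_ge0 // ltW ?x0_gt0.
elim: m => [|m IH]; first by rewrite big_ord0 mulr0 expR0.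
rewrite big_ord_recr /= mulrDr expRD ler_pM ?(ltW (euler_gt0 _)) //.
by rewrite invr_ge0 ltW // subr_gt0 expr_x0_lt1.
Qed.

(** * Almost multiplicativity of the quantum dimension *)

Lemma qdim_rec k : d k.+2 = (\sum_(i < N) lam i ^+ 2) * d k.+1 - d k.
Proof.
rewrite qdimS muS mulrBl; congr (_ - _).
by rewrite qdimS mulrA mulVf ?mul1r // gt_eqF ?mu_gt0.
Qed.

Lemma qdim_mul a b : d a.+1 * d b.+1 = d (a + b).+2 + d a * d b.
Proof.
have d1 : d 1 = \sum_(i < N) lam i ^+ 2.
  by rewrite qdimS muS /= invr0 subr0 mulr1.
(* The recursion for d has order two, so the induction carries two consecutive values of b. *)
suff: d a.+1 * d b.+1 = d (a + b).+2 + d a * d b /\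
      d a.+1 * d b.+2 = d (a + b).+3 + d a * d b.+1 by case.
elim: b => [|b [IH1 IH2]].
  have d0 : d 0 = 1 by [].
  rewrite addn0 (qdim_rec 0) (qdim_rec a.+1) (qdim_rec a) d1 d0.
  by move: (d a) (d a.+1) (\sum_(i < N) _) => p q D; split; ring.
split; first by rewrite addnS.
have E : d a.+1 * d b.+3 =
    (\sum_(i < N) lam i ^+ 2) * (d a.+1 * d b.+2) - d a.+1 * d b.+1.
  by rewrite (qdim_rec b.+1); ring.
by rewrite E IH2 IH1 addnS (qdim_rec (a + b).+2) (qdim_rec b); ring.
Qed.

Lemma qdimD_le a b : d (a + b) <= d a * d b.
Proof.
case: a => [|a]; first by rewrite add0n mul1r.
case: b => [|b]; first by rewrite addn0 mulr1.
by rewrite qdim_mul addSn addnS lerDl mulr_ge0 ?ltW ?qdim_gt0.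
Qed.

Definition qdim_ratio : R := (1 - x0)^-1.

Lemma qdim_ratio_ge1 : 1 <= qdim_ratio.
Proof.
by rewrite invf_ge1 ?subr_gt0 ?x0_lt1 // lerBlDr lerDl ltW ?x0_gt0.
Qed.

(** Since d_(k+1) >= s d_k, the remainder d_a d_b in [qdim_mul] is at most s^-2 d_(a+1) d_(b+1).
    Solving for the product gives 1/(1 - x0). *)
Lemma qdim_mul_le a b : d a * d b <= qdim_ratio * d (a + b).
Proof.
have x1 : 0 < 1 - x0 by rewrite subr_gt0 x0_lt1.
case: a => [|a].
  by rewrite add0n mul1r ler_pMl ?qdim_gt0 ?qdim_ratio_ge1.
case: b => [|b].
  by rewrite addn0 mulr1 ler_pMl ?qdim_gt0 ?qdim_ratio_ge1.
rewrite [X in _ <= X]mulrC /qdim_ratio ler_pdivlMr // mulrBr mulr1.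
rewrite {1}qdim_mul addSn addnS -addrA gerDl subr_le0.
have h k : d k * s <= d k.+1.
  by rewrite qdimS mulrC ler_pM2r ?qdim_gt0 ?mu_ge.
rewrite ler_pdivlMr; last by rewrite exprn_gt0 ?s_gt0.
have -> : d a * d b * s ^+ 2 = (d a * s) * (d b * s) by ring.
have h0 k : 0 <= d k * s by rewrite mulr_ge0 ?ltW ?qdim_gt0 ?s_gt0.
by apply: ler_pM.
Qed.

(** Split d_(m+j) into d_m d_j and regroup with the two factors d_p. The constant is independent of
    m, p and j, which keeps the term with j annihilations at size s^j. *)
Lemma qdim_bracket m p j :
  d (m + j) * d p ^+ 2 <= qdim_ratio ^+ 2 * (d (p + j) * d (m + p)).
Proof.
have d0 k := ltW (qdim_gt0 k).
apply: (@le_trans _ _ ((d p * d j) * (d m * d p))).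
  have -> : d p * d j * (d m * d p) = d m * d j * d p ^+ 2 by ring.
  by rewrite ler_wpM2r ?sqr_ge0 ?qdimD_le.
have -> : qdim_ratio ^+ 2 * (d (p + j) * d (m + p)) =
  (qdim_ratio * d (p + j)) * (qdim_ratio * d (m + p)) by ring.
by apply: ler_pM; rewrite ?qdim_mul_le ?mulr_ge0.
Qed.

Lemma mix_term_le m p j X Y : bitraceless l Y ->
  (d (m + p))^-1 * nsq (m + p) (mix l m j X Y) <=
  (qdim_ratio * s ^+ j) ^+ 2 * (nsq (m + j) X / d (m + j)) *
  ((d (p + j))^-1 * nsq (p + j) Y).
Proof.
move=> hY; have d0 k := qdim_gt0 k; have dn k := lt0r_neq0 (qdim_gt0 k).
apply: le_trans (ler_wpM2l _ (nsq_mix m p j X hY)) _.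
  by rewrite invr_ge0 ltW.
have -> : (d (m + p))^-1 * ((s ^+ j * (d p / d (p + j))) ^+ 2 * nsq (m + j) X * nsq (p + j) Y)
  = (d (m + j) * d p ^+ 2 / (d (p + j) * d (m + p))) *
   (s ^+ j ^+ 2 * (nsq (m + j) X / d (m + j)) * ((d (p + j))^-1 * nsq (p + j) Y)).
  move: (s ^+ j) (nsq (m + j) X) (nsq (p + j) Y) => a b c.
  by field; rewrite !dn.
have -> : (qdim_ratio * s ^+ j) ^+ 2 * (nsq (m + j) X / d (m + j)) *
  ((d (p + j))^-1 * nsq (p + j) Y) = qdim_ratio ^+ 2 *
   (s ^+ j ^+ 2 * (nsq (m + j) X / d (m + j)) * ((d (p + j))^-1 * nsq (p + j) Y)).
  by move: (s ^+ j) => a; ring.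
apply: ler_wpM2r.
  by do ![rewrite sqr_ge0 | rewrite nsq_ge0 | rewrite invr_ge0 ltW // | apply: mulr_ge0].
by rewrite ler_pdivrMr ?mulr_gt0 // qdim_bracket.
Qed.

Lemma degree_lt_mix n m j X Y : degree_lt n Y -> degree_lt (n + m) (mix l m j X Y).
Proof.
move=> dY; elim: m X => [|m IH] X.
  rewrite addn0; elim: j X => [|j IH] X v w hv; first by rewrite /= dY ?mulr0.
  rewrite [LHS]lowS big1 // => i _; rewrite big1 // => k _.
  exact: (degree_lt_down l _ _ (IH (slice i k X))).
move=> v w hv; rewrite mixS big1 // => i _; rewrite big1 // => k _.
by apply: (degree_lt_up l _ _ (IH (slice i k X))); rewrite -addnS.
Qed.

Local Notation fock := (fock lam).
Local Notation fact := (fact lam_rev eps_sqr i0_rev i0_ge1).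
Local Notation fspace := (fock_space lam_rev eps_sqr i0_rev i0_ge1).

Definition mix_part k j X Y v w : C :=
  act_coef l k j (size v) * mix l (k - j) j X Y v w.

Lemma mix_part_subproof k j X (y : fock) : fock_pred lam (mix_part k j X y).
Proof.
apply/asboolP; split.
  by apply: bitraceless_scale; apply: bitraceless_mix; apply: fock_bitraceless.
exists (degree y + (k - j))%N => v w hv; rewrite /mix_part.
by rewrite (degree_lt_mix _ _ (@degreeP _ _ _ y)) ?mulr0.
Qed.

Definition fmix k j X (y : fock) : fock := Fock (mix_part_subproof k j X y).

Lemma fact_fmix k X (y : fock) : row_traceless l X -> col_traceless l X ->
  fact k X y = \sum_(j < k.+1) fmix k j X y.
Proof.
move=> rX cX; apply: fock_ext => v w; rewrite fock_sumE.
have [hvw|hvw] := eqVneq (size v) (size w).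
  have [by_ _ _] := fock_bitraceless y.
  exact: (act_expand lr e2 k rX cX by_ hvw).
have [-> //] := fock_bitraceless (fact k X y).
by rewrite big1 // => j _; have [-> //] := fock_bitraceless (fmix k j X y).
Qed.

Lemma phnorm_sqr n (y : fock) : degree_lt n y ->
  phnorm (y : fspace) ^+ 2 = normsq lam n y.
Proof.
by move=> dy; apply: complexI; rewrite -(@ip_self _ fspace) -(fip_self dy).
Qed.

Lemma normsq_fmix B n k j X (y : fock) : (forall m, euler x0 m <= B) ->
  (j <= k)%N ->
  normsq lam n (fmix k j X y) <=
  (B * qdim_ratio * s ^+ j) ^+ 2 * (nsq k X / d k) * normsq lam (j + n) y.
Proof.
move=> hB hjk; set m := (k - j)%N; have hk : (m + j)%N = k by rewrite subnK.
have B0 : 0 < B by apply: lt_le_trans (hB 0%N).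
have term q : 0 <= (d q)^-1 * nsq q (fmix k j X y).
  by rewrite mulr_ge0 ?nsq_ge0 // invr_ge0 ltW ?qdim_gt0.
have termy q : 0 <= (d q)^-1 * nsq q y.
  by rewrite mulr_ge0 ?nsq_ge0 // invr_ge0 ltW ?qdim_gt0.
have c0 : 0 <= (B * qdim_ratio * s ^+ j) ^+ 2 * (nsq k X / d k).
  by rewrite mulr_ge0 ?sqr_ge0 // mulr_ge0 ?nsq_ge0 // invr_ge0 ltW ?qdim_gt0.
apply: (@le_trans _ _ (\sum_(q < m + n) (d q)^-1 * nsq q (fmix k j X y))).
  rewrite /normsq -(big_mkord xpredT (fun q => (d q)^-1 * nsq q (fmix k j X y))).
  rewrite -(big_mkord xpredT (fun q => (d q)^-1 * nsq q (fmix k j X y))).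
  by rewrite [X in _ <= X](big_cat_nat (leq0n n)) ?leq_addl //= lerDl sumr_ge0.
(* The m created letters force output length at least m, and output degree m + p comes from degree j
   + p of y. *)
rewrite big_split_ord /= big1 ?add0r => [|q _]; last first.
  rewrite /nsq bsum_zero ?mulr0 // => v w hv _.
  by rewrite /= /mix_part mix_short ?hv // mulr0 normc0 expr0n.
apply: (@le_trans _ _ (\sum_(p < n) (B * qdim_ratio * s ^+ j) ^+ 2 * (nsq k X / d k) *
    ((d (j + p))^-1 * nsq (j + p) y))).
  apply: ler_sum => p _.
  apply: (@le_trans _ _ (B ^+ 2 * ((d (m + p))^-1 * nsq (m + p) (mix l m j X y)))).
    rewrite mulrCA ler_wpM2l ?invr_ge0 ?(ltW (qdim_gt0 _)) //.
    rewrite -bsumZ; apply: bsum_le => v w _ _.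
    rewrite /= /mix_part normcM exprMn ler_wpM2r ?sqr_ge0 //.
    rewrite act_coefC normc_real ger0_norm ?act_coef_ge0 //.
    rewrite ler_pXn2r ?nnegrE ?act_coef_ge0 ?(ltW B0) //.
    exact: le_trans (act_coef_le _ _ _) (hB _).
  have := ler_wpM2l (sqr_ge0 B) (mix_term_le m p j X (fock_bitraceless y)).
  rewrite hk [(j + p)%N]addnC => /le_trans; apply.
  rewrite le_eqVlt; apply/orP; left; apply/eqP.
  by move: (s ^+ j) => a; ring.
rewrite -mulr_sumr; apply: ler_wpM2l => //.
rewrite /normsq big_split_ord /= lerDr sumr_ge0 // => q _.
Qed.

(** The terms of the normal ordering are bounded by multiples of s^j, and s > 1 makes their sum at
    most s/(s - 1) times the last one, s^k. *)
Lemma fact_bounded : exists2 K, 0 < K & forall k X (y : fock),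
  row_traceless l X -> col_traceless l X ->
  phnorm (fact k X y : fspace) <=
    K * s ^+ k * Num.sqrt (nsq k X / d k) * phnorm (y : fspace).
Proof.
have [B B0 hB] := euler_bounded.
have q0 : 0 < qdim_ratio by apply: lt_le_trans qdim_ratio_ge1.
have s1 : 0 < s - 1 by rewrite subr_gt0.
exists (B * qdim_ratio * (s / (s - 1))).
  by apply: mulr_gt0; [apply: mulr_gt0 | apply: divr_gt0 => //; apply: s_gt0].
move=> k X y rX cX; set t := Num.sqrt _; set Y := phnorm (y : fspace).
have Y0 : 0 <= Y by apply: phnorm_ge0.
have t0 : 0 <= t by apply: sqrtr_ge0.
have part (j : 'I_k.+1) : phnorm (fmix k j X y : fspace) <= B * qdim_ratio * s ^+ j * (t * Y).
  have sj : 0 < s ^+ j by rewrite exprn_gt0 ?s_gt0.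
  rewrite -(@ler_pXn2r _ 2) ?nnegrE ?phnorm_ge0 ?mulr_ge0 ?(ltW B0) ?(ltW q0) ?(ltW sj) //.
  rewrite (phnorm_sqr (@degreeP _ _ _ (fmix k j X y))).
  apply: le_trans (normsq_fmix _ X y hB (ltn_ord j : j <= k)%N) _.
  set M := degree _.
  have dM : degree_lt (j + (M + degree y)) y.
    by apply: degree_lt_mono (@degreeP _ _ _ y); rewrite addnA leq_addl.
  rewrite [X in _ <= X]exprMn [(t * Y) ^+ 2]exprMn /t sqr_sqrtr; last first.
    by rewrite mulr_ge0 ?nsq_ge0 // invr_ge0 ltW ?qdim_gt0.
  rewrite (phnorm_sqr dM) [X in _ <= X]mulrA; apply: ler_wpM2l.
    by rewrite mulr_ge0 ?sqr_ge0 // mulr_ge0 ?nsq_ge0 // invr_ge0 ltW ?qdim_gt0.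
  rewrite addnA /normsq [X in _ <= X]big_split_ord /= lerDl sumr_ge0 // => q _.
  by rewrite mulr_ge0 ?nsq_ge0 // invr_ge0 ltW ?qdim_gt0.
have tri (I : Type) (tt : seq I) (f : I -> fspace) :
    phnorm (\sum_(i <- tt) f i) <= \sum_(i <- tt) phnorm (f i).
  elim: tt => [|i tt IH]; first by rewrite !big_nil phnorm0.
  by rewrite !big_cons; apply: le_trans (phnormD _ _) _; rewrite lerD2l.
rewrite fact_fmix //; apply: le_trans (tri _ _ _) _.
apply: le_trans (ler_sum _ (fun j _ => part j)) _.
rewrite -mulr_suml -mulr_sumr.
have geo : (\sum_(j < k.+1) s ^+ j) * (s - 1) = s ^+ k.+1 - 1.
  rewrite mulrC -[X in _ = _ - X](expr1n _ k.+1) subrXX; congr (_ * _).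
  rewrite (reindex_inj rev_ord_inj) /=; apply: eq_bigr => j _.
  by rewrite expr1n mulr1 subSS.
have geo_le : \sum_(j < k.+1) s ^+ j <= s / (s - 1) * s ^+ k.
  by rewrite mulrAC ler_pdivlMr // geo exprS lerBlDr lerDl ler01.
have -> : B * qdim_ratio * (s / (s - 1)) * s ^+ k * t * Y =
  B * qdim_ratio * (s / (s - 1) * s ^+ k) * (t * Y).
  by move: (s ^+ k) (s / (s - 1)) => a b; ring.
by rewrite ler_wpM2r ?mulr_ge0 // ler_wpM2l // mulr_ge0 ?(ltW B0) ?(ltW q0).
Qed.

End Estimates.

(** * Homogeneous polynomials *)

Section HomogeneousPolynomials.
Variables (R : realType) (N : nat) (lam : 'I_N -> R) (i0 : 'I_N).
Local Notation C := R[i].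
Local Notation r := (@rev_ord N).
Local Notation word := (seq 'I_N).
Local Notation l := (lamC lam).
Variable F : 'M[C]_N.
Hypothesis F_entry : forall i j, F i j = (lam i)%:C * (j == r i)%:R.
Variables (A : cstarType R) (u : 'M[A]_N).

Definition index_word k (v : multi_index N k) : word := [seq v j | j <- enum 'I_k].

Definition index_cons k i (v : multi_index N k) : multi_index N k.+1 :=
  [ffun j => if unlift ord0 j is Some j' then v j' else i].

Lemma index_word_cons k i (v : multi_index N k) :
  index_word (index_cons i v) = i :: index_word v.
Proof.
rewrite /index_word enum_ordSl /= ffunE unlift_none -map_comp; congr (_ :: _).
by apply: eq_map => j; rewrite /= ffunE liftK.
Qed.

Lemma u_tensor_cons k i j (v w : multi_index N k) :
  u_tensor u (index_cons i v) (index_cons j w) = u i j * u_tensor u v w.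
Proof.
rewrite /u_tensor big_ord_recl !ffunE !unlift_none; congr (_ * _).
by apply: eq_bigr => m _; rewrite !ffunE !liftK.
Qed.

Lemma sum_index0 (V : nmodType) (f : multi_index N 0 -> V) v : \sum_w f w = f v.
Proof.
by rewrite (big_pred1 v) // => w; apply/esym/eqP/ffunP => -[].
Qed.

Lemma sum_indexS (V : nmodType) k (f : multi_index N k.+1 -> V) :
  \sum_v f v = \sum_i \sum_v f (index_cons i v).
Proof.
rewrite pair_bigA /= (reindex (fun p : 'I_N * multi_index N k => index_cons p.1 p.2)) //.
exists (fun v : multi_index N k.+1 => (v ord0, [ffun j => v (lift ord0 j)])).
- move=> [i v] _ /=; rewrite ffunE unlift_none; congr (_, _).
  by apply/ffunP => j; rewrite !ffunE liftK.
- move=> v _; apply/ffunP => j; rewrite ffunE.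
  by case: unliftP => [j' ->|->] //=; rewrite ffunE.
Qed.

Lemma coef_index k (X : word -> word -> C) : coef u k X =
  \sum_(v : multi_index N k) \sum_w X (index_word v) (index_word w) *: u_tensor u v w.
Proof.
elim: k X => [|k IH] X.
  pose v0 : multi_index N 0 := [ffun=> i0].
  have e0 : index_word v0 = [::].
    by apply: size0nil; rewrite size_map size_enum_ord.
  by rewrite (sum_index0 _ v0) (sum_index0 _ v0) e0 /u_tensor big_ord0.
rewrite coefS sum_indexS; apply: eq_bigr => i _.
under [RHS]eq_bigr do rewrite sum_indexS.
rewrite exchange_big; apply: eq_bigr => j _; rewrite IH mulr_sumr.
apply: eq_bigr => v _; rewrite mulr_sumr; apply: eq_bigr => w _.
by rewrite !index_word_cons u_tensor_cons scalerAr.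
Qed.

Definition word_index k (v : word) : multi_index N k := [ffun j : 'I_k => nth i0 v j].

(** Extension by zero to words of other lengths puts all degrees in one space of functions. *)
Definition tensor_fun k (xi : tensor R N k) (v : word) : C :=
  if size v == k then xi (word_index k v) else 0.

Lemma index_wordK k (v : multi_index N k) : word_index k (index_word v) = v.
Proof.
by apply/ffunP => j; rewrite ffunE (nth_map j) ?size_enum_ord // nth_ord_enum.
Qed.

Lemma tensor_fun_index k (xi : tensor R N k) v : tensor_fun xi (index_word v) = xi v.
Proof. by rewrite /tensor_fun size_map size_enum_ord eqxx index_wordK. Qed.

Lemma coef_ukE k (eta xi : tensor R N k) : coef_uk u eta xi =
  coef u k (fun v w => (tensor_fun eta v)^* * tensor_fun xi w).
Proof.
rewrite coef_index; apply: eq_bigr => v _; apply: eq_bigr => w _.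
by rewrite !tensor_fun_index.
Qed.

Lemma Tvec_entry a b : Tvec F a b = l b * (a == r b)%:R.
Proof.
rewrite /Tvec (bigD1 a) //= eqxx mul1r big1 ?addr0 => [|j]; last first.
  by rewrite eq_sym => /negPf ->; rewrite mul0r.
rewrite mxE (bigD1 a) //= big1 ?addr0 => [|j /negPf hj]; last first.
  by rewrite mxE hj mulr0.
by rewrite mxE !eqxx mulr1 F_entry.
Qed.

Lemma traceless_tensor k (xi : tensor R N k) : Hk F xi -> traceless l (tensor_fun xi).
Proof.
move=> hxi p w.
have [hk|hk] := eqVneq (size p + (size w).+2)%N k; last first.
  rewrite big1 // => i _; rewrite /tensor_fun size_cat /= (negPf hk).
  by rewrite mulr0.
have ltp : (size p < k)%N by lia.
have ltp1 : ((size p).+1 < k)%N by lia.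
(* The two letters [i0] are placeholders, overwritten by [subst2]. *)
have := hxi (word_index k (p ++ i0 :: i0 :: w)) (Ordinal ltp) (Ordinal ltp1) erefl.
have E a b : subst2 (word_index k (p ++ i0 :: i0 :: w)) (Ordinal ltp) (Ordinal ltp1) a b =
    word_index k (p ++ a :: b :: w).
  apply/ffunP => j; rewrite !ffunE -!val_eqE /= !nth_cat.
  case: (ltngtP j (size p)) => [h|h|->]; rewrite ?subnn //.
    by have /negPf -> : nat_of_ord j != (size p).+1 by lia.
  have [->|h1] := eqVneq (nat_of_ord j) (size p).+1; first by rewrite subSnn.
  by have -> : (j - size p = (j - (size p).+2).+2)%N by lia.
move=> H; rewrite -[RHS]H; apply: eq_bigr => a _; rewrite (bigD1 (r a)) //= big1 ?addr0 => [|b hb].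
  rewrite E Tvec_entry rev_ordK eqxx mulr1 /lamC conj_realC /tensor_fun size_cat /=.
  by rewrite hk eqxx.
rewrite Tvec_entry; have /negPf -> : a != r b.
  by apply: contra hb => /eqP ->; rewrite rev_ordK.
by rewrite mulr0 rmorph0 mul0r.
Qed.

Lemma PolkP k f : Polk F u k f -> exists X,
  [/\ bitraceless l X, forall v w, size v != k -> X v w = 0 & f = coef u k X].
Proof.
move=> [n [c [eta [xi [hs ->]]]]].
exists (fun v w => \sum_(s < n) c s * ((tensor_fun (eta s) v)^* * tensor_fun (xi s) w)).
split.
- split.
  + move=> v w hvw; rewrite big1 // => s _; rewrite /tensor_fun.
    have [hv|_] := eqVneq (size v) k; last by rewrite rmorph0 mul0r mulr0.
    by move: hvw; rewrite hv eq_sym => /negPf ->; rewrite !mulr0.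
  + move=> w p q /=; under eq_bigr do rewrite mulr_sumr.
    rewrite exchange_big big1 // => s _ /=.
    transitivity (c s * tensor_fun (xi s) w *
      (\sum_i l (r i) * tensor_fun (eta s) (p ++ i :: r i :: q))^*).
      rewrite rmorph_sum mulr_sumr; apply: eq_bigr => i _.
      by rewrite rmorphM /= [X in _ = _ * (X * _)]conj_realC; ring.
    by rewrite (traceless_tensor (proj1 (hs s))) rmorph0 mulr0.
  + move=> w p q /=; under eq_bigr do rewrite mulr_sumr.
    rewrite exchange_big big1 // => s _ /=.
    transitivity (c s * (tensor_fun (eta s) w)^* *
      (\sum_i l (r i) * tensor_fun (xi s) (p ++ i :: r i :: q))).
      by rewrite mulr_sumr; apply: eq_bigr => i _; ring.
    by rewrite (traceless_tensor (proj2 (hs s))) mulr0.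
- move=> v w /negPf hv; rewrite big1 // => s _.
  by rewrite /tensor_fun hv rmorph0 mul0r mulr0.
- rewrite coef_sum; apply: eq_bigr => s _.
  by rewrite coefZ coef_ukE.
Qed.

Definition const_tensor k a : tensor R N k := [ffun v => (v == [ffun=> a])%:R].

(** T has no coordinate on e_a \otimes e_a when r a differs from a, so every power of e_a is
    traceless. *)
Lemma const_tensor_Hk k a : r a != a -> Hk F (const_tensor k a).
Proof.
move=> ha w i j hij; rewrite big1 // => b _; rewrite big1 // => c _.
rewrite Tvec_entry ffunE; have [e|] := eqVneq (subst2 _ _ _ _ _) _; last by rewrite mulr0.
have eb : b = a.
  by have := congr1 (fun v : multi_index N k => v i) e; rewrite !ffunE eqxx.
have ec : c = a.
  have := congr1 (fun v : multi_index N k => v j) e; rewrite !ffunE eqxx.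
  by have /negPf -> : j != i by rewrite -val_eqE /= hij; lia.
by rewrite eb ec eq_sym (negPf ha) mulr0 rmorph0 mul0r.
Qed.

Lemma const_tensor_coef k a :
  coef_uk u (const_tensor k a) (const_tensor k a) = u a a ^+ k.
Proof.
rewrite /coef_uk (bigD1 [ffun=> a]) //= [X in _ + X]big1 ?addr0; last first.
  move=> v /negPf hv; rewrite big1 // => w _.
  by rewrite ffunE hv rmorph0 mul0r scale0r.
rewrite (bigD1 [ffun=> a]) //= [X in _ + X]big1 ?addr0; last first.
  by move=> w /negPf hw; rewrite [const_tensor k a w]ffunE hw mulr0 scale0r.
rewrite !ffunE eqxx rmorph1 mul1r scale1r /u_tensor.
under eq_bigr do rewrite !ffunE.
by rewrite prodr_const card_ord.
Qed.

Lemma Polk_power k a : r a != a -> Polk F u k (u a a ^+ k).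
Proof.
move=> ha; exists 1%N, (fun=> 1), (fun=> const_tensor k a), (fun=> const_tensor k a).
split; first by split; apply: const_tensor_Hk.
by rewrite big_ord_recl big_ord0 addr0 scale1r const_tensor_coef.
Qed.

End HomogeneousPolynomials.

(** * Norms of left multiplications, and powers of a diagonal generator *)

Section OperatorNorms.
Variables (R : realType) (N : nat) (lam : 'I_N -> R) (eps : R).
Hypothesis lam_rev : forall i, lam i * lam (rev_ord i) = eps.
Hypothesis eps_sqr : eps * eps = 1.
Variable i0 : 'I_N.
Hypothesis i0_rev : rev_ord i0 != i0.
Hypothesis i0_gt1 : 1 < lam i0 ^+ 2.
Hypothesis i0_max : forall i, lam i ^+ 2 <= lam i0 ^+ 2.
Local Notation C := R[i].
Local Notation r := (@rev_ord N).
Local Notation word := (seq 'I_N).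
Local Notation l := (lamC lam).
Local Notation s := (lam i0 ^+ 2).
Local Notation i0_ge1 := (ltW i0_gt1).
Variable F : 'M[C]_N.
Hypothesis F_entry : forall i j, F i j = (lam i)%:C * (j == r i)%:R.
Variables (A : cstarType R) (u : 'M[A]_N).
Hypothesis A_COF : is_COF F u.
Variables (Delta : A -> seq (A * A)) (h : {scalar A}).
Hypothesis A_coproduct : is_coproduct u Delta.
Hypothesis A_Haar : is_Haar_state u Delta h.
Local Notation fock := (fock lam).
Local Notation nsq := (@nsq R N lam).
Local Notation d := (qdim lam).
Local Notation coef := (@coef C N A u).
Local Notation qdim_gt0 := (qdim_gt0 lam_rev eps_sqr i0_rev i0_ge1).

Lemma L2norm_coef k X : bitraceless l X -> (forall v w, size v != k -> X v w = 0) ->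
  L2norm h (coef k X) = Num.sqrt (nsq k X / d k).
Proof.
move=> hX sX.
have fX : fock_pred lam X.
  apply/asboolP; split=> //; exists k.+1 => v w hv; apply: sX.
  by rewrite neq_ltn hv orbT.
pose x : fock := Fock fX.
have dx : degree_lt k.+1 x by move=> v w hv; apply: sX; rewrite neq_ltn hv orbT.
have -> : coef k X = emb u x.
  rewrite (embE u dx) /embed big_ord_recr /=.
  rewrite big1 ?add0r // => j _; apply: coef_zero => v w hv _; apply: sX.
  by rewrite hv neq_ltn ltn_ord.
rewrite (L2norm_emb lam_rev eps_sqr i0_rev i0_ge1 F_entry A_COF A_coproduct A_Haar dx).
rewrite /normsq big_ord_recr /= big1 ?add0r 1?mulrC // => j _.
rewrite [nsq _ _](_ : _ = 0) ?mulr0 //.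
rewrite /nsq (@bsum_local _ _ _ _ _ (fun _ _ => 0)).
  elim: (nat_of_ord j) => [|q IH]; first by rewrite bsum0.
  by rewrite bsumS big1 // => a _; rewrite big1 // => b _; rewrite IH mulr0.
by move=> v w hv _; rewrite /x /= sX ?hv ?neq_ltn ?ltn_ord // normc0 expr0n.
Qed.

Lemma left_mul_bounded : exists2 K, 0 < K & forall k f, Polk F u k f ->
  [/\ Pol u f, 0 <= K * s ^+ k * L2norm h f
    & forall a, Pol u a -> L2norm h (f * a) <= K * s ^+ k * L2norm h f * L2norm h a].
Proof.
have [K K0 hK] := fact_bounded lam_rev eps_sqr i0_rev i0_gt1 i0_max.
exists K => // k f /(PolkP i0 F_entry)[X [hX sX ->]].
have [_ rX cX] := hX.
split; first exact: Pol_coef.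
  apply: mulr_ge0; last exact: sqrtr_ge0.
  apply: mulr_ge0; first exact: ltW.
  by apply: exprn_ge0; apply: sqr_ge0.
move=> _ /(Pol_embP lam_rev eps_sqr i0_rev i0_ge1 F_entry A_COF)[y ->].
rewrite -(emb_fact lam_rev eps_sqr i0_rev i0_ge1 F_entry A_COF).
rewrite !(L2norm_phnorm lam_rev eps_sqr i0_rev i0_ge1 F_entry A_COF A_coproduct A_Haar).
by rewrite L2norm_coef //; apply: hK.
Qed.

Definition power_word (a : 'I_N) k (v w : word) : C :=
  (v == nseq k a)%:R * (w == nseq k a)%:R.

Lemma bitraceless_power a k : r a != a -> bitraceless l (power_word a k).
Proof.
move=> ha.
have tr : traceless l (fun v => (v == nseq k a)%:R).
  move=> p w; rewrite big1 // => i _.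
  have [e|] := eqVneq (p ++ i :: r i :: w) (nseq k a); last by rewrite mulr0.
  have mem b : b \in i :: r i :: w -> b = a.
    move=> hb; have : b \in nseq k a by rewrite -e mem_cat hb orbT.
    by rewrite mem_nseq => /andP[_ /eqP].
  have e1 := mem i (mem_head _ _).
  by have := mem (r i); rewrite !inE eqxx orbT e1 => /(_ isT) e2; rewrite e2 eqxx in ha.
split.
- move=> v w hvw; rewrite /power_word.
  have [hv|_] := eqVneq v (nseq k a); last by rewrite mul0r.
  have [hw|_] := eqVneq w (nseq k a); last by rewrite mulr0.
  by rewrite hv hw eqxx in hvw.
- move=> w p q; under eq_bigr do rewrite /power_word mulrA.
  by rewrite -mulr_suml tr mul0r.
- move=> v p q; under eq_bigr do rewrite /power_word mulrCA.
  by rewrite -mulr_sumr tr mulr0.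
Qed.

Lemma slice_power a k i j v w :
  slice i j (power_word a k.+1) v w = (i == a)%:R * (j == a)%:R * power_word a k v w.
Proof.
rewrite /slice /power_word /= !eqseq_cons -!mulnb !natrM; ring.
Qed.

Lemma coef_power a k : coef k (power_word a k) = u a a ^+ k.
Proof.
elim: k => [|k IH]; first by rewrite -[LHS]/((1 * 1) *: 1) mulr1 scale1r.
rewrite coefS (bigD1 a) //= (bigD1 a) //= [X in _ + X + _]big1 ?addr0; last first.
  move=> j /negPf hj; rewrite coef_zero ?mulr0 // => v w _ _.
  by rewrite slice_power hj mulr0 mul0r.
rewrite [X in _ + X]big1 ?addr0; last first.
  move=> i /negPf hi; rewrite big1 // => j _; rewrite coef_zero ?mulr0 // => v w _ _.
  by rewrite slice_power hi !mul0r.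
rewrite exprS -IH; congr (_ * _); apply: coef_local => v w _ _.
by rewrite slice_power eqxx !mul1r.
Qed.

Lemma nsq_power a k : nsq k (power_word a k) = lam a ^+ 2 ^+ k.
Proof.
elim: k => [|k IH]; first by rewrite /nsq bsum0 /power_word !eqxx mul1r normc1 expr1n.
have E i j : bsum lam k (slice i j (fun v w => normc (power_word a k.+1 v w) ^+ 2)) =
    (i == a)%:R * (j == a)%:R * nsq k (power_word a k).
  rewrite /nsq -bsumZ; apply: bsum_local => v w _ _.
  rewrite -[slice _ _ _ _ _]/(normc (slice i j (power_word a k.+1) v w) ^+ 2).
  rewrite slice_power; case: (i == a); case: (j == a); rewrite ?(mul1r, mul0r) //;
    by rewrite normc0 expr0n.
rewrite /nsq bsumS.
transitivity (\sum_i \sum_j (a == i)%:R * ((a == j)%:R * (lam i ^+ 2 * lam a ^+ 2 ^+ k))).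
  apply: eq_bigr => i _; apply: eq_bigr => j _; rewrite E IH.
  by rewrite eq_sym [j == a]eq_sym; ring.
transitivity (\sum_i (a == i)%:R * (lam i ^+ 2 * lam a ^+ 2 ^+ k)).
  apply: eq_bigr => i _; rewrite -mulr_sumr.
  by rewrite (sum_delta (fun=> lam i ^+ 2 * lam a ^+ 2 ^+ k)).
by rewrite (sum_delta (fun i => lam i ^+ 2 * lam a ^+ 2 ^+ k)) -exprS.
Qed.

Lemma L2norm_power a k : r a != a ->
  L2norm h (u a a ^+ k) = Num.sqrt (lam a ^+ 2 ^+ k / d k).
Proof.
move=> ha; rewrite -coef_power L2norm_coef ?nsq_power //.
  exact: bitraceless_power.
move=> v w hv; rewrite /power_word; have [e|_] := eqVneq v (nseq k a).
  by rewrite e size_nseq eqxx in hv.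
by rewrite mul0r.
Qed.

Lemma star_power a k : star (u a a ^+ k) = u (r a) (r a) ^+ k.
Proof.
elim: k => [|k IH]; first by rewrite !expr0 star1.
rewrite exprS starM IH (u_star lam_rev eps_sqr F_entry A_COF).
rewrite /star_coef -mulrA (lamC_rev lam_rev) (epsC_sqr eps_sqr) scale1r.
by rewrite -exprSr.
Qed.

Lemma Crnorm_power k : s ^+ k * L2norm h (u (r i0) (r i0) ^+ k) <=
  Crnorm u h (u (r i0) (r i0) ^+ k).
Proof.
set f := u _ _ ^+ k; pose g := u i0 i0 ^+ k.
have ra : r (r i0) != r i0 by rewrite rev_ordK eq_sym.
(* The upper estimate is invoked so that [Crnorm] of f is a supremum of a bounded set, as
   [Crnorm_ge] demands. *)
have [K K0 /(_ k f (Polk_power F_entry _ _ ra))[Pf c0 hf]] := left_mul_bounded.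
have [_ _ /(_ k g (Polk_power F_entry _ _ i0_rev))[Pg _ _]] := left_mul_bounded.
have fg : star g = f by rewrite star_power.
have s0 : 0 < s by apply: lt_trans i0_gt1.
have g0 : 0 < L2norm h g.
  rewrite L2norm_power // sqrtr_gt0; apply: divr_gt0; last exact: qdim_gt0.
  exact: exprn_gt0.
(* The squared norms are s^-k / d_k for f and s^k / d_k for g, because l_(r i0)^2 = s^-1. *)
have -> : s ^+ k * L2norm h f = L2norm h g.
  have inv : lam (r i0) ^+ 2 = s^-1.
    apply: (mulfI (lt0r_neq0 s0)); rewrite mulfV ?gt_eqF //.
    by rewrite -exprMn lam_rev expr2.
  have sk0 : 0 <= s ^+ k by rewrite exprn_ge0 // ltW.
  rewrite !L2norm_power // inv.
  transitivity (Num.sqrt ((s ^+ k) ^+ 2) * Num.sqrt (s^-1 ^+ k / d k)).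
    by rewrite sqrtr_sqr ger0_norm.
  rewrite -sqrtrM ?sqr_ge0 //; congr Num.sqrt; rewrite mulrA; congr (_ / _).
  transitivity (s ^+ k * (s * s^-1) ^+ k); first by rewrite [(s * _) ^+ k]exprMn mulrA -(expr2 (s ^+ k)).
  by rewrite mulfV ?gt_eqF // expr1n mulr1.
have := Crnorm_ge lam_rev eps_sqr i0_rev i0_ge1 F_entry A_COF A_coproduct A_Haar Pf c0 hf Pg.
move=> hfg; rewrite -(ler_pM2r g0); apply: le_trans hfg.
rewrite -expr2 -(L2norm_star_mul lam_rev eps_sqr i0_rev i0_ge1 F_entry A_COF A_coproduct A_Haar Pg) fg.
apply: (Haar_le_L2norm lam_rev eps_sqr i0_rev i0_ge1 F_entry A_COF A_coproduct A_Haar).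
exact: PolM.
Qed.

End OperatorNorms.

(** * Canonical matrices *)

Section CanonicalMatrix.
Variables (R : realType) (N : nat) (lam : 'I_N -> R) (i0 : 'I_N).
Local Notation C := R[i].
Local Notation r := (@rev_ord N).
Hypothesis i0_max : forall i, `|lam i| <= `|lam i0|.
Variable F : 'M[C]_N.
Hypothesis F_entry : forall i j, F i j = (lam i)%:C * (j == r i)%:R.

Lemma mulmx_canonical (x : 'cV[C]_N) i : (F *m x) i 0 = (lam i)%:C * x (r i) 0.
Proof.
rewrite mxE (bigD1 (r i)) //= big1 ?addr0 => [|j /negPf hj]; last first.
  by rewrite F_entry hj mulr0 mul0r.
by rewrite F_entry eqxx mulr1.
Qed.

Lemma l2norm_mul_le (x : 'cV[C]_N) : l2norm (F *m x) <= `|lam i0| * l2norm x.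
Proof.
rewrite /l2norm -[X in X * _]sqrtr_sqr -sqrtrM ?sqr_ge0 //.
rewrite ler_wsqrtr // mulr_sumr.
apply: (@le_trans _ _ (\sum_i lam i0 ^+ 2 * normc (x (r i) 0) ^+ 2)); last first.
  by rewrite (sum_rev (fun i => lam i0 ^+ 2 * normc (x i 0) ^+ 2)).
apply: ler_sum => i _; rewrite mulmx_canonical normcM normc_real exprMn.
rewrite ler_wpM2r ?sqr_ge0 // -[lam i0 ^+ 2]real_normK ?num_real //.
by rewrite ler_pXn2r ?nnegrE.
Qed.

Lemma opnorm_canonical : opnorm F = `|lam i0|.
Proof.
have l2_delta j : l2norm (delta_mx j 0 : 'cV[C]_N) = 1.
  rewrite /l2norm (bigD1 j) //= big1 ?addr0 => [|i /negPf hi].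
    by rewrite mxE !eqxx normc1 expr1n sqrtr1.
  by rewrite mxE hi normc0 expr0n.
have ub : ubound [set l2norm (F *m x) | x in [set x : 'cV[C]_N | l2norm x <= 1]] `|lam i0|.
  move=> _ [x hx <-]; apply: le_trans (l2norm_mul_le x) _.
  by rewrite ler_piMr.
have mem : [set l2norm (F *m x) | x in [set x : 'cV[C]_N | l2norm x <= 1]] `|lam i0|.
  exists (delta_mx (r i0) 0); first by rewrite /= l2_delta.
  have -> : F *m delta_mx (r i0) (0 : 'I_1) = (lam i0)%:C *: delta_mx i0 0.
    apply/matrixP => i j; rewrite ord1 mulmx_canonical !mxE !andbT.
    rewrite (can_eq (@rev_ordK N)).
    by have [->|] := eqVneq i i0; rewrite ?mulr0.
  rewrite /l2norm (bigD1 i0) //= big1 ?addr0 => [|i /negPf hi].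
    by rewrite !mxE !eqxx mulr1 normc_real sqrtr_sqr normr_id.
  by rewrite !mxE hi mulr0 normc0 expr0n.
apply/eqP; rewrite eq_le; apply/andP; split.
  by apply: ge_sup => //; exists `|lam i0|.
by apply: ub_le_sup => //; exists `|lam i0|.
Qed.

End CanonicalMatrix.

(** The last index serves as i0: the ordering makes |l| maximal there, and N >= 2 separates it from
    its opposite. The final dichotomy is whether m is positive or zero. *)
Lemma canonical_F_entries (R : realType) (N : nat) (F0 : 'M[R]_N) :
  (2 <= N)%N -> canonical_F F0 -> exists (lam : 'I_N -> R) (eps : R) (i0 : 'I_N),
  [/\ forall i j, F0 i j = lam i * (j == rev_ord i)%:R,
      (forall i, lam i * lam (rev_ord i) = eps) /\ eps * eps = 1,
      rev_ord i0 != i0,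
      forall i, `|lam i| <= `|lam i0|
    & 1 < `|lam i0| \/ forall i, `|lam i| = 1].
Proof.
move=> hN [lam [hF lam0 hsqr [m [hm h1 h2 h3 h4]]]].
have entry i j : F0 i j = lam i * (j == rev_ord i)%:R.
  rewrite hF summxE (bigD1 i) //= big1 ?addr0 => [|k /negPf hk].
    by rewrite !mxE eqxx.
  by rewrite !mxE eq_sym hk mulr0.
have sqr i : (F0 *m F0) i i = lam i * lam (rev_ord i).
  rewrite mxE (bigD1 (rev_ord i)) //= big1 ?addr0 => [|k /negPf hk].
    by rewrite !entry rev_ordK !eqxx !mulr1.
  by rewrite entry hk mulr0 mul0r.
have lt0 : (N.-1 < N)%N by lia.
pose i0 := Ordinal lt0.
have hi0 : rev_ord i0 != i0 by rewrite -val_eqE /=; lia.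
have [eps heps] : exists eps, (forall i, lam i * lam (rev_ord i) = eps) /\ eps * eps = 1.
  case: hsqr => e; [exists 1 | exists (-1)]; split; rewrite ?mulrNN ?mulr1 // => i;
    by rewrite -sqr e !mxE eqxx.
exists lam, eps, i0; split=> //.
  move=> j; have [hj|hj] := leqP (N - m) j.
    apply: h4; last by rewrite hj orbT.
    by rewrite /=; have := ltn_ord j; lia.
  case: m hm h1 h2 h3 h4 hj => [|m] hm h1 h2 h3 h4 hj.
    by rewrite !h3 ?subn0 /= ?lt0.
  have i0_gt1 : 1 < `|lam i0| by apply: h2; rewrite /=; lia.
  apply: le_trans (ltW i0_gt1); have [hj'|hj'] := ltnP j m.+1; first exact: ltW (h1 _ _).
  by rewrite h3 // hj' hj.
case: m hm h1 h2 h3 h4 => [|m] hm h1 h2 h3 h4; last by left; apply: h2 => /=; lia.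
by right=> i; apply: h3; rewrite subn0 ltn_ord.
Qed.
Theorem corollary3p6 (R : realType) (N : nat) (hN : (2 <= N)%N)
    (F0 : 'M[R]_N) (hF0 : canonical_F F0)
    (F : 'M[R[i]]_N) (hF : F = map_mx (fun x : R => x%:C) F0)
    (A : cstarType R) (u : 'M[A]_N) (hA : is_COF F u)
    (Delta : A -> seq (A * A)) (hDelta : is_coproduct u Delta)
    (h : {scalar A}) (hh : is_Haar_state u Delta h)
    (hKac : ~ Kac_type u h)
    (phi : nat -> R) (hphi : forall k, 0 < phi k) :
  (exists K : R, 0 < K /\
     forall (k : nat) (f : A), Polk F u k f ->
       Crnorm u h f <= K * phi k * L2norm h f)
  <->
  (exists K' : R, 0 < K' /\
     forall k : nat, K' * opnorm F ^+ (2 * k) <= phi k).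
Proof.
have [lam [eps [i0 [F0_entry [lam_rev eps_sqr] i0_rev i0_max gt1]]]] :=
  canonical_F_entries hN hF0.
have F_entry i j : F i j = (lam i)%:C * (j == rev_ord i)%:R.
  by rewrite hF mxE F0_entry castM cast_nat.
(* The alternative, all |l_i| equal to 1, would make h tracial and contradict [hKac]. *)
have i0_sqr : 1 < lam i0 ^+ 2.
  case: gt1 => [gt1|lam1]; first by rewrite -real_normK ?num_real // exprn_egt1.
  case: hKac; have lam2 i : lam i ^+ 2 = 1.
    by rewrite -real_normK ?num_real // lam1 expr1n.
  have ge1 : 1 <= lam i0 ^+ 2 by rewrite lam2.
  exact: (Kac_of_unit lam_rev eps_sqr i0_rev ge1 F_entry hA hDelta hh lam2).
have max_sqr i : lam i ^+ 2 <= lam i0 ^+ 2.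
  rewrite -[lam i ^+ 2]real_normK ?num_real // -[lam i0 ^+ 2]real_normK ?num_real //.
  by rewrite ler_pXn2r ?nnegrE.
have opnormE k : opnorm F ^+ (2 * k) = lam i0 ^+ 2 ^+ k.
  by rewrite (opnorm_canonical i0_max F_entry) exprM real_normK ?num_real.
have s0 : 0 < lam i0 ^+ 2 by apply: lt_trans i0_sqr.
split=> [[K [K0 hK]]|[K' [K'0 hK']]].
  exists K^-1; split=> [|k]; first by rewrite invr_gt0.
  have ra : rev_ord (rev_ord i0) != rev_ord i0 by rewrite rev_ordK eq_sym.
  have := hK k _ (Polk_power F_entry u k ra).
  move=> /(le_trans (Crnorm_power lam_rev eps_sqr i0_rev i0_sqr max_sqr F_entry hA hDelta hh k)).
  (* The L^2 norm of the test power is cancelled; it is positive because l_(r i0) is nonzero, as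
     eps^2 = 1. *)
  rewrite ler_pM2r => [hk|]; last first.
    rewrite (L2norm_power lam_rev eps_sqr i0_rev i0_sqr F_entry hA hDelta hh) //.
    rewrite sqrtr_gt0; apply: divr_gt0.
      apply: exprn_gt0; rewrite exprn_even_gt0 //=; apply/eqP => l0.
      have := eps_sqr; rewrite -(lam_rev i0) l0 mulr0 mul0r => /eqP.
      by rewrite eq_sym oner_eq0.
    exact: (qdim_gt0 lam_rev eps_sqr i0_rev (ltW i0_sqr)).
  by rewrite opnormE mulrC ler_pdivrMr // mulrC.
have [K K0 hK] :=
  left_mul_bounded lam_rev eps_sqr i0_rev i0_sqr max_sqr F_entry hA hDelta hh.
(* K is the constant of the bound K s^k |f|, and condition (2) gives s^k <= phi k / K'. *)
exists (K / K'); split=> [|k f /hK[Pf c0 hf]]; first exact: divr_gt0.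
apply: le_trans (Crnorm_le lam_rev eps_sqr i0_rev (ltW i0_sqr) F_entry hA hDelta hh Pf c0 hf) _.
rewrite ler_wpM2r ?sqrtr_ge0 // -mulrA ler_pM2l // mulrC ler_pdivlMr //.
by rewrite mulrC -opnormE.
Qed.
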